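(* Let $p$ be a prime with $p\equiv 3\pmod 4$, $p\ne 3$, and let $v$ be a primitive root modulo $p$. If $h$ is an odd prime dividing the class number $h(\mathbb{Q}(\sqrt{-p}))$, then $$\sum_{\substack{0\le i\le p-2\\ v_{-i}\text{ even}}}(-1)^i\ne 0\qquad\text{and}\qquad\sum_{\substack{0\le i\le p-2\\ v_{-i}\text{ even}}}(-1)^i\equiv 0\pmod h.$$
   Context: For $n\in\mathbb{Z}$, $v_n$ denotes the integer with $v_n\equiv v^n\pmod p$ and $1\le v_n\le p-1$. *)

(* Defs.v *)
From mathcomp Require Import all_boot all_order all_algebra all_field.
From mathcomp Require Import boolp classical_sets functions cardinality.

Set Implicit Arguments.
Unset Strict Implicit.
Unset Printing Implicit Defensive.

Import GRing.Theory.
Local Open Scope classical_set_scope.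
Local Open Scope card_scope.
Local Open Scope ring_scope.

Definition ring_of_integers (L : fieldExtType rat) : set L :=
  [set x | integralOver (intr : int -> L) x].
Arguments ring_of_integers L : clear implicits.

(* An ideal of the ring of integers is encoded as a subset of the field L. *)
Definition nonzero_ideal (L : fieldExtType rat) (I : set L) : Prop :=
  [/\ I `<=` ring_of_integers L,
      I 0,
      (forall x y, I x -> I y -> I (x + y)),
      (forall a x, ring_of_integers L a -> I x -> I (a * x)) &
      exists2 x, I x & x != 0].

Definition ideal_equiv (L : fieldExtType rat) (I J : set L) : Prop :=
  exists a b : L,
    [/\ ring_of_integers L a, ring_of_integers L b, a != 0, b != 0 &
        [set a * x | x in I] = [set b * y | y in J]].

Definition ideal_class (L : fieldExtType rat) (I : set L) : set (set L) :=
  [set J | nonzero_ideal J /\ ideal_equiv I J].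

Definition ideal_classes (L : fieldExtType rat) : set (set (set L)) :=
  [set ideal_class I | I in @nonzero_ideal L].
Arguments ideal_classes L : clear implicits.

(* A relation rather than a function, so that no default value is needed
   ahead of the finiteness theorem. *)
Definition is_class_number (L : fieldExtType rat) (N : nat) : Prop :=
  ideal_classes L #= `I_N.

(* L is a copy of Q(sqrt d), possibly Q itself when d is a square. *)
Definition is_Q_sqrt (L : fieldExtType rat) (d : int) : Prop :=
  exists2 s : L, s ^+ 2 = d%:~R & <<1; s>>%VS = fullv.

Definition primitive_root_mod (p : nat) (v : int) : Prop :=
  p.-1.-primitive_root (v%:~R : 'F_p).

(* The representative of v ^ n mod p in {0, ..., p - 1}; for p prime and v
   prime to p it is nonzero, and negative n use the inverse of v mod p. *)
Definition residue_pow (p : nat) (v n : int) : nat :=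
  val ((v%:~R : 'F_p) ^ n).

(* Main.v *)
(** The sum equals the sum S of the Legendre symbol chi over the even residues
    modulo p, and reindexing by a |-> 2a and a |-> p - a turns S into
    - (2 chi(2) - 1) A / p with A = sum_(a < p) a chi(a).  So it is enough to
    prove the class number formula N = - A / p.

    For each of the N ideal classes choose an ideal Z a + Z (b + w); its norm
    form Q = (a, 2b+1, c) has discriminant -p.  For n > 0 the forms together
    represent n twice as often as there are ideals of norm n, that is
    2 sum_(d | n) chi(d) times.  Weighting n by (X - n)^3 for n < X gives
      sum_Q T_Q(X) = N X^3 + 2 U(X),
    where T_Q(X) is the sum of (X - Q(v))^3 over the lattice points of the
    ellipse Q < X, and U(X) is the sum over d, m > 0, d m < X, of
    chi(d) (X - d m)^3.

    Comparing X with 4X removes the leading X^4 terms: 256 T_Q(X) - T_Q(4X) is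
    O(X^(5/2)), because the cosets of 2Z^2 in Z^2 contribute almost equally,
    while 256 U(X) - U(4X) = (96 A / p) X^3 + o(X^3).  Hence
    192 (N + A / p) X^3 = o(X^3).  Everything is an inequality between
    integers; neither pi nor L(1, chi) occurs. *)

Require Import Defs.
From mathcomp Require Import boolp classical_sets functions cardinality.
From mathcomp Require Import all_boot all_order all_algebra all_fingroup.
From mathcomp Require Import all_solvable all_field.
From mathcomp Require Import zify ring lra.

Set Implicit Arguments.
Unset Strict Implicit.
Unset Printing Implicit Defensive.

Import Order.TTheory GRing.Theory Num.Theory.
Local Open Scope ring_scope.

(** * Smoothed lattice point sums *)

(** Why the weight is a cube: the [k]-th difference of [(X - Q)^k], cut off at 0, along a fixed
    vector is [O(X^(k/2))] at each of [O(X)] lattice points, and the error [O(X^(k/2+1))] is below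
    the class number term [N X^k] only for [k > 2]. Why 4: since [Q(2v) = 4 Q(v)], the sum at [X] is
    a multiple of the part over [2Z^2] of the sum at [4X], so the area of the ellipse never enters.
    On the other side [256 = 4^4] cancels the term [X^4 / (4d)] contributed by the multiples of each
    [d]. The sum over [d] in [U] is cut near [X^(5/8)]. Below a cut at [X^t] the errors [O(d^3)] add
    up to [o(X^3)] if [t < 3/4]; above it the errors [O(m X^2)], for [m] up to about [X^(1-t)], do
    so if [t > 1/2]. Taking [X = Z^8] keeps all these powers integral. The passage from ideals to
    [chi] is quadratic reciprocity. Counting roots of [b^2 + b + m], rather than asking whether [-p]
    is a square, puts the prime 2 on the same footing as the others. *)

Section PositivePartCube.
Variable R : realDomainType.
Implicit Types u d a b k Y : R.

Definition pos3 (u : R) : R := Num.max u 0 ^+ 3.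

Lemma pos3_ge0 u : 0 <= u -> pos3 u = u ^+ 3.
Proof. by move=> u0; rewrite /pos3 max_l. Qed.

Lemma pos3_le0 u : u <= 0 -> pos3 u = 0.
Proof. by move=> u0; rewrite /pos3 max_r // expr0n. Qed.

Lemma pos3_nneg u : 0 <= pos3 u.
Proof. by rewrite exprn_ge0 // le_max lexx orbT. Qed.

(** [pos3] is twice differentiable with the Lipschitz second derivative [6 * Num.max u 0], so the
    second order Taylor estimate survives the kink at 0. The four cases are the signs of [u] and
    [u + d]. *)
Lemma pos3_taylor u d :
  `|pos3 (u + d) - pos3 u - 3 * Num.max u 0 ^+ 2 * d - 3 * Num.max u 0 * d ^+ 2|
  <= `|d| ^+ 3.
Proof.
have [u0|u0] := leP 0 u; have [w0|w0] := leP 0 (u + d).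
- rewrite !pos3_ge0 //.
  have -> : (u + d) ^+ 3 - u ^+ 3 - 3 * u ^+ 2 * d - 3 * u * d ^+ 2 = d ^+ 3 by ring.
  by rewrite normrX.
- rewrite (pos3_le0 (ltW w0)) pos3_ge0 //.
  have d0 : d <= 0 by lra.
  have: (- (u + d)) ^+ 3 >= 0 by apply: exprn_ge0; lra.
  have: (- (u + d)) ^+ 3 <= (- d) ^+ 3 by rewrite lerXn2r ?nnegrE; lra.
  have : (- d) ^+ 3 >= 0 by apply: exprn_ge0; lra.
  rewrite (ler0_norm d0) ler_norml => h1 h2 h3; apply/andP; split; by lra.
- rewrite (pos3_le0 (ltW u0)) pos3_ge0 //.
  have d0 : 0 <= d by lra.
  rewrite !(expr0n, mulr0, mul0r, subr0) /= ger0_norm ?exprn_ge0 //.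
  by rewrite ger0_norm // lerXn2r ?nnegrE; lra.
- rewrite (pos3_le0 (ltW u0)) (pos3_le0 (ltW w0)) !(expr0n, mulr0, mul0r, subr0) /= normr0.
  by rewrite exprn_ge0.
Qed.

(* Along the progression u + j a + j^2 b, where a = O(Y) and b = O(1), the third
   difference annihilates the linear term of the Taylor expansion. *)
Lemma pos3_diff3 Y k u a b : 1 <= Y -> 0 <= k ->
  u <= 4 * Y ^+ 2 -> `|a| <= k * Y -> `|b| <= k ->
  `|pos3 (u + (3 * a + 9 * b)) - 3 * pos3 (u + (2 * a + 4 * b))
      + 3 * pos3 (u + (a + b)) - pos3 u|
   <= (576 * k ^+ 2 + 12096 * k ^+ 3) * Y ^+ 3.
Proof.
move=> Y1 k0 uY aY bk.
set P := Num.max u 0.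
have P0 : 0 <= P by rewrite le_max lexx orbT.
have Y0 : 0 <= Y by lra.
have PY : P <= 4 * Y ^+ 2 by rewrite ge_max uY mulr_ge0 // exprn_ge0.
have kY : k <= k * Y by rewrite ler_peMr.
have E (c1 c2 : R) : 0 <= c1 -> 0 <= c2 -> c1 + c2 <= 12 ->
  `|c1 * a + c2 * b| ^+ 3 <= 12 ^+ 3 * (k ^+ 3 * Y ^+ 3).
  move=> h1 h2 h3; rewrite -!exprMn lerXn2r ?nnegrE ?mulr_ge0 //.
  apply: le_trans (ler_normD _ _) _; rewrite !normrM (ger0_norm h1) (ger0_norm h2).
  apply: (@le_trans _ _ (c1 * (k * Y) + c2 * (k * Y))).
    by apply: lerD; apply: ler_wpM2l => //; apply: le_trans kY.
  by rewrite -mulrDl; apply: ler_wpM2r => //; rewrite mulr_ge0.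
have e3 := le_trans (pos3_taylor u (3 * a + 9 * b)) (E 3 9 ltac:(lra) ltac:(lra) ltac:(lra)).
have e2 := le_trans (pos3_taylor u (2 * a + 4 * b)) (E 2 4 ltac:(lra) ltac:(lra) ltac:(lra)).
have e1 := le_trans (pos3_taylor u (1 * a + 1 * b)) (E 1 1 ltac:(lra) ltac:(lra) ltac:(lra)).
rewrite !mul1r in e1.
rewrite -/P in e1 e2 e3.
(* In the third difference of the quadratic Taylor terms [a ^+ 2] also cancels, leaving
   [12 * a * b + 36 * b ^+ 2]; hence [576 = 3 * 4 * 48]. The remainders enter with weights 1, 3, 3,
   whence [12096 = 7 * 12 ^ 3]. *)
have ab : `|3 * P * (12 * a * b + 36 * b ^+ 2)| <= 576 * (k ^+ 2 * Y ^+ 3).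
  rewrite !normrM (ger0_norm P0) /=.
  have : `|12 * a * b + 36 * b ^+ 2| <= 48 * (k ^+ 2 * Y).
    apply: le_trans (ler_normD _ _) _; rewrite expr2 !normrM.
    have : `|a| * `|b| <= k * Y * k by apply: ler_pM.
    have : `|b| * `|b| <= k * (k * Y) by apply: ler_pM => //; apply: le_trans kY.
    rewrite !normr_nat; set s := `|a| * `|b|; set t := `|b| * `|b| => ht hs.
    have -> : 12 * `|a| * `|b| = 12 * s by rewrite /s; ring.
    by lra.
  move=> h; have := ler_pM P0 (normr_ge0 _) PY h.
  rewrite normr_nat.
  set t := `|_|; move: t => t; set z := P * t => hz.
  have -> : 3 * P * t = 3 * z by rewrite /z; ring.
  by lra.
move: ab e1 e2 e3; rewrite !ler_norml => /andP[ab1 ab2] /andP[e11 e12] /andP[e21 e22] /andP[e31 e32].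
by apply/andP; split; lra.
Qed.
End PositivePartCube.

(* The range is -B <= x < B, so that doubling B splits it exactly by parity. *)
Definition zsum (B : nat) (f : int -> int) : int :=
  \sum_(i < 2 * B) f (i%:Z - B%:Z).

Definition zsum2 (B : nat) (f : int -> int -> int) : int :=
  zsum B (fun x => zsum B (f x)).

Lemma eq_zsum B f g : f =1 g -> zsum B f = zsum B g.
Proof. by move=> fg; apply: eq_bigr => i _; rewrite fg. Qed.

Lemma zsumD B f g : zsum B (fun x => f x + g x) = zsum B f + zsum B g.
Proof. by rewrite /zsum big_split. Qed.

Lemma zsumM B c f : zsum B (fun x => c * f x) = c * zsum B f.
Proof. by rewrite /zsum mulr_sumr. Qed.

Lemma zsum0 B : zsum B (fun=> 0) = 0.
Proof. by rewrite /zsum big1. Qed.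

Lemma zsum_shift B f : f (- B%:Z) = 0 -> f B%:Z = 0 ->
  zsum B (fun x => f (x + 1)) = zsum B f.
Proof.
move=> f0 f1; rewrite /zsum -(big_mkord xpredT (fun i : nat => f (i%:Z - B%:Z + 1))).
rewrite -(big_mkord xpredT (fun i : nat => f (i%:Z - B%:Z))).
have [->|B0] := posnP B; first by rewrite !big_geq.
rewrite [RHS]big_ltn ?muln_gt0 // sub0r f0 add0r.
rewrite -[X in index_iota 1 X](@prednK (2 * B)) ?muln_gt0 //.
rewrite -[X in index_iota 0 X](@prednK (2 * B)) ?muln_gt0 //.
rewrite big_nat_recr //= big_add1 /= [X in _ + X](_ : _ = 0) ?addr0.
  by apply: eq_bigr => i _; congr f; lia.
by rewrite -f1; congr f; lia.
Qed.

Lemma zsum_double B f :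
  zsum (2 * B) f = zsum B (fun x => f (2 * x) + f (2 * x + 1)).
Proof.
rewrite /zsum -(big_mkord xpredT (fun i : nat => f (i%:Z - (2 * B)%:Z))).
rewrite -(big_mkord xpredT (fun i : nat => f (2 * (i%:Z - B%:Z)) + f (2 * (i%:Z - B%:Z) + 1))).
elim: {1 3}(2 * B)%N => [|n IHn]; first by rewrite !big_geq.
rewrite mulnS !addSn add0n !big_nat_recr //= IHn -addrA; congr (_ + (f _ + f _)); lia.
Qed.

Lemma zsum_le B f (C : int) : (forall x, - B%:Z <= x <= B%:Z -> `|f x| <= C) ->
  `|zsum B f| <= (2 * B)%:Z * C.
Proof.
move=> fC; apply: le_trans (ler_norm_sum _ _ _) _.
have -> : (2 * B)%:Z * C = \sum_(i < 2 * B) C.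
  by rewrite sumr_const card_ord -mulr_natl natz.
by apply: ler_sum => i _; apply: fC; have := ltn_ord i; lia.
Qed.

Lemma eq_zsum2 B f g : (forall x y, f x y = g x y) -> zsum2 B f = zsum2 B g.
Proof. by move=> fg; apply: eq_zsum => x; apply: eq_zsum. Qed.

Lemma zsum2D B f g :
  zsum2 B (fun x y => f x y + g x y) = zsum2 B f + zsum2 B g.
Proof. by rewrite /zsum2 -zsumD; apply: eq_zsum => x; rewrite zsumD. Qed.

Lemma zsum2M B c f : zsum2 B (fun x y => c * f x y) = c * zsum2 B f.
Proof. by rewrite /zsum2 -zsumM; apply: eq_zsum => x; rewrite zsumM. Qed.

Lemma zsum2_double B f : zsum2 (2 * B) f =
  zsum2 B (fun x y => f (2 * x) (2 * y) + f (2 * x) (2 * y + 1)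
                + (f (2 * x + 1) (2 * y) + f (2 * x + 1) (2 * y + 1))).
Proof.
rewrite /zsum2 zsum_double; apply: eq_zsum => x.
by rewrite !zsum_double -zsumD.
Qed.

(** Vanishing is asked at [B] as well as at [- B]: a shift by 1 drops the value at [- B] from the
    range and brings in the one at [B]. *)
Definition box_supported (B : nat) (f : int -> int -> int) :=
  forall x y, (B%:Z <= `|x|) || (B%:Z <= `|y|) -> f x y = 0.

Lemma zsum2_shift B f (w1 w2 : bool) : box_supported B f ->
  zsum2 B (fun x y => f (x + w1%:R) (y + w2%:R)) = zsum2 B f.
Proof.
move=> fB; have nB : `|- B%:Z| = B%:Z by rewrite normrN ger0_norm.
have nB' : `|B%:Z| = B%:Z by rewrite ger0_norm.
transitivity (zsum2 B (fun x y => f (x + w1%:R) y)).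
  apply: eq_zsum => x; case: w2 => /=; last by apply: eq_zsum => y; rewrite addr0.
  by rewrite zsum_shift //; apply: fB; rewrite ?nB ?nB' lexx orbT.
case: w1 => /=; last by apply: eq_zsum => x; rewrite addr0.
rewrite /zsum2 (zsum_shift (f := fun x => zsum B (f x))) //.
  by rewrite -(zsum0 B); apply: eq_zsum => y; apply: fB; rewrite nB lexx.
by rewrite -(zsum0 B); apply: eq_zsum => y; apply: fB; rewrite nB' lexx.
Qed.

Lemma zsum2_le B f (C : int) :
  (forall x y, `|x| <= B%:Z -> `|y| <= B%:Z -> `|f x y| <= C) ->
  `|zsum2 B f| <= (2 * B)%:Z ^+ 2 * C.
Proof.
move=> fC; rewrite expr2 -mulrA; apply: zsum_le => x xB; apply: zsum_le => y yB.
by apply: fC; lia.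
Qed.

Section QuadraticForm.
Variables a b c : int.
Hypotheses (a_gt0 : 0 < a) (c_gt0 : 0 < c) (disc_gt0 : 0 < 4 * a * c - b ^+ 2).

Definition qf (x y : int) : int := a * x ^+ 2 + b * x * y + c * y ^+ 2.

(** The discriminant is a positive integer, so completing the square gives
    [x ^+ 2 <= 4 * c * qf x y] and [y ^+ 2 <= 4 * a * qf x y]. The bound is [4 * Y ^+ 2], not
    [Y ^+ 2], so that the same box serves for the cut at [4 * Y ^+ 2]. *)
Lemma qf_box (K : nat) (Y x y : int) : 4 * (a + c) <= K%:Z -> 0 <= Y ->
  (K%:Z * Y <= `|x|) || (K%:Z * Y <= `|y|) -> 4 * Y ^+ 2 <= qf x y.
Proof.
move=> hK Y0 hxy.
have E1 : 4 * a * qf x y = (2 * a * x + b * y) ^+ 2 + (4 * a * c - b ^+ 2) * y ^+ 2.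
  by rewrite /qf; ring.
have E2 : 4 * c * qf x y = (2 * c * y + b * x) ^+ 2 + (4 * a * c - b ^+ 2) * x ^+ 2.
  by rewrite /qf; ring.
have big (z : int) : K%:Z * Y <= `|z| -> 16 * (a + c) ^+ 2 * Y ^+ 2 <= (4 * a * c - b ^+ 2) * z ^+ 2.
  move=> hz; apply: (@le_trans _ _ (1 * z ^+ 2)); last by rewrite ler_wpM2r ?sqr_ge0 //; lia.
  rewrite mul1r -(real_normK (num_real z)).
  have -> : 16 * (a + c) ^+ 2 * Y ^+ 2 = (4 * (a + c) * Y) ^+ 2 by ring.
  rewrite lerXn2r ?nnegrE ?mulr_ge0 //; try lia.
  by apply: le_trans hz; rewrite ler_wpM2r.
have comp (u q s : int) : 0 < u -> u <= a + c -> 0 <= s ->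
   16 * (a + c) ^+ 2 * Y ^+ 2 <= s -> 4 * u * q = s -> 4 * Y ^+ 2 <= q.
  move=> u0 uac s0 hs E.
  have : 4 * u * (4 * Y ^+ 2) <= 4 * u * q.
    rewrite E; apply: le_trans hs.
    have -> : 4 * u * (4 * Y ^+ 2) = 16 * (u * Y ^+ 2) by ring.
    rewrite -mulrA ler_wpM2l // ler_wpM2r ?sqr_ge0 //.
    rewrite expr2; apply: le_trans uac _; rewrite ler_peMl //; lia.
  by rewrite ler_pM2l // mulr_gt0.
case/orP: hxy => /big h.
- apply: comp E2 => //; [by rewrite lerDr ltW| |].
    by rewrite addr_ge0 ?sqr_ge0 // mulr_ge0 ?sqr_ge0 // ltW.
  by apply: le_trans h _; rewrite lerDr sqr_ge0.
- apply: comp E1 => //; [by rewrite lerDl ltW| |].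
    by rewrite addr_ge0 ?sqr_ge0 // mulr_ge0 ?sqr_ge0 // ltW.
  by apply: le_trans h _; rewrite lerDr sqr_ge0.
Qed.

Variable K : nat.
Hypothesis K_large : 4 * (a + c) <= K%:Z.

(** The sum [T_Q(X)] at the square [X = Y ^ 2], for which the ellipse fits in a box of integral side
    proportional to [Y]. *)
Definition lattice_sum (Y : nat) : int :=
  zsum2 (K * Y) (fun x y => pos3 (Y%:Z ^+ 2 - qf x y)).

Lemma qf_shift (x y w1 w2 j : int) : qf (2 * x + j * w1) (2 * y + j * w2) =
  qf (2 * x) (2 * y) + j * (4 * a * x * w1 + 2 * b * (x * w2 + y * w1) + 4 * c * y * w2)
   + j ^+ 2 * qf w1 w2.
Proof. by rewrite /qf; ring. Qed.

Let k : int := 16 * K%:Z * (a + `|b| + c).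

Lemma k_ge0 : 0 <= k.
Proof. by rewrite /k !mulr_ge0 //; lia. Qed.

Let cut (Y : nat) (x y : int) : int := pos3 (4 * Y%:Z ^+ 2 - qf x y).

(* Shifting by 2w permutes 2Z^2, so the alternating sum 1, 3, 3, 1 over the
   cosets 2v + j w collapses to four times the difference of two cosets. *)
Lemma coset_sum (Y : nat) (w1 w2 : bool) (f := cut Y) : (0 < Y)%N ->
  `|4 * zsum2 (K * Y) (fun x y => f (2 * x + w1%:R) (2 * y + w2%:R)
                                  - f (2 * x) (2 * y))|
  <= (2 * (K * Y))%:Z ^+ 2 * ((576 * k ^+ 2 + 12096 * k ^+ 3) * Y%:Z ^+ 3).
Proof.
move=> Y0; set B := (K * Y)%N.
have K0 : (1 <= K)%N by lia.
have B1 : (1 <= B)%N by rewrite muln_gt0 K0 Y0.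
pose g (j : int) x y := f (2 * x + j * w1%:R) (2 * y + j * w2%:R).
(* Outside the box the argument of [f] has a coordinate of size at least [2 * B - 1], which is still
   at least [B]. *)
have g0 (j : int) : 0 <= j <= 1 -> box_supported B (g j).
  move=> hj x y hxy; rewrite /g /f /cut pos3_le0 // subr_le0.
  apply: (@qf_box K) => //.
  have -> : K%:Z * Y%:Z = B%:Z by rewrite -PoszM.
  have {hj} hj : j = 0 \/ j = 1 by lia.
  by case: hj hxy => ->; case: (w1); case: (w2); lia.
have sh (j : int) : 0 <= j <= 1 -> zsum2 B (g (j + 2)) = zsum2 B (g j).
  move=> hj; rewrite -(@zsum2_shift B (g j) w1 w2 (g0 j hj)); apply: eq_zsum2 => x y.
  by rewrite /g; congr f; ring.
have -> : 4 * zsum2 B (fun x y => f (2 * x + w1%:R) (2 * y + w2%:R) - f (2 * x) (2 * y))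
   = zsum2 B (fun x y => g 3 x y - 3 * g 2 x y + 3 * g 1 x y - g 0 x y).
  rewrite (@eq_zsum2 B (fun x y => f _ _ - _) (fun x y => g 1 x y + (-1) * g 0 x y)); last first.
    by move=> x y; rewrite /g !mul1r !mul0r !addr0 mulN1r.
  rewrite (@eq_zsum2 B (fun x y => g 3 x y - _ + _ - _)
     (fun x y => g 3 x y + (-3) * g 2 x y + 3 * g 1 x y + (-1) * g 0 x y)); last first.
    by move=> x y; rewrite mulN1r mulNr.
  by rewrite !zsum2D !zsum2M (sh 1) // (sh 0) //; ring.
apply: zsum2_le => x y xB yB.
set al := - (4 * a * x * w1%:R + 2 * b * (x * w2%:R + y * w1%:R) + 4 * c * y * w2%:R).
set be := - qf w1%:R w2%:R.
set u := 4 * Y%:Z ^+ 2 - qf (2 * x) (2 * y).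
have E j : g j x y = pos3 (u + (j * al + j ^+ 2 * be)).
  by rewrite /g /f /cut qf_shift /u /al /be; congr pos3; ring.
have KYB : B%:Z = K%:Z * Y%:Z by rewrite /B PoszM.
have -> : g 3 x y - 3 * g 2 x y + 3 * g 1 x y - g 0 x y =
   pos3 (u + (3 * al + 9 * be)) - 3 * pos3 (u + (2 * al + 4 * be))
      + 3 * pos3 (u + (al + be)) - pos3 u.
  by rewrite !E; congr (pos3 _ - 3 * pos3 _ + 3 * pos3 _ - pos3 _); ring.
have bb : 0 <= `|b| by [].
have posm (s t : int) : 0 <= s -> `|t| <= B%:Z -> `|s * t| <= s * B%:Z.
  by move=> s0 tB; rewrite normrM ger0_norm // ler_wpM2l.
have nB (t : int) : `|t| <= B%:Z -> `|b * t| <= `|b| * B%:Z.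
  by move=> tB; rewrite normrM ler_wpM2l.
apply: pos3_diff3; rewrite ?k_ge0 //.
- rewrite /u lerBlDr lerDl.
  have := @qf_box K 0 (2 * x) (2 * y) K_large (lexx _).
  by rewrite mulr0 normr_ge0 expr0n mulr0; apply.
- rewrite /al /k normrN.
  have -> : 16 * K%:Z * (a + `|b| + c) * Y%:Z = 16 * (a * B%:Z) + 16 * (`|b| * B%:Z) + 16 * (c * B%:Z).
    by rewrite KYB; ring.
  have h1 := posm a x (ltW a_gt0) xB; have h2 := posm c y (ltW c_gt0) yB.
  have h3 := nB x xB; have h4 := nB y yB.
  have -> : 4 * a * x * w1%:R + 2 * b * (x * w2%:R + y * w1%:R) + 4 * c * y * w2%:R
    = 4 * (a * x) * w1%:R + 2 * (b * x) * w2%:R + 2 * (b * y) * w1%:R + 4 * (c * y) * w2%:R.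
    by ring.
  move: h1 h2 h3 h4; move: (a * x) (c * y) (b * x) (b * y) (a * B%:Z) (c * B%:Z) (`|b| * B%:Z).
  by move=> *; case: (w1); case: (w2); lia.
- rewrite /be normrN /k /qf.
  have h : a + `|b| + c <= 16 * K%:Z * (a + `|b| + c).
    by rewrite ler_peMl //; lia.
  apply: le_trans h.
  by case: (w1); case: (w2); rewrite /= ?(expr0n, expr1n, mulr1, mulr0, addr0, add0r) /=; lia.
Qed.

(** By homogeneity [64 = 4 ^ 3] times the sum at [Y] is the part of the sum at [2 * Y] over the
    trivial coset of [2Z^2]. Multiplying by 256 replaces each of the four cosets by that one, and
    [coset_sum] bounds the replacement: [O(Y^2)] points with error [O(Y^3)] each. *)
Lemma lattice_sum_doubling : exists C : int, forall Y : nat, (0 < Y)%N ->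
  `|256 * lattice_sum Y - lattice_sum (2 * Y)| <= C * Y%:Z ^+ 5.
Proof.
exists (4 * ((2 * K)%:Z ^+ 2 * (576 * k ^+ 2 + 12096 * k ^+ 3))) => Y Y0.
have cs := @coset_sum Y _ _ Y0.
pose f := cut Y.
pose D w1 w2 := zsum2 (K * Y) (fun x y => f (2 * x + (w1 : bool)%:R) (2 * y + (w2 : bool)%:R)
                                  - f (2 * x) (2 * y)).
have e0 : lattice_sum Y = zsum2 (K * Y) (fun x y => pos3 (Y%:Z ^+ 2 - qf x y)) by [].
have E : lattice_sum (2 * Y) - 256 * lattice_sum Y
         = D false false + D false true + D true false + D true true.
  rewrite /lattice_sum mulnCA zsum2_double -[RHS]addr0.
  set T := zsum2 (K * Y) (fun x y => pos3 (Y%:Z ^+ 2 - qf x y)).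
  have <- : zsum2 (K * Y) (fun x y => 256 * pos3 (Y%:Z ^+ 2 - qf x y)) = 256 * T.
    by rewrite zsum2M.
  have E64 x y : 64 * pos3 (Y%:Z ^+ 2 - qf x y) = f (2 * x) (2 * y).
    rewrite /f /cut; have -> : 4 * Y%:Z ^+ 2 - qf (2 * x) (2 * y) = 4 * (Y%:Z ^+ 2 - qf x y).
      by rewrite /qf; ring.
    have [h|h] := leP 0 (Y%:Z ^+ 2 - qf x y).
      by rewrite !pos3_ge0 ?mulr_ge0 //; ring.
    by rewrite !pos3_le0 ?mulr0 //; lia.
  rewrite /D -!zsum2D addr0 -[X in _ - X]mul1r -mulNr -zsum2M -zsum2D; apply: eq_zsum2 => x y.
  rewrite /= !addr0 -!E64 PoszM exprMn /=.
  rewrite -/(f (2 * x) (2 * y + 1)) -/(f (2 * x + 1) (2 * y)).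
  have -> : pos3 (2%:Z ^+ 2 * Y%:Z ^+ 2 - qf (2 * x) (2 * y)) = f (2 * x) (2 * y) by [].
  by rewrite -E64; ring.
have hD w1 w2 : `|4 * D w1 w2| <= (2 * (K * Y))%:Z ^+ 2 * ((576 * k ^+ 2 + 12096 * k ^+ 3) * Y%:Z ^+ 3).
  exact: cs.
rewrite distrC E.
have -> : 4 * ((2 * K)%:Z ^+ 2 * (576 * k ^+ 2 + 12096 * k ^+ 3)) * Y%:Z ^+ 5
   = 4 * ((2 * (K * Y))%:Z ^+ 2 * ((576 * k ^+ 2 + 12096 * k ^+ 3) * Y%:Z ^+ 3)).
  by rewrite !PoszM; ring.
move: (hD false false) (hD false true) (hD true false) (hD true true).
move: (D false false) (D false true) (D true false) (D true true) => d1 d2 d3 d4.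
move: ((2 * (K * Y))%:Z ^+ 2 * ((576 * k ^+ 2 + 12096 * k ^+ 3) * Y%:Z ^+ 3)) => M.
by lia.
Qed.

End QuadraticForm.

(** * Character sums *)

Lemma PoszX (n k : nat) : (n ^ k)%N%:Z = n%:Z ^+ k.
Proof. by rewrite -[LHS]natz natrX natz. Qed.

Lemma sum_by_parts (R : comPzRingType) (f h : nat -> R) (M : nat) :
  \sum_(i < M) f i * h i = (\sum_(i < M) f i) * h M
    + \sum_(n < M) (\sum_(i < n.+1) f i) * (h n - h n.+1).
Proof.
elim: M => [|M IH]; first by rewrite !big_ord0 mul0r addr0.
rewrite [LHS]big_ord_recr /= IH [in RHS]big_ord_recr /=.
rewrite [X in _ = _ + X]big_ord_recr /= (big_ord_recr M) /=.
by ring.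
Qed.

Lemma sum_ord_split (V : nmodType) (f : nat -> V) (m n : nat) : (m <= n)%N ->
  \sum_(i < n) f i = \sum_(i < m) f i + \sum_(i < n - m) f (m + i)%N.
Proof. by move=> mn; rewrite -[in LHS](subnKC mn) big_split_ord. Qed.

Lemma periodic_sum (V : zmodType) (f : nat -> V) (q n : nat) :
  (forall i, f (i + q)%N = f i) -> \sum_(i < q) f i = 0 ->
  \sum_(i < n) f i = \sum_(i < n %% q) f i.
Proof.
move=> per f0; have E k r : \sum_(i < k * q + r) f i = \sum_(i < r) f i.
  elim: k => [//|k IH]; rewrite mulSn -addnA big_split_ord /= f0 add0r -IH.
  by apply: eq_bigr => i _; rewrite addnC per.
by rewrite -[in RHS](E (n %/ q)%N) -divn_eq.
Qed.

Lemma periodic_sum_bound (R : numDomainType) (f : nat -> R) (q n : nat) : (0 < q)%N ->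
  (forall i, f (i + q)%N = f i) -> \sum_(i < q) f i = 0 ->
  `|\sum_(i < n) f i| <= \sum_(i < q) `|f i|.
Proof.
move=> q0 per f0; rewrite (periodic_sum n per f0).
apply: le_trans (ler_norm_sum _ _ _) _.
have /ltnW le := ltn_pmod n q0.
rewrite -[in leRHS](subnKC le) big_split_ord /= lerDl; apply: sumr_ge0 => i _; exact: normr_ge0.
Qed.

Section Character.
Variables (p : nat) (chi : nat -> int).
Hypotheses (p_gt0 : (0 < p)%N)
  (chi_per : forall n, chi (n + p)%N = chi n)
  (chi_sum : \sum_(a < p) chi a = 0).

Definition first_moment : int := \sum_(a < p) a%:Z * chi a.
Local Notation A := first_moment.

(* The partial sums of chi have mean - A / p over a period. *)
Let e (n : nat) : int := p%:Z * (\sum_(i < n.+1) chi i) + A.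

Lemma centered_per n : e (n + p) = e n.
Proof.
rewrite /e; congr (_ * _ + _); rewrite -addSn addnC big_split_ord /= chi_sum add0r.
by apply: eq_bigr => i _; rewrite addnC chi_per.
Qed.

Lemma centered_sum : \sum_(n < p) e n = 0.
Proof.
rewrite big_split /= -mulr_sumr sumr_const card_ord -mulr_natl natz -mulrDr.
have := sum_by_parts chi (fun n => n%:Z) p; rewrite chi_sum mul0r add0r => E.
suff -> : \sum_(i < p) \sum_(i0 < i.+1) chi i0 = - A.
  by rewrite addNr mulr0.
have -> : A = \sum_(i < p) chi i * i%:Z by apply: eq_bigr => i _; rewrite mulrC.
rewrite E -sumrN; apply: eq_bigr => i _.
have -> : i%:Z - i.+1%:Z = -1 by lia.
by rewrite mulrN1 opprK.
Qed.

(** Two summations by parts. The first turns the left side into the sum of the centered values [e n]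
    against the decrements of [h]; the second uses that partial sums of [e] are bounded, [e] being
    periodic of mean 0. By convexity the decrements are monotone, so their total variation
    telescopes to [h 0 - h 1]. *)
Lemma char_sum_convex : exists2 K : int, 0 <= K & forall (h : nat -> int) (M : nat),
  (forall n, h n.+1 - h n.+2 <= h n - h n.+1) ->
  (forall n, (M <= n)%N -> h n = 0) ->
  `|p%:Z * (\sum_(d < M) chi d * h d) + A * h 0| <= K * (h 0 - h 1).
Proof.
exists (\sum_(i < p) `|e i|); first by apply: sumr_ge0.
move=> h M cvx hM.
have -> : p%:Z * (\sum_(d < M) chi d * h d) + A * h 0 = \sum_(n < M) e n * (h n - h n.+1).
  rewrite sum_by_parts (hM M (leqnn M)) mulr0 add0r mulr_sumr.
  have -> : A * h 0 = \sum_(n < M) A * (h n - h n.+1).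
    rewrite -mulr_sumr; congr (_ * _).
    rewrite -(big_mkord xpredT (fun n => h n - h n.+1)).
    rewrite (@telescope_sumr_eq _ 0 M (fun n => - h n)) //; last by move=> i _; rewrite opprK addrC.
    by rewrite (hM M (leqnn M)) oppr0 sub0r opprK.
  by rewrite -big_split /=; apply: eq_bigr => i _; rewrite mulrA -mulrDl.
have D0 : h M - h M.+1 = 0 by rewrite !hM // subrr.
rewrite (sum_by_parts e (fun n => h n - h n.+1)) D0 mulr0 add0r.
apply: le_trans (ler_norm_sum _ _ _) _.
have -> : h 0 - h 1 = \sum_(n < M) ((h n - h n.+1) - (h n.+1 - h n.+2)).
  rewrite -(big_mkord xpredT (fun n => (h n - h n.+1) - (h n.+1 - h n.+2))).
  rewrite (@telescope_sumr_eq _ 0 M (fun n => - (h n - h n.+1))) //; last by move=> i _; rewrite opprK addrC.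
  by rewrite D0; ring.
rewrite mulr_sumr; apply: ler_sum => i _; rewrite normrM.
apply: ler_pM => //; first by apply: periodic_sum_bound => //; [exact: centered_per|exact: centered_sum].
by rewrite ger0_norm // subr_ge0.
Qed.

Lemma first_moment_mul n : \sum_(d < p * n) chi d = 0 /\
  \sum_(d < p * n) d%:Z * chi d = n%:Z * A.
Proof.
elim: n => [|n [IH1 IH2]]; first by rewrite muln0 !big_ord0 mul0r.
have per k i : chi (p * k + i)%N = chi i.
  by elim: k => [|k IH]; rewrite ?muln0 // mulnS -addnA addnC chi_per IH.
rewrite mulnS addnC !big_split_ord /= IH1 IH2 add0r; split.
  by rewrite -[RHS]chi_sum; apply: eq_bigr => i _; rewrite per.
have -> : \sum_(i < p) (p * n + i)%N%:Z * chi (p * n + i)%N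
   = (p * n)%N%:Z * \sum_(i < p) chi i + A.
  rewrite mulr_sumr -big_split /=; apply: eq_bigr => i _.
  by rewrite per PoszD mulrDl.
by rewrite chi_sum mulr0 add0r intS mulrDl mul1r addrC.
Qed.

End Character.

(** A cubic Riesz sum over the multiples of [d]. For positive [d] the bound [R] is a mere cutoff,
    since the terms with [d * m.+1 >= X] vanish. *)
Definition riesz (X d : int) (R : nat) : int := \sum_(m < R) pos3 (X - d * m.+1%:Z).

(* Faulhaber: the difference of two values of the Bernoulli polynomial B_4. *)
Lemma cube_sum (d r : int) (q : nat) :
  4 * d * \sum_(m < q) (q%:Z * d + r - d * m.+1%:Z) ^+ 3 =
  (q%:Z * d + r) ^+ 4 - 2 * d * (q%:Z * d + r) ^+ 3 + d ^+ 2 * (q%:Z * d + r) ^+ 2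
  - r ^+ 2 * (d - r) ^+ 2.
Proof.
elim: q => [|q IH]; first by rewrite big_ord0; ring.
rewrite big_ord_recl /= mulrDr.
have -> : \sum_(i < q) (q.+1%:Z * d + r - d * (bump 0 i).+1%:Z) ^+ 3
  = \sum_(m < q) (q%:Z * d + r - d * m.+1%:Z) ^+ 3.
  by apply: eq_bigr => i _; congr (_ ^+ 3); rewrite /bump /= add1n !intS; ring.
by rewrite IH !intS; ring.
Qed.

Lemma rieszE (X d R : nat) : (0 < d)%N -> (X <= R)%N ->
  4 * d%:Z * riesz X%:Z d%:Z R = X%:Z ^+ 4 - 2 * d%:Z * X%:Z ^+ 3 + d%:Z ^+ 2 * X%:Z ^+ 2
   - (X %% d)%N%:Z ^+ 2 * (d%:Z - (X %% d)%N%:Z) ^+ 2.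
Proof.
move=> d0 XR; have EX : X%:Z = (X %/ d)%N%:Z * d%:Z + (X %% d)%N%:Z.
  by rewrite -PoszM -PoszD -divn_eq.
set q := (X %/ d)%N in EX *; set r := (X %% d)%N in EX *.
have rd : (r < d)%N by rewrite ltn_mod.
have qR : (q <= R)%N by apply: leq_trans (leq_div _ _) XR.
rewrite EX -cube_sum; congr (_ * _).
rewrite /riesz -(subnKC qR) big_split_ord /= [X in _ + X]big1 ?addr0.
  apply: eq_bigr => i _; rewrite pos3_ge0 // addrAC; apply: addr_ge0 => //.
  by rewrite mulrC -mulrBr mulr_ge0 //; have := ltn_ord i; lia.
move=> i _; rewrite pos3_le0 //.
have : d%:Z * q.+1%:Z <= d%:Z * (q + i)%N.+1%:Z by rewrite ler_wpM2l //; lia.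
have -> : d%:Z * q.+1%:Z = q%:Z * d%:Z + d%:Z by rewrite intS; ring.
by lia.
Qed.

(** In [rieszE] the factor 256 cancels the quartic term, while [(256 - 4 ^ 3) / 2 = 96] and
    [(256 - 4 ^ 2) / 4 = 60]. The two remainders lie in [[0, d ^ 4]] and have opposite signs, so
    after division by [4 * d] only [256 / 4 = 64] counts. *)
Lemma riesz_diff (X d R : nat) : (0 < d)%N -> (4 * X <= R)%N ->
  `|256 * riesz X%:Z d%:Z R - riesz (4 * X)%N%:Z d%:Z R
     + 96 * X%:Z ^+ 3 - 60 * d%:Z * X%:Z ^+ 2| <= 64 * d%:Z ^+ 3.
Proof.
move=> d0 XR; set T := _ - _.
have rho n : 0 <= (n %% d)%N%:Z ^+ 2 * (d%:Z - (n %% d)%N%:Z) ^+ 2 <= d%:Z ^+ 4.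
  have : (n %% d < d)%N by rewrite ltn_mod.
  move: (n %% d)%N => r rd; apply/andP; split; first by rewrite mulr_ge0 // sqr_ge0.
  have -> : d%:Z ^+ 4 = d%:Z ^+ 2 * d%:Z ^+ 2 by ring.
  by apply: ler_pM; rewrite ?sqr_ge0 // lerXn2r ?nnegrE; lia.
have E : 4 * d%:Z * T = - 256 * ((X %% d)%N%:Z ^+ 2 * (d%:Z - (X %% d)%N%:Z) ^+ 2)
   + ((4 * X) %% d)%N%:Z ^+ 2 * (d%:Z - ((4 * X) %% d)%N%:Z) ^+ 2.
  have E1 := @rieszE X d R d0 (ltac:(lia)); have E2 := @rieszE (4 * X) d R d0 XR.
  rewrite /T; move: (riesz _ _ _) (riesz _ _ _) E1 E2 => t2 t1.
  move: ((X %% d)%N%:Z ^+ 2 * _) (((4 * X) %% d)%N%:Z ^+ 2 * _) => s1 s2 E1 E2.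
  have -> : 4 * d%:Z * (256 * t1 - t2 + 96 * X%:Z ^+ 3 - 60 * d%:Z * X%:Z ^+ 2)
    = 256 * (4 * d%:Z * t1) - 4 * d%:Z * t2 + 384 * d%:Z * X%:Z ^+ 3 - 240 * d%:Z ^+ 2 * X%:Z ^+ 2.
    by ring.
  by rewrite E1 E2 !PoszM; ring.
have d0' : 0 < 4 * d%:Z by lia.
rewrite -(ler_pM2l d0') -[X in X * `|_|](gtr0_norm d0') -normrM E.
have -> : 4 * d%:Z * (64 * d%:Z ^+ 3) = 256 * d%:Z ^+ 4 by ring.
move: (rho X) (rho (4 * X)%N).
move: (d%:Z ^+ 4) ((X %% d)%N%:Z ^+ 2 * _) (((4 * X) %% d)%N%:Z ^+ 2 * _) => *.
by lia.
Qed.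

Lemma pos3_convex (R : realDomainType) (u w : R) : 0 <= w ->
  pos3 (u - w) - pos3 (u - 2 * w) <= pos3 u - pos3 (u - w).
Proof.
move=> w0; rewrite -subr_ge0.
have [h1|h1] := leP 0 (u - 2 * w).
  rewrite !pos3_ge0; [|lra..].
  have -> : u ^+ 3 - (u - w) ^+ 3 - ((u - w) ^+ 3 - (u - 2 * w) ^+ 3) = 6 * (w ^+ 2 * (u - w)).
    by ring.
  by rewrite !mulr_ge0 ?sqr_ge0 //; lra.
rewrite (pos3_le0 (ltW h1)).
have [h2|h2] := leP 0 (u - w); last first.
  by rewrite (pos3_le0 (ltW h2)); have := pos3_nneg u; lra.
rewrite !pos3_ge0; [|lra..].
have h : (2 * (u - w)) ^+ 3 <= u ^+ 3 by rewrite lerXn2r ?nnegrE; lra.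
have : 0 <= (u - w) ^+ 3 by apply: exprn_ge0.
have : (2 * (u - w)) ^+ 3 = 8 * (u - w) ^+ 3 by ring.
by lra.
Qed.

Lemma pos3_increment (R : realDomainType) (u w : R) : 0 <= w ->
  pos3 u - pos3 (u - w) <= 3 * Num.max u 0 ^+ 2 * w.
Proof.
move=> w0; have [h1|/ltW h1] := leP u 0.
  rewrite (pos3_le0 h1) pos3_le0; last by lra.
  by rewrite expr0n /= mulr0 mul0r subrr.
rewrite (pos3_ge0 h1) -subr_ge0.
have [h2|h2] := leP 0 (u - w).
  rewrite pos3_ge0 //.
  have -> : 3 * u ^+ 2 * w - (u ^+ 3 - (u - w) ^+ 3) = w ^+ 2 * (2 * u + (u - w)) by ring.
  by rewrite mulr_ge0 ?sqr_ge0 //; lra.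
rewrite (pos3_le0 (ltW h2)).
have -> : 3 * u ^+ 2 * w - (u ^+ 3 - 0) = u ^+ 2 * (2 * w + (w - u)) by ring.
by rewrite mulr_ge0 ?sqr_ge0 //; lra.
Qed.

Lemma sum_if_ltn (R : realDomainType) (M n : nat) (c : R) : 0 <= c ->
  \sum_(m < M) (if (m < n)%N then c else 0) <= n%:R * c.
Proof.
move=> c0; have -> : \sum_(m < M) (if (m < n)%N then c else 0) = (minn M n)%:R * c.
  elim: M => [|M IH]; first by rewrite big_ord0 min0n mul0r.
  rewrite big_ord_recr /= IH; case: ltnP => h.
    by rewrite (minn_idPl h) -[M.+1]addn1 natrD mulrDl mul1r.
  by rewrite (minn_idPr _) ?addr0 // ltnW.
by rewrite ler_wpM2r // ler_nat geq_minr.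
Qed.

Section CharacterSum.
Variables (p : nat) (chi : nat -> int).
Hypotheses (p_gt0 : (0 < p)%N)
  (chi_per : forall n, chi (n + p)%N = chi n)
  (chi_sum : \sum_(a < p) chi a = 0)
  (chi_le1 : forall n, `|chi n| <= 1).
Local Notation A := (first_moment p chi).

(** This is [U(X)], independent of [R] once [X < R] and [chi 0 = 0]; the latter removes [d = 0],
    where [riesz] does depend on the cutoff. *)
Definition chi_riesz (X R : nat) : int := \sum_(d < R) chi d * riesz X%:Z d%:Z R.

(* With X = Z^8, the terms d < D = p Z^5 are given by [riesz_diff]; for d >= D
   only O(Z^3) values of m occur, and each sum over d is a character sum with
   convex weights.  Both errors are O(Z^23), that is o(X^3). *)
Lemma chi_riesz_doubling : (chi 0%N = 0) ->
  exists C : int, forall Z R : nat, (p < Z)%N -> (4 * Z ^ 8 < R)%N ->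
  `|p%:Z * (256 * chi_riesz (Z ^ 8) R - chi_riesz (4 * Z ^ 8) R) - 96 * A * Z%:Z ^+ 24|
    <= C * Z%:Z ^+ 23.
Proof.
move=> chi0.
have [K K0 HK] := char_sum_convex p_gt0 chi_per chi_sum.
exists (64 * `|A| * p%:Z ^+ 3 + 64 * p%:Z ^+ 5 + 257 * 768 * K) => Z R pZ ZR.
set X := (Z ^ 8)%N; set D := (p * Z ^ 5)%N.
have Z0 : (0 < Z)%N by apply: leq_ltn_trans pZ.
have DX : (D <= X)%N.
  rewrite /D /X; apply: (@leq_trans (Z * Z ^ 5)); first by rewrite leq_mul2r ltnW ?orbT.
  by rewrite -expnS leq_pexp2l.
have DR : (D <= R)%N by apply: leq_trans DX _; apply: leq_trans (ltnW ZR); rewrite leq_pmull.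
pose W d := 256 * riesz X%:Z d%:Z R - riesz (4 * X)%N%:Z d%:Z R.
have -> : 256 * chi_riesz X R - chi_riesz (4 * X) R = \sum_(d < R) chi d * W d.
  rewrite /chi_riesz mulr_sumr -sumrB; apply: eq_bigr => i _; rewrite /W; ring.
rewrite (sum_ord_split (fun d => chi d * W d) DR).
set S1 := \sum_(i < D) _; set S2 := \sum_(i < R - D) _.
have WD d : (0 < d)%N -> `|W d + 96 * X%:Z ^+ 3 - 60 * d%:Z * X%:Z ^+ 2| <= 64 * d%:Z ^+ 3.
  by move=> d0; apply: riesz_diff => //; apply: ltnW.
have D0 : (0 < D)%N by rewrite muln_gt0 p_gt0 expn_gt0 Z0.
have [sD mD] := first_moment_mul chi_per chi_sum (Z ^ 5).
(* [D] is a multiple of [p]: the character sum up to [D] vanishes, which removes the term in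
   [X ^ 3], and the term linear in [d] yields exactly [Z ^ 5] copies of the first moment. *)
have hS1 : `|S1 - 60 * X%:Z ^+ 2 * (Z%:Z ^+ 5 * A)| <= 64 * D%:Z ^+ 4.
  have -> : S1 - 60 * X%:Z ^+ 2 * (Z%:Z ^+ 5 * A) = \sum_(d < D) chi d *
     (W d + 96 * X%:Z ^+ 3 - 60 * d%:Z * X%:Z ^+ 2).
    rewrite (eq_bigr (fun d : 'I_D => chi d * W d + (96 * X%:Z ^+ 3 * chi d
               - 60 * X%:Z ^+ 2 * (d%:Z * chi d)))); last by move=> i _; ring.
    rewrite big_split sumrB /= -!mulr_sumr sD mD -/S1.
    have -> : (Z ^ 5)%N%:Z = Z%:Z ^+ 5 by rewrite PoszX.
    by ring.
  apply: le_trans (ler_norm_sum _ _ _) _.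
  apply: (@le_trans _ _ (\sum_(d < D) 64 * D%:Z ^+ 3)).
    apply: ler_sum => d _; have [->|d0] := posnP d.
      by rewrite chi0 mul0r normr0 mulr_ge0 // exprn_ge0.
    rewrite normrM -[leRHS]mul1r; apply: ler_pM => //.
    apply: le_trans (WD _ d0) _; rewrite ler_wpM2l // lerXn2r ?nnegrE //.
    by have := ltn_ord d; lia.
  by rewrite sumr_const card_ord -mulr_natl natz; lia.
pose h x m n := pos3 (x%:Z - (D + n)%N%:Z * m.+1%:Z).
have hconv x m n : h x m n.+1 - h x m n.+2 <= h x m n - h x m n.+1.
  have := @pos3_convex _ (x%:Z - (D + n)%N%:Z * m.+1%:Z) m.+1%:Z isT.
  rewrite /h !addnS !intS.
  have -> : x%:Z - (D + n)%N%:Z * (1 + m%:Z) - (1 + m%:Z) = x%:Z - (1 + (D + n)%N%:Z) * (1 + m%:Z) by ring.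
  by have -> : x%:Z - (D + n)%N%:Z * (1 + m%:Z) - 2 * (1 + m%:Z)
     = x%:Z - (1 + (1 + (D + n)%N%:Z)) * (1 + m%:Z) by ring.
have hsupp x m n : (x <= R)%N -> (R - D <= n)%N -> h x m n = 0.
  move=> xR Rn; rewrite /h pos3_le0 // subr_le0 -PoszM lez_nat.
  apply: leq_trans xR _; apply: (@leq_trans (D + n)); first by rewrite -leq_subLR.
  by rewrite leq_pmulr.
have chiD n : chi (D + n)%N = chi n.
  rewrite /D; elim: (Z ^ 5)%N => [|k IH]; first by rewrite muln0.
  by rewrite mulnS -addnA addnC chi_per.
have ES2 : S2 = \sum_(m < R) (256 * (\sum_(n < R - D) chi n * h X m n)
                  - \sum_(n < R - D) chi n * h (4 * X)%N m n).
  rewrite /S2 sumrB -mulr_sumr.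
  rewrite (exchange_big_dep xpredT) //= [X in _ - X](exchange_big_dep xpredT) //=.
  rewrite mulr_sumr -sumrB; apply: eq_bigr => n _; rewrite chiD /W /riesz.
  rewrite -!mulr_sumr /h; ring.
have EW : W D = \sum_(m < R) (256 * h X m 0%N - h (4 * X)%N m 0%N).
  by rewrite /W /riesz sumrB -mulr_sumr /h; congr (256 * _ - _); apply: eq_bigr => m _; rewrite addn0.
(* The decrement is at most [3 * (4 * X) ^ 2 * m.+1], whence [192 = 3 * 4 ^ 2 * 4]. It vanishes when
   [D * m.+1 >= 4 * X], in particular from [m = 4 * Z ^ 3] on. *)
have hinc x m : (x <= 4 * X)%N -> h x m 0%N - h x m 1%N <=
   (if (m < 4 * Z ^ 3)%N then 192 * Z%:Z ^+ 19 else 0).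
  move=> x4.
  have E : h x m 1%N = pos3 (x%:Z - (D + 0)%N%:Z * m.+1%:Z - m.+1%:Z).
    by rewrite /h addn1 addn0 intS; congr pos3; ring.
  rewrite E /h addn0; have := @pos3_increment _ (x%:Z - D%:Z * m.+1%:Z) m.+1%:Z isT.
  set u := x%:Z - _ => inc; apply: le_trans inc _.
  case: ifP => hm.
    have u4 : Num.max u 0 <= 4 * Z%:Z ^+ 8.
      rewrite ge_max mulr_ge0 ?exprn_ge0 // andbT /u lerBlDr.
      apply: (@le_trans _ _ (4 * Z%:Z ^+ 8)); last by rewrite lerDl mulr_ge0.
      by have -> : 4 * Z%:Z ^+ 8 = (4 * X)%N%:Z by rewrite PoszM /X PoszX.
    have u0 : 0 <= Num.max u 0 by rewrite le_max lexx orbT.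
    have m4 : m.+1%:Z <= 4 * Z%:Z ^+ 3.
      by have -> : 4 * Z%:Z ^+ 3 = (4 * Z ^ 3)%N%:Z by rewrite PoszM PoszX.
    have -> : 192 * Z%:Z ^+ 19 = 3 * (4 * Z%:Z ^+ 8) ^+ 2 * (4 * Z%:Z ^+ 3) by ring.
    apply: ler_pM => //; first by rewrite mulr_ge0 ?sqr_ge0.
    by rewrite ler_wpM2l // lerXn2r ?nnegrE // mulr_ge0 // exprn_ge0.
  rewrite max_r ?expr0n ?mulr0 ?mul0r // /u subr_le0 -PoszM lez_nat.
  apply: leq_trans x4 _; move/negbT: hm; rewrite -leqNgt => hm.
  apply: (@leq_trans (D * (4 * Z ^ 3))); last by rewrite leq_mul2l ltnW ?orbT.
  rewrite /D /X mulnCA leq_mul2l /= -mulnA -expnD; exact: leq_pmull.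
have hS2 : `|p%:Z * S2 + A * W D| <= 257 * K * (768 * Z%:Z ^+ 22).
  rewrite ES2 EW !mulr_sumr -big_split /=.
  apply: le_trans (ler_norm_sum _ _ _) _.
  apply: (@le_trans _ _ (\sum_(m < R) 257 * K * (if (m < 4 * Z ^ 3)%N then 192 * Z%:Z ^+ 19 else 0))).
    apply: ler_sum => m _.
    have X4 : (X <= 4 * X)%N by rewrite leq_pmull.
    have i1 := hinc X m X4; have i2 := hinc (4 * X)%N m (leqnn _).
    have c1 := HK (h X m) (R - D)%N (hconv X m) (fun n => @hsupp X m n (leq_trans X4 (ltnW ZR))).
    have c2 := HK (h (4 * X)%N m) (R - D)%N (hconv _ m) (fun n => @hsupp _ m n (ltnW ZR)).
    have {}c1 := le_trans c1 (ler_wpM2l K0 i1).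
    have {}c2 := le_trans c2 (ler_wpM2l K0 i2).
    have -> : p%:Z * (256 * \sum_(n < R - D) chi n * h X m n - \sum_(n < R - D) chi n * h (4 * X)%N m n)
       + A * (256 * h X m 0%N - h (4 * X)%N m 0%N)
     = 256 * (p%:Z * (\sum_(n < R - D) chi n * h X m n) + A * h X m 0%N)
       - (p%:Z * (\sum_(n < R - D) chi n * h (4 * X)%N m n) + A * h (4 * X)%N m 0%N) by ring.
    move: c1 c2; rewrite -mulrA.
    move: (p%:Z * _ + _) (p%:Z * _ + _) (K * _) => s t M c1 c2; clear -c1 c2.
    by lia.
  rewrite -mulr_sumr ler_wpM2l ?mulr_ge0 //.
  apply: le_trans (sum_if_ltn _ _ _) _; first by rewrite mulr_ge0 // exprn_ge0.
  have -> : (4 * Z ^ 3)%:R = 4 * Z%:Z ^+ 3 :> int by rewrite natz PoszM PoszX.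
  by have -> : 4 * Z%:Z ^+ 3 * (192 * Z%:Z ^+ 19) = 768 * Z%:Z ^+ 22 by ring.
have hWD : `|A * (W D + 96 * X%:Z ^+ 3 - 60 * D%:Z * X%:Z ^+ 2)| <= `|A| * (64 * D%:Z ^+ 3).
  by rewrite normrM ler_wpM2l // WD.
have eX : X%:Z = Z%:Z ^+ 8 by rewrite /X PoszX.
have eD : D%:Z = p%:Z * Z%:Z ^+ 5 by rewrite /D PoszM PoszX.
have Zpow k : (k <= 23)%N -> Z%:Z ^+ k <= Z%:Z ^+ 23.
  by move=> k23; rewrite ler_weXn2l // lez_nat.
set a := S1 - _ in hS1; set b := p%:Z * S2 + _ in hS2; set c := _ + _ - _ in hWD.
(* The main term [96 * A * X ^ 3] comes from the boundary term [A * W D] of the tail, and the two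
   terms with factor 60 cancel because [D = p * Z ^ 5]. *)
have -> : p%:Z * (S1 + S2) - 96 * A * Z%:Z ^+ 24 = p%:Z * a + b - A * c.
  by rewrite /a /b /c eX eD; ring.
apply: le_trans (ler_normB _ _) _; rewrite mulrDl mulrDl -[leRHS]addrA [leRHS]addrC.
apply: lerD; first (apply: le_trans (ler_normD _ _) _; apply: lerD).
- rewrite normrM ger0_norm //; apply: le_trans (ler_wpM2l _ hS1) _ => //.
  rewrite eD; have -> : p%:Z * (64 * (p%:Z * Z%:Z ^+ 5) ^+ 4) = 64 * p%:Z ^+ 5 * Z%:Z ^+ 20 by ring.
  by rewrite ler_wpM2l ?Zpow // mulr_ge0 // exprn_ge0.
- apply: le_trans hS2 _.
  have -> : 257 * K * (768 * Z%:Z ^+ 22) = 257 * 768 * K * Z%:Z ^+ 22 by ring.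
  by rewrite ler_wpM2l ?Zpow // mulr_ge0.
- apply: le_trans hWD _; rewrite eD.
  have -> : `|A| * (64 * (p%:Z * Z%:Z ^+ 5) ^+ 3) = 64 * `|A| * p%:Z ^+ 3 * Z%:Z ^+ 15 by ring.
  by rewrite ler_wpM2l ?Zpow // !mulr_ge0 // exprn_ge0.
Qed.
End CharacterSum.

(** * The Legendre symbol and the number of ideals of given norm *)

Definition legendre (p : nat) (x : 'F_p) : int :=
  if x == 0 then 0 else if x ^+ p.-1./2 == 1 then 1 else -1.

Section Legendre.
Variable p : nat.
Hypotheses (p_prime : prime p) (p_mod4 : (p = 3 %[mod 4])%N).
Local Notation leg := (@legendre p).

Lemma p_odd : odd p.
Proof. by have := @odd_mod p 4 erefl; rewrite p_mod4. Qed.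

Lemma half_odd : odd p.-1./2.
Proof.
have := divn_eq p 4; rewrite p_mod4 /= => ->; rewrite addnS /=.
have -> : (p %/ 4 * 4 + 2)%N = (p %/ 4 * 2 + 1).*2 by lia.
by rewrite doubleK oddD oddM andbF.
Qed.

Lemma half_double : (p.-1./2.*2 = p.-1)%N.
Proof.
rewrite -[RHS]odd_double_half -subn1 oddB ?prime_gt0 // p_odd /=; lia.
Qed.

Lemma Fp_expf_card (x : 'F_p) : x != 0 -> x ^+ p.-1 = 1.
Proof.
move=> x0; apply: (mulfI x0); rewrite -exprS prednK ?prime_gt0 // mulr1.
by have := expf_card x; rewrite card_Fp.
Qed.

Lemma half_power (x : 'F_p) : x != 0 ->
  x ^+ p.-1./2 = if leg x == 1 then 1 else -1.
Proof.
move=> x0; have : x ^+ (p.-1./2 * 2) == 1 by rewrite muln2 half_double Fp_expf_card.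
rewrite exprM.
rewrite sqrf_eq1 /legendre (negPf x0) => /orP[] /eqP E; rewrite E ?eqxx //.
by have [->|] := eqVneq (-1 : 'F_p) 1.
Qed.

Lemma one_neqN1 : (1 : 'F_p) != -1.
Proof.
rewrite -subr_eq0 opprK -(natrD _ 1 1) -(dvdn_pcharf (pchar_Fp p_prime)).
apply/negP => /(@dvdn_leq p 2 isT) p2; have := p_odd.
by have := prime_gt1 p_prime; case: (p) p2 => [|[|[|]]].
Qed.

Lemma leg0 : leg 0 = 0.
Proof. by rewrite /legendre eqxx. Qed.

Lemma leg_values x : x != 0 -> leg x = 1 \/ leg x = -1.
Proof. by rewrite /legendre => /negPf ->; case: ifP; [left|right]. Qed.

Lemma leg_eq0 x : (leg x == 0) = (x == 0).
Proof. by rewrite /legendre; case: ifP => // _; case: ifP. Qed.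

Lemma legM x y : leg (x * y) = leg x * leg y.
Proof.
have [->|x0] := eqVneq x 0; first by rewrite mul0r leg0 mul0r.
have [->|y0] := eqVneq y 0; first by rewrite mulr0 leg0 mulr0.
have xy0 : x * y != 0 by rewrite mulf_neq0.
have := half_power xy0; rewrite exprMn half_power // half_power //.
have n1 := one_neqN1.
case: (leg_values x0) => ->; case: (leg_values y0) => ->; case: (leg_values xy0) => ->;
  rewrite //= ?(mulr1, mul1r, mulrNN) => /eqP; rewrite ?(negPf n1) // eq_sym (negPf n1) //.
Qed.

Lemma leg1 : leg 1 = 1.
Proof. by rewrite /legendre oner_eq0 expr1n eqxx. Qed.

Lemma legN1 : leg (-1) = -1.
Proof.
rewrite /legendre oppr_eq0 oner_eq0 -signr_odd half_odd expr1 eq_sym.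
by rewrite (negPf one_neqN1).
Qed.

Lemma legN x : leg (- x) = - leg x.
Proof. by rewrite -mulN1r legM legN1 mulN1r. Qed.

Lemma sum_leg : \sum_x leg x = 0.
Proof.
set S := \sum_x _; suff : S = - S by lia.
rewrite {1}/S (reindex_inj oppr_inj) -sumrN /=.
by apply: eq_bigr => x _; rewrite legN.
Qed.

Lemma leg_sum_nat : \sum_(a < p) leg a%:R = 0.
Proof.
rewrite -[RHS]sum_leg -(big_mkord xpredT (fun a : nat => leg a%:R)).
have E : (Zp_trunc (pdiv p)).+2 = p by rewrite -[RHS](Fp_cast p_prime).
rewrite -[X in index_iota 0 X]E big_mkord; apply: eq_bigr => i _.
by rewrite natr_Zp.
Qed.

(** Since [-1] is a nonresidue, negation exchanges residues and nonresidues. *)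
Lemma card_residues (e : int) : `|e| = 1 -> #|[pred x | leg x == e]| = p.-1./2.
Proof.
move=> e1.
have c1 : #|[pred x | leg x == 1%R]| = #|[pred x | leg x == -1%R]|.
  rewrite -(card_image oppr_inj [pred x | leg x == 1%R]).
  apply: eq_card => x; rewrite inE.
  by rewrite -[x in LHS]opprK (mem_image oppr_inj) inE legN eqr_oppLR.
have : (#|[pred x | leg x == 1%R]| + #|[pred x | leg x == -1%R]|)%N = p.-1.
  have := cardC1 (0 : 'F_p); rewrite card_Fp // => <-.
  rewrite -cardUI [X in (_ + X)%N]eq_card0 ?addn0.
    apply: eq_card => x; rewrite !inE; have [->|x0] := eqVneq x 0; first by rewrite leg0.
    by case: (leg_values x0) => ->.
  by move=> x; rewrite !inE; apply/negP => /andP[/eqP ->].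
rewrite -c1 addnn => c2.
have {}c2 : #|[pred x | leg x == 1%R]| = p.-1./2 by rewrite -c2 doubleK.
have [->|->] : e = 1 \/ e = -1 by lia.
  by [].
by rewrite -c1.
Qed.

Lemma legV x : leg x^-1 = leg x.
Proof.
have [->|x0] := eqVneq x 0; first by rewrite invr0.
have : leg x * leg x^-1 = 1 by rewrite -legM mulfV ?leg1.
by case: (leg_values x0) => ->; lia.
Qed.

(* c |-> 1/c exchanges the two values of e. *)
Lemma card_shifted_nonresidues (e : int) : `|e| = 1 ->
  (#|[pred c | (leg c == -1%R) && (leg (1 + c)%R == e)]|.*2.+1 = p.-1./2)%N.
Proof.
move=> e1.
pose N (e : int) := #|[pred c | (leg c == -1%R) && (leg (1 + c)%R == e)]|.
have N1 : N 1 = N (-1).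
  have inj : injective (fun x : 'F_p => x^-1) by exact: invr_inj.
  rewrite /N -(card_image inj [pred c | (leg c == -1%R) && (leg (1 + c)%R == 1%R)]).
  apply: eq_card => x; rewrite inE -[x in LHS]invrK (mem_image inj) !inE legV.
  have [->|x0] := eqVneq x 0; first by rewrite leg0.
  have -> : 1 + x^-1 = (1 + x) * x^-1 by rewrite mulrDl mul1r mulfV // addrC.
  rewrite legM legV; case: eqP => //= ->.
  by rewrite mulrN1 eqr_oppLR.
have c : (N 1%R + N (-1)%R + 1)%N = p.-1./2.
  rewrite -(@card_residues (-1)) // -[X in (_ + X)%N](card1 (-1 : 'F_p)).
  rewrite /N -cardUI [X in (_ + X + _)%N]eq_card0 ?addn0; last first.
    by move=> x; rewrite !inE; apply/negP => /andP[/andP[_ /eqP ->] /andP[_ /eqP]].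
  rewrite -cardUI [X in (_ + X)%N]eq_card0 ?addn0; last first.
    move=> x; rewrite !inE; apply/negP => /andP[] /[swap] /eqP ->.
    by rewrite subrr leg0 !andbF.
  apply: eq_card => x; rewrite !inE.
  have [->|x1] := eqVneq x (-1); first by rewrite orbT legN1.
  rewrite orbF -andb_orr; case: eqP => //= _.
  have : 1 + x != 0 by rewrite addrC addr_eq0.
  by case/leg_values => ->.
have [->|->] : e = 1 \/ e = -1 by lia.
  by rewrite -/(N 1) -c -N1 -addnn addn1.
by rewrite -/(N (-1)) -c N1 -addnn addn1.
Qed.

(** * Quadratic Gaussian periods over an arbitrary field *)

Section Periods.
Variables (F : fieldType) (zeta : F).
Hypotheses (zeta_pow : zeta ^+ p = 1) (zeta_neq1 : zeta != 1).

Definition zpow (x : 'F_p) : F := zeta ^+ x.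

Lemma zpow_nat n : zpow n%:R = zeta ^+ n.
Proof.
rewrite /zpow [X in _ ^+ X](_ : _ = (n %% p)%N); first by rewrite expr_mod.
by rewrite val_Fp_nat.
Qed.

Lemma zpowD x y : zpow (x + y) = zpow x * zpow y.
Proof.
rewrite -[x]natr_Zp -[y]natr_Zp -natrD !zpow_nat exprD //.
Qed.

Lemma zpow0 : zpow 0 = 1.
Proof. by rewrite /zpow expr0. Qed.

Lemma sum_zpow : \sum_x zpow x = 0.
Proof.
set S := \sum_x _; suff : (1 - zeta) * S = 0.
  by move/eqP; rewrite mulf_eq0 subr_eq0 eq_sym (negPf zeta_neq1) => /eqP.
rewrite mulrBl mul1r {1}/S (reindex_inj (addIr 1)) mulr_sumr -sumrB big1 // => x _.
by rewrite zpowD mulrC -[1]/(1%:R) zpow_nat expr1 subrr.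
Qed.

Definition period (e : int) : F := \sum_(x | leg x == e) zpow x.

Lemma sum_periods : period 1 + period (-1) = -1.
Proof.
have := sum_zpow; rewrite (bigID (fun x => leg x == 1)) /= -/(period 1).
rewrite (bigD1 (0 : 'F_p)) /= ?leg0 // zpow0.
rewrite (eq_bigl (fun x => leg x == -1)); last first.
  move=> x; have [->|x0] := eqVneq x 0; first by rewrite leg0.
  by case: (leg_values x0) => ->.
by rewrite -/(period (-1)) => /eqP; rewrite addrCA addrC addr_eq0 => /eqP.
Qed.

Lemma period_dilate (e : int) (y : 'F_p) : y != 0 ->
  \sum_(x | leg x == e) zpow (x * y) = period (e * leg y).
Proof.
move=> y0; rewrite /period [RHS](reindex_inj (mulIf y0)) /=.
apply: eq_bigl => x; rewrite legM; apply/eqP/eqP => [->//|].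
have ly : leg y != 0 by rewrite leg_eq0.
by move/(mulIf ly).
Qed.

(** Writing the nonresidue as [x * c], the product becomes a sum of [zpow (x * (1 + c))]. The value
    [c = -1] contributes [p.-1./2 = 2 * n + 1]; every other [c] contributes a period, each of the
    two [n] times by [card_shifted_nonresidues]. As the periods add up to [-1], the total is
    [n + 1 = m]. *)
Lemma prod_periods (m : nat) : (p.+1 = 4 * m)%N -> period 1 * period (-1) = m%:R.
Proof.
move=> pm; rewrite /period big_distrlr /=.
transitivity (\sum_(x | leg x == 1) \sum_(c | leg c == -1) zpow (x * (1 + c))).
  apply: eq_bigr => x /eqP lx.
  have x0 : x != 0 by rewrite -leg_eq0 lx.
  rewrite (reindex_inj (mulfI x0)) /=; apply: eq_big => c.
    by rewrite legM lx mul1r.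
  by rewrite mulrDr mulr1 zpowD.
rewrite exchange_big /= (bigD1 (-1)) ?legN1 //=.
rewrite [X in X + _](_ : _ = (p.-1./2)%:R); last first.
  rewrite (eq_bigr (fun=> 1)); last by move=> x _; rewrite subrr mulr0 zpow0.
  by rewrite sumr_const (@card_residues 1).
rewrite (bigID (fun c => leg (1 + c) == 1)) /=.
have S (e : int) : \sum_(i | (leg i == -1) && (leg (1 + i) == e)) period e
   = period e *+ #|[pred c | (leg c == -1%R) && (leg (1 + c)%R == e)]|.
  by rewrite sumr_const; congr (_ *+ _); apply: eq_card.
rewrite (eq_big (fun c => (leg c == -1) && (leg (1 + c) == 1)) (fun=> period 1)); first last.
- move=> c /andP[_ /eqP l1].
  by rewrite period_dilate ?l1 ?mulr1 // -leg_eq0 l1.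
- move=> c; have [->|] := eqVneq c (-1); last by rewrite andbT.
  by rewrite subrr leg0 !andbF.
rewrite S (eq_big (fun c => (leg c == -1) && (leg (1 + c) == -1)) (fun=> period (-1))); first last.
- move=> c /andP[/andP[_ c1] l1].
  have c0 : 1 + c != 0 by rewrite addrC addr_eq0.
  by rewrite period_dilate //; case: (leg_values c0) l1 => ->.
- move=> c; have [->|c1] := eqVneq c (-1); first by rewrite subrr leg0 !andbF.
  rewrite andbT; congr (_ && _).
  have : 1 + c != 0 by rewrite addrC addr_eq0.
  by case/leg_values => ->.
rewrite S; have := @card_shifted_nonresidues 1 erefl.
have := @card_shifted_nonresidues (-1) erefl.
move: (#|_|) (#|_|) => n1 n2 h1 h2.
have hp := half_double.
have [-> -> hm] : [/\ n2 = n1, p.-1./2 = n1.*2.+1 & m = n1.+1] by split; lia.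
rewrite -mulrnDl sum_periods hm mulNrn -addnn -!natr1 natrD.
by rewrite addrAC addrK.
Qed.

End Periods.
End Legendre.

(** [b ^ 2 + b + m] is the norm of [b + w], so this counts the ideals [Z a + Z (b + w)] of norm
    [a]. *)
Definition rho (m a : nat) : nat := \sum_(b < a) (a %| b ^ 2 + b + m).

Lemma mod4_of_pm p m : (p.+1 = 4 * m)%N -> (p = 3 %[mod 4])%N.
Proof. by lia. Qed.

(** * Roots of [b ^ 2 + b + m] modulo a prime *)

Section Reciprocity.
Variables p m l : nat.
Hypotheses (p_prime : prime p) (pm : (p.+1 = 4 * m)%N).
Hypotheses (l_prime : prime l) (l_neq_p : l != p).

(** By Fermat [p] divides [l ^ (p - 1) - 1], the number of units of the field with [l ^ (p - 1)]
    elements, and Cauchy's theorem supplies an element of order [p]. *)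
Lemma root_of_unity_ext : exists (F : finFieldType) (z : F),
  [/\ l \in [pchar F], z ^+ p = 1 & z != 1].
Proof.
have p1 : (0 < p.-1)%N by have := prime_gt1 p_prime; lia.
have [F chF cF] := PrimePowerField l_prime p1.
have dv : (p %| #|[set: {unit F}]|)%N.
  rewrite card_finField_unit cF -subn1 -eqn_mod_dvd ?expn_gt0 ?prime_gt0 //.
  rewrite -totient_prime //; apply/eqP; apply: Euler_exp_totient.
  by rewrite prime_coprime // dvdn_prime2.
have [u _ ou] := Cauchy p_prime dv.
exists F, (FinRing.uval u); split=> //.
  by rewrite -FinRing.val_unitX -ou expg_order.
apply/eqP => u1; have : u = 1%g by apply: val_inj.
by move=> ug1; have := p_prime; rewrite -ou ug1 order1.
Qed.

Lemma natr_inj_lt (F : nzRingType) (i j : nat) : l \in [pchar F] ->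
  (i < l)%N -> (j < l)%N -> i%:R = j%:R :> F -> i = j.
Proof.
move=> chF il jl.
wlog ij : i j il jl / (i <= j)%N.
  by move=> H E; have [h|/ltnW h] := leqP i j; [apply: H|apply/esym/H].
move=> /eqP; rewrite eq_sym -subr_eq0 -natrB // -(dvdn_pcharf chF) => d.
have : (j - i = 0)%N; last by lia.
by apply/eqP; move: d; apply: contraLR => ji; rewrite gtnNdvd ?lt0n //; lia.
Qed.

Lemma prime_field_fixed (F : finFieldType) (x : F) : l \in [pchar F] ->
  x ^+ l = x -> exists2 b : nat, (b < l)%N & x = b%:R.
Proof.
move=> chF xl.
have l1 := prime_gt1 l_prime.
pose P : {poly F} := 'X^l - 'X.
have sP : size P = l.+1.
  by rewrite size_polyDl size_polyXn // size_polyN size_polyX.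
have P0 : P != 0 by rewrite -size_poly_eq0 sP.
have rP y : root P y = (y ^+ l == y) by rewrite rootE !hornerE subr_eq0.
pose rs : seq F := [seq i%:R | i <- iota 0 l].
have inj : {in iota 0 l &, injective (fun i : nat => i%:R : F)}.
  by move=> i j; rewrite !mem_iota !add0n /= => il jl; apply: natr_inj_lt.
have us : uniq rs by rewrite map_inj_in_uniq // iota_uniq.
have ars : all (root P) rs.
  apply/allP => y /mapP[i _ ->]; rewrite rP.
  by rewrite -!(pFrobenius_autE chF) pFrobenius_aut_nat.
have [/mapP[b bl ->]|xrs] := boolP (x \in rs).
  by exists b => //; move: bl; rewrite mem_iota.
have := @max_poly_roots _ P (x :: rs) P0.
rewrite /= rP xl eqxx ars us xrs /= sP size_map size_iota ltnn.
by move/(_ isT isT).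
Qed.

(* The roots of b^2 + b + m in characteristic l are the two Gaussian periods, and
   the Frobenius fixes or exchanges them according to the symbol of l. *)
Lemma rho_prime : (rho m l)%:Z = 1 + legendre (l%:R : 'F_p).
Proof.
have [F [z [chF zp z1]]] := root_of_unity_ext.
have p4 := mod4_of_pm pm.
pose eta e := @period p F z e.
have sE : eta 1 + eta (-1) = -1 by exact: sum_periods.
have pE : eta 1 * eta (-1) = m%:R by exact: prod_periods.
have l0 : (l%:R : 'F_p) != 0.
  by rewrite -(dvdn_pcharf (pchar_Fp p_prime)) dvdn_prime2 // eq_sym.
have rootE (b : nat) : (l %| b ^ 2 + b + m)%N = (b%:R == eta 1) || (b%:R == eta (-1)).
  rewrite (dvdn_pcharf chF) !natrD natrX -pE.
  have -> : b%:R ^+ 2 + b%:R + eta 1 * eta (-1) = (b%:R - eta 1) * (b%:R - eta (-1)).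
    have -> : b%:R ^+ 2 + b%:R + eta 1 * eta (-1) = b%:R ^+ 2 - b%:R * (-1) + eta 1 * eta (-1) by ring.
    by rewrite -sE; ring.
  by rewrite mulf_eq0 !subr_eq0.
(* The square of the difference is the discriminant [1 - 4 * m = - p], nonzero in characteristic [l]
   because [l] differs from [p]. *)
have neta : eta 1 != eta (-1).
  rewrite -subr_eq0 -sqrf_eq0.
  have -> : (eta 1 - eta (-1)) ^+ 2 = (eta 1 + eta (-1)) ^+ 2 - 4 * (eta 1 * eta (-1)) by ring.
  have -> : (eta 1 + eta (-1)) ^+ 2 - 4 * (eta 1 * eta (-1)) = - p%:R.
    rewrite sE pE -natrM -pm -natr1; ring.
  rewrite oppr_eq0 -(dvdn_pcharf chF) dvdn_prime2 //.
have frob e : eta e ^+ l = eta (e * legendre (l%:R : 'F_p)).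
  rewrite /eta -(period_dilate p_prime p4 z e l0) -(pFrobenius_autE chF) /period rmorph_sum.
  apply: eq_bigr => x _; rewrite /= pFrobenius_autE.
  by rewrite -[x in RHS]natr_Zp -natrM zpow_nat // exprM.
rewrite /rho; have [E|E] := leg_values l0.
  have fx e : eta e ^+ l = eta e by rewrite frob E mulr1.
  have [b1 b1l E1] := prime_field_fixed chF (fx 1).
  have [b2 b2l E2] := prime_field_fixed chF (fx (-1)).
  have nb : (Ordinal b2l != Ordinal b1l).
    by apply: contra neta => /eqP[eb]; rewrite E1 E2 eb.
  have eqb (i j : 'I_l) : ((i%:R : F) == j%:R) = (i == j).
    apply/eqP/eqP => [|-> //].
    by move/(natr_inj_lt chF (ltn_ord i) (ltn_ord j))/val_inj.
  rewrite E (bigD1 (Ordinal b1l)) //= rootE E1 eqxx /=.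
  rewrite (bigD1 (Ordinal b2l)) //= rootE E2 eqxx orbT big1 // => i /andP[i1 i2].
  rewrite rootE E1 E2.
  by rewrite (eqb i (Ordinal b1l)) (eqb i (Ordinal b2l)) (negPf i1) (negPf i2).
rewrite E big1 // => b _; rewrite rootE; apply/eqP; rewrite eqb0.
apply/negP => H.
have bf : (b%:R : F) ^+ l = b%:R by rewrite -!(pFrobenius_autE chF) pFrobenius_aut_nat.
case/orP: H => /eqP H; move: bf; rewrite H frob E ?mulrN1 ?mul1r ?opprK => /eqP;
  by rewrite ?(negPf neta) // eq_sym (negPf neta).
Qed.
End Reciprocity.

(** * Multiplicative functions and their values at prime powers *)

Definition multiplicative (f : nat -> int) :=
  f 1%N = 1 /\ (forall m n, (0 < m)%N -> (0 < n)%N -> coprime m n -> f (m * n)%N = f m * f n).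

Definition dconv (f g : nat -> int) (n : nat) : int :=
  \sum_(d <- divisors n) f d * g (n %/ d)%N.

Lemma gcdn_coprime_mul m n d : coprime m n -> (d %| m * n)%N ->
  (gcdn d m * gcdn d n = d)%N.
Proof.
move=> co dmn; apply/eqP; rewrite eqn_dvd; apply/andP; split.
  rewrite Gauss_dvd ?dvdn_gcdl //.
  by apply: coprime_dvdl (dvdn_gcdr _ _) _; apply: coprime_dvdr (dvdn_gcdr _ _) co.
rewrite muln_gcdl !muln_gcdr !dvdn_gcd dmn.
by rewrite !(dvdn_mulr _ (dvdnn d)) (dvdn_mull _ (dvdnn d)).
Qed.

Lemma divisors_coprime_mul m n : (0 < m)%N -> (0 < n)%N -> coprime m n ->
  perm_eq (divisors (m * n)) [seq (d * e)%N | d <- divisors m, e <- divisors n].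
Proof.
move=> m0 n0 co; apply: uniq_perm; first exact: divisors_uniq.
  apply: allpairs_uniq; try exact: divisors_uniq.
  move=> [d e] [d' e'] /allpairsP[[a b] /= [am bn [-> ->]]] /allpairsP[[a' b'] /= [am' bn' [-> ->]]].
  move=> E; move: am bn am' bn'; rewrite -!dvdn_divisors // => am bn am' bn'.
  have gm x y : (x %| m)%N -> (y %| n)%N -> gcdn (x * y) m = x.
    move=> xm yn; rewrite gcdnC Gauss_gcdl; first by apply/gcdn_idPr.
    by apply: coprime_dvdr yn co.
  have gn x y : (x %| m)%N -> (y %| n)%N -> gcdn (x * y) n = y.
    move=> xm yn; rewrite gcdnC Gauss_gcdr; first by apply/gcdn_idPr.
    by rewrite coprime_sym; apply: coprime_dvdl xm co.
  by congr (_, _); [rewrite -(gm a b) // E gm|rewrite -(gn a b) // E gn].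
move=> d; rewrite -dvdn_divisors ?muln_gt0 ?m0 //; apply/idP/allpairsP.
  move=> dmn; exists (gcdn d m, gcdn d n); rewrite /= -!dvdn_divisors // !dvdn_gcdr; split=> //.
  by rewrite gcdn_coprime_mul.
move=> [[a b] /=]; rewrite -!dvdn_divisors // => -[am bn ->]; exact: dvdn_mul.
Qed.

Lemma sum_divisors_coprime (f : nat -> int) m n : (0 < m)%N -> (0 < n)%N -> coprime m n ->
  \sum_(d <- divisors (m * n)) f d
   = \sum_(d <- divisors m) \sum_(e <- divisors n) f (d * e)%N.
Proof.
by move=> m0 n0 co; rewrite (perm_big _ (divisors_coprime_mul m0 n0 co)) big_allpairs_dep.
Qed.

Lemma sum_divisors (n : nat) (F : nat -> int) : (0 < n)%N ->
  \sum_(d <- divisors n) F d = \sum_(d < n.+1 | (d %| n)%N) F d.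
Proof.
move=> n0; rewrite -(big_mkord (fun d => d %| n)%N F) -big_filter.
apply: perm_big; apply: uniq_perm; first exact: divisors_uniq.
  by rewrite filter_uniq // iota_uniq.
move=> d; rewrite mem_filter mem_index_iota -dvdn_divisors //=.
by case: (boolP (d %| n)%N) => //= dn; rewrite ltnS dvdn_leq.
Qed.

Lemma dconv_multiplicative f g :
  multiplicative f -> multiplicative g -> multiplicative (dconv f g).
Proof.
move=> [f1 fM] [g1 gM]; split.
  by rewrite /dconv [divisors 1]/= big_seq1 f1 g1.
move=> m n m0 n0 co; rewrite /dconv sum_divisors_coprime // mulr_suml.
rewrite !big_seq; apply: eq_bigr => d; rewrite -dvdn_divisors // => dm.
rewrite mulr_sumr !big_seq; apply: eq_bigr => e; rewrite -dvdn_divisors // => en.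
have de : coprime d e by apply: coprime_dvdl dm _; apply: coprime_dvdr en co.
have [d0 e0] : (0 < d)%N /\ (0 < e)%N by rewrite (dvdn_gt0 m0 dm) (dvdn_gt0 n0 en).
rewrite fM //.
have -> : (m * n %/ (d * e) = (m %/ d) * (n %/ e))%N.
  by rewrite -{1}(divnK dm) -{1}(divnK en) mulnACA mulnK ?muln_gt0 ?d0.
rewrite gM; first by ring.
- by rewrite divn_gt0 // dvdn_leq.
- by rewrite divn_gt0 // dvdn_leq.
- by apply: coprime_dvdl (dvdn_div dm) _; apply: coprime_dvdr (dvdn_div en) co.
Qed.

Lemma multiplicative_eq f g : multiplicative f -> multiplicative g ->
  (forall l k, prime l -> f (l ^ k)%N = g (l ^ k)%N) ->
  forall n, (0 < n)%N -> f n = g n.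
Proof.
move=> [f1 fM] [g1 gM] fg n.
have [k] := ubnP n; elim: k n => // k IH n nk n0.
have [n1|n1] := leqP n 1; first by have -> : n = 1%N; [lia|rewrite f1 g1].
have lp := pdiv_prime n1; set l := pdiv n in lp.
have [j _ [m co nE]] : exists2 j, true & exists2 m, coprime l m & n = (m * l ^ j.+1)%N.
  have [m co nE] := pfactor_coprime lp n0.
  have : (0 < logn l n)%N by rewrite logn_gt0 mem_primes lp n0 pdiv_dvd.
  case E : (logn l n) => [//|j] _; exists j => //; exists m => //; rewrite -E //.
have lj : (1 < l ^ j.+1)%N by rewrite -[1%N](exp1n j.+1) ltn_exp2r ?prime_gt1.
have m0 : (0 < m)%N by move: n0; rewrite nE muln_gt0 => /andP[].
have cm : coprime m (l ^ j.+1) by rewrite coprime_sym coprimeXl.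
have lj0 : (0 < l ^ j.+1)%N by apply: ltnW.
rewrite nE (fM m _ m0 lj0 cm) (gM m _ m0 lj0 cm) fg // IH //.
move: nk; rewrite nE ltnS => nk; apply: leq_trans nk.
by rewrite -[X in (X < _)%N]muln1 ltn_pmul2l.
Qed.

Lemma divisors_pfactor l k : prime l ->
  perm_eq (divisors (l ^ k)) [seq (l ^ i)%N | i <- iota 0 k.+1].
Proof.
move=> lp; apply: uniq_perm; first exact: divisors_uniq.
  rewrite map_inj_uniq ?iota_uniq // => i j /eqP; rewrite eqn_exp2l ?prime_gt1 // => /eqP //.
move=> d; rewrite -dvdn_divisors ?expn_gt0 ?prime_gt0 //.
apply/(dvdn_pfactor _ _ lp)/mapP => [[i ik ->]|[i ik ->]]; exists i => //; move: ik;
  by rewrite mem_iota.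
Qed.

Lemma sum_divisors_pfactor (f : nat -> int) l k : prime l ->
  \sum_(d <- divisors (l ^ k)) f d = \sum_(i < k.+1) f (l ^ i)%N.
Proof.
move=> lp; rewrite (perm_big _ (divisors_pfactor k lp)) big_map.
by rewrite -(big_mkord xpredT (fun i => f (l ^ i)%N)) /index_iota subn0.
Qed.

Definition issq (n : nat) : bool := [exists d : 'I_n.+1, (d ^ 2 == n)%N].

Lemma issqP n : reflect (exists d, n = (d ^ 2)%N) (issq n).
Proof.
apply: (iffP existsP) => [[d /eqP <-]|[d ->]]; first by exists d.
have dn : (d < (d ^ 2).+1)%N by rewrite ltnS; case: (d) => // e; rewrite -{1}[e.+1]expn1 leq_pexp2l.
by exists (Ordinal dn).
Qed.

(** If [x * y = d ^ 2] with [x] and [y] coprime, then [x = gcdn d x ^ 2], since [d] is the product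
    of its gcds with [x] and [y]. *)
Lemma issq_coprime m n : (0 < m)%N -> (0 < n)%N -> coprime m n ->
  issq (m * n) = issq m && issq n.
Proof.
move=> m0 n0 co; apply/issqP/andP => [[d E]|[/issqP[a ->] /issqP[b ->]]]; last first.
  by exists (a * b)%N; rewrite expnMn.
have H x y : (0 < x)%N -> (0 < y)%N -> coprime x y -> (x * y = d ^ 2)%N -> issq x.
  move=> x0 y0 cxy {}E; apply/issqP; exists (gcdn d x).
  have dxy : (d %| x * y)%N by rewrite E dvdn_mulr.
  have G := gcdn_coprime_mul cxy dxy.
  apply/eqP; rewrite eqn_dvd; apply/andP; split.
    have : (x %| gcdn d x ^ 2 * gcdn d y ^ 2)%N by rewrite -expnMn G -E dvdn_mulr.
    rewrite Gauss_dvdl //; apply: coprimeXr.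
    by apply: coprime_dvdr (dvdn_gcdr _ _) cxy.
  have : (gcdn d x ^ 2 %| x * y)%N by rewrite E dvdn_exp2r ?dvdn_gcdl.
  rewrite Gauss_dvdl //; apply: coprimeXl.
  by apply: coprime_dvdl (dvdn_gcdr _ _) cxy.
split; first exact: H E.
by apply: (H n m) => //; rewrite 1?coprime_sym // mulnC.
Qed.

Lemma issq_multiplicative : multiplicative (fun n => (issq n)%:Z).
Proof.
split; first by have -> : issq 1 by apply/issqP; exists 1%N.
by move=> m n m0 n0 co; rewrite issq_coprime // -mulnb PoszM.
Qed.

Lemma issq_pfactor l k : prime l -> issq (l ^ k) = ~~ odd k.
Proof.
move=> lp; apply/issqP/idP => [[d /(congr1 (logn l))]|].
  by rewrite pfactorK // lognX => ->; rewrite oddM.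
move=> ek; exists (l ^ k./2)%N; rewrite -expnM muln2.
by rewrite -[in LHS](odd_double_half k) (negPf ek).
Qed.

Lemma rho_coprime m a b : (0 < a)%N -> (0 < b)%N -> coprime a b ->
  rho m (a * b) = (rho m a * rho m b)%N.
Proof.
move=> a0 b0 co; rewrite /rho big_distrlr pair_big /=.
have ab0 : (0 < a * b)%N by rewrite muln_gt0 a0.
pose h (ij : 'I_a * 'I_b) : 'I_(a * b) := Ordinal (ltn_pmod (chinese a b ij.1 ij.2) ab0).
pose g (k : 'I_(a * b)) : 'I_a * 'I_b := (Ordinal (ltn_pmod k a0), Ordinal (ltn_pmod k b0)).
have hg : cancel g h.
  move=> k; apply: val_inj => /=.
  by rewrite -(chinese_mod co) modn_small.
have gh : cancel h g.
  move=> [i j]; congr (_, _); apply: val_inj => /=.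
    by rewrite modn_dvdm ?dvdn_mulr // chinese_modl // modn_small.
  by rewrite modn_dvdm ?dvdn_mull // chinese_modr // modn_small.
rewrite (reindex h) /=; last by exists g => x _.
apply: eq_bigr => -[i j] _ /=.
set k := ((chinese a b i j) %% (a * b))%N.
rewrite mulnb; congr nat_of_bool; rewrite Gauss_dvd //.
have ki : k = i %[mod a] by rewrite modn_dvdm ?dvdn_mulr // chinese_modl.
have kj : k = j %[mod b] by rewrite modn_dvdm ?dvdn_mull // chinese_modr.
have E (c x y : nat) : x = y %[mod c] -> (c %| x ^ 2 + x + m)%N = (c %| y ^ 2 + y + m)%N.
  move=> xy; have e2 : x ^ 2 = y ^ 2 %[mod c] by rewrite -modnXm xy modnXm.
  by rewrite /dvdn -modnDml -(modnDm (x ^ 2)) e2 xy modnDm modnDml.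
by rewrite (E _ _ _ ki) (E _ _ _ kj).
Qed.

Lemma rho1 m : rho m 1 = 1%N.
Proof. by rewrite /rho big_ord1 dvd1n. Qed.

Lemma rho_multiplicative m : multiplicative (fun n => (rho m n)%:Z).
Proof.
split; first by rewrite rho1.
by move=> a b a0 b0 co; rewrite rho_coprime // PoszM.
Qed.

Lemma sum_ord_mul (G : nat -> nat) (q l : nat) :
  (\sum_(b < q * l) G b = \sum_(b < q) \sum_(t < l) G (b + q * t))%N.
Proof.
rewrite exchange_big /=; elim: l => [|l IH]; first by rewrite muln0 !big_ord0.
rewrite mulnS addnC big_split_ord /= IH big_ord_recr /=; congr (_ + _)%N.
by apply: eq_bigr => i _; rewrite addnC.
Qed.

Lemma count_linear (l c u : nat) : prime l -> ~~ (l %| u)%N ->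
  (\sum_(t < l) (l %| c + t * u) = 1)%N.
Proof.
move=> lp lu; have chl := pchar_Fp lp.
have u0 : (u%:R : 'F_l) != 0 by rewrite -(dvdn_pcharf chl).
pose x : 'F_l := - c%:R / u%:R.
have xl : (x < l)%N by have := ltn_ord x; rewrite [X in (_ < X)%N](Fp_cast lp).
have E (t : 'I_l) : (l %| c + t * u)%N = (t == Ordinal xl).
  rewrite (dvdn_pcharf chl) natrD natrM addrC addr_eq0.
  rewrite -(inj_eq (mulIf (invr_neq0 u0))) mulfK //.
  apply/eqP/eqP => [tx|->]; last by rewrite natr_Zp.
  have xt : x = t :> nat by rewrite /x -tx val_Fp_nat // modn_small.
  by apply: val_inj; exact: esym xt.
rewrite (bigD1 (Ordinal xl)) // E eqxx big1 // => t tx.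
by rewrite E (negPf tx).
Qed.

(** Hensel lifting. The lifts of a root [b] modulo [q] are the [b + q * t], and
    [(b + q * t) ^ 2 + (b + q * t) + m] is [q * (c + t * (2 * b + 1))] modulo [q * l]; the
    derivative [2 * b + 1] being prime to [l], exactly one [t] works. *)
Lemma rho_lift (m l k : nat) : prime l ->
  (forall b, (l %| b ^ 2 + b + m)%N -> ~~ (l %| 2 * b + 1)%N) ->
  rho m (l ^ k.+2) = rho m (l ^ k.+1).
Proof.
move=> lp H; rewrite /rho [(l ^ k.+2)%N]expnSr; set q := (l ^ k.+1)%N.
have lq : (l %| q)%N by rewrite /q expnS dvdn_mulr.
have q0 : (0 < q)%N by rewrite expn_gt0 prime_gt0.
rewrite (sum_ord_mul (fun b => (q * l %| b ^ 2 + b + m)%N : nat)); apply: eq_bigr => b _.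
have [/dvdnP[c cE]|nq] := boolP (q %| b ^ 2 + b + m)%N; last first.
  rewrite big1 // => t _; apply/eqP; rewrite eqb0; apply: contra nq => d.
  have {}d : (q %| (b + q * t) ^ 2 + (b + q * t) + m)%N by apply: dvdn_trans d; rewrite dvdn_mulr.
  have E : ((b + q * t) ^ 2 + (b + q * t) + m = q * (2 * b * t + q * t ^ 2 + t) + (b ^ 2 + b + m))%N.
    by ring.
  by move: d; rewrite E dvdn_addr // dvdn_mulr.
have cl : (\sum_(t < l) (l %| c + t * (2 * b + 1)) = 1)%N.
  by apply: count_linear => //; apply: H; rewrite cE dvdn_mull.
rewrite -[RHS]cl.
apply: eq_bigr => t _; congr nat_of_bool.
have -> : ((b + q * t) ^ 2 + (b + q * t) + m = q * (c + t * (2 * b + 1) + q * t ^ 2))%N.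
  have -> : ((b + q * t) ^ 2 + (b + q * t) + m = q * (2 * b * t + q * t ^ 2 + t) + (b ^ 2 + b + m))%N.
    by ring.
  by rewrite cE; ring.
by rewrite dvdn_pmul2l // dvdn_addl // dvdn_mulr.
Qed.

Section IdealCount.
Variables p m : nat.
Hypotheses (p_prime : prime p) (pm : (p.+1 = 4 * m)%N).

Definition chi (n : nat) : int := @legendre p n%:R.

Lemma four_poly b : (4 * (b ^ 2 + b + m) = (2 * b + 1) ^ 2 + p)%N.
Proof. by lia. Qed.

Lemma chiM a b : chi (a * b) = chi a * chi b.
Proof. by rewrite /chi natrM legM //; apply: mod4_of_pm pm. Qed.

Lemma chiX a k : chi (a ^ k) = chi a ^+ k.
Proof.
elim: k => [|k IH]; first by rewrite /chi leg1.
by rewrite expnS chiM IH exprS.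
Qed.

Lemma chi_p : chi p = 0.
Proof. by rewrite /chi pchar_Fp_0 // leg0. Qed.

Lemma coprime_p4 : coprime p 4.
Proof. rewrite (@coprime_pexpr 2 p 2) // coprimen2; exact: p_odd (mod4_of_pm pm). Qed.

(** Everything follows from [4 * (b ^ 2 + b + m) = (2 * b + 1) ^ 2 + p]. For [l = p] there is one
    root modulo [p], and none modulo [p ^ 2], which would have to divide [p]. For other [l] a double
    root would force [l] to divide [p], so Hensel lifting reduces to the first power, and
    [chi l ^+ k] is harmless because [chi l] is 1 or [-1]. *)
Lemma rho_ppow l k : prime l -> (rho m (l ^ k.+1))%:Z = chi l ^+ k * (1 + chi l).
Proof.
move=> lp; have [->|lnp] := eqVneq l p.
  have pd b : (p %| b ^ 2 + b + m)%N = (p %| 2 * b + 1)%N.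
    by rewrite -(Gauss_dvdr _ coprime_p4) four_poly dvdn_addl // Euclid_dvdX // andbT.
  rewrite chi_p; case: k => [|k].
    have cl : (\sum_(t < p) (p %| 1 + t * 2) = 1)%N.
      apply: count_linear => //.
      by rewrite dvdn_prime2 //; apply: contraTneq (p_odd (mod4_of_pm pm)) => ->.
    rewrite expn1 expr0 mul1r addr0 -[1]/(1%N%:Z); congr Posz; rewrite -[RHS]cl.
    by apply: eq_bigr => b _; rewrite pd mulnC addnC.
  rewrite exprS !mul0r /rho big1 // => b _; apply/eqP; rewrite eqb0.
  apply/negP => d.
  have {}d : (p ^ 2 %| b ^ 2 + b + m)%N by apply: dvdn_trans d; rewrite dvdn_exp2l.
  have pb : (p %| 2 * b + 1)%N by rewrite -pd; apply: dvdn_trans d; rewrite dvdn_mulr.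
  have : (p ^ 2 %| (2 * b + 1) ^ 2 + p)%N by rewrite -four_poly dvdn_mull.
  rewrite dvdn_addr ?dvdn_exp2r // => /dvdn_leq; rewrite prime_gt0 // => /(_ isT).
  by rewrite leqNgt -[X in (X < _)%N]expn1 ltn_exp2l ?prime_gt1.
have H b : (l %| b ^ 2 + b + m)%N -> ~~ (l %| 2 * b + 1)%N.
  move=> d; apply: contra lnp => d2.
  have : (l %| (2 * b + 1) ^ 2 + p)%N by rewrite -four_poly dvdn_mull.
  by rewrite (dvdn_addr _ (dvdn_exp _ d2)) // dvdn_prime2.
have -> : rho m (l ^ k.+1) = rho m l.
  by elim: k => [|k IH]; rewrite ?expn1 // rho_lift.
rewrite (rho_prime p_prime pm lp lnp) -/(chi l).
have l0 : (l%:R : 'F_p) != 0.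
  by rewrite -(dvdn_pcharf (pchar_Fp p_prime)) dvdn_prime2 // eq_sym.
have [] := leg_values l0; rewrite -/(chi l) => ->; rewrite ?expr1n ?mul1r //.
by rewrite subrr mulr0.
Qed.

(* The ideal k (Z a + Z (b + w)) has norm k^2 a: rho counts the possible b, and
   the square factor accounts for k. *)
Definition ideal_count (n : nat) : int :=
  dconv (fun a => (rho m a)%:Z) (fun n => (issq n)%:Z) n.

(** Both sides are multiplicative. At [l ^ k] the induction goes from [k] to [k + 2]: this keeps the
    parity conditions on the old terms, and the one new nonzero term that [rho] adds beyond them is
    [chi l ^+ k.+1 * (1 + chi l)], that is the two new powers of [chi l]. *)
Lemma ideal_countE n : (0 < n)%N -> ideal_count n = \sum_(d <- divisors n) chi d.
Proof.
move=> n0; have -> : \sum_(d <- divisors n) chi d = dconv chi (fun=> 1) n.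
  by apply: eq_bigr => d _; rewrite mulr1.
apply: (multiplicative_eq _ _ _ n0).
- by apply: dconv_multiplicative (rho_multiplicative m) issq_multiplicative.
- apply: dconv_multiplicative; split=> //; first by rewrite /chi leg1.
  by move=> *; rewrite chiM.
move=> l k lp; rewrite /ideal_count /dconv !sum_divisors_pfactor //=.
rewrite (eq_bigr (fun i : 'I_k.+1 => (rho m (l ^ i))%:Z * (~~ odd (k - i))%:Z)); last first.
  by move=> i _; rewrite -expnB ?prime_gt0 ?issq_pfactor // -ltnS.
rewrite [RHS](eq_bigr (fun i : 'I_k.+1 => chi l ^+ i)); last first.
  by move=> i _; rewrite chiX mulr1.
have [j] := ubnP k; elim: j k => // j IH [|[|k]] kj.
- by rewrite !big_ord_recr !big_ord0 /= rho1.
- rewrite !big_ord_recr !big_ord0 /= rho1 (@rho_ppow l 0) //=.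
  by rewrite expr0 expr1; ring.
rewrite (big_ord_recr k.+2) (big_ord_recr k.+1) [RHS](big_ord_recr k.+2) (big_ord_recr k.+1) /=.
rewrite subnn /= subSnn /= mulr0 addr0 mulr1 rho_ppow //.
rewrite (eq_bigr (fun i : 'I_k.+1 => (rho m (l ^ i))%:Z * (~~ odd (k - i))%:Z)); last first.
  move=> i _; have ik : (i <= k)%N by rewrite -ltnS.
  by rewrite (subSn (leqW ik)) (subSn ik) /= negbK.
rewrite IH; last by lia.
by rewrite -addrA; congr (_ + _); rewrite mulrDr mulr1 -exprSr.
Qed.

End IdealCount.

(** * The first moment and the sum over even residues *)

Lemma sum_even (F : nat -> int) p h : p = h.*2.+1 ->
  \sum_(a < p | ~~ odd a) F a = \sum_(b < h.+1) F b.*2.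
Proof.
move=> ->; elim: h => [|h IH]; first by rewrite big_mkcond !big_ord_recr !big_ord0 /=.
rewrite [RHS]big_ord_recr /= -IH big_mkcond doubleS !big_ord_recr /= [in RHS]big_mkcond big_ord_recr /=.
by rewrite odd_double /= addr0.
Qed.

Lemma sum_odd (F : nat -> int) p h : p = h.*2.+1 ->
  \sum_(a < p | odd a) F a = \sum_(b < h) F b.*2.+1.
Proof.
move=> ->; elim: h => [|h IH]; first by rewrite big_mkcond !big_ord_recr !big_ord0 /= addr0.
rewrite [RHS]big_ord_recr /= -IH big_mkcond doubleS !big_ord_recr /= [in RHS]big_mkcond big_ord_recr /=.
by rewrite odd_double /= !addr0.
Qed.

(** Let [S1] and [B] be the sums of [chi b] and [b * chi b] over the lower half. Splitting the first
    moment at the middle gives [2 * B - p * S1], splitting it by parity gives [4 * c * B - p * S],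
    and [S = c * S1]; the claim results from eliminating [B]. *)
Lemma moment_even_sum (chi : nat -> int) (p h : nat) (c : int) :
  p = h.*2.+1 -> chi 0%N = 0 -> (forall b, (b <= p)%N -> chi (p - b)%N = - chi b) ->
  (forall b, chi b.*2 = c * chi b) -> c * c = 1 ->
  first_moment p chi * (1 - 2 * c) = p%:Z * \sum_(a < p | ~~ odd a) chi a.
Proof.
move=> ph chi0 chiN chi2 cc.
set S := \sum_(a < p | _) _.
pose S1 := \sum_(b < h.+1) chi b; pose B := \sum_(b < h.+1) b%:Z * chi b.
have SE : S = c * S1.
  by rewrite /S (sum_even chi ph) mulr_sumr; apply: eq_bigr => b _.
have EE : \sum_(a < p | ~~ odd a) a%:Z * chi a = 2 * c * B.
  rewrite (sum_even (fun a => a%:Z * chi a) ph) mulr_sumr; apply: eq_bigr => b _.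
  by rewrite chi2 -muln2 PoszM; ring.
have OE : \sum_(a < p | odd a) a%:Z * chi a = 2 * c * B - p%:Z * S.
  rewrite -EE (sum_odd (fun a => a%:Z * chi a) ph) (sum_even (fun a => a%:Z * chi a) ph).
  rewrite /S (sum_even chi ph) !big_ord_recl /= !chi0 mulr0 !add0r (reindex_inj rev_ord_inj) /=.
  rewrite mulr_sumr -sumrB; apply: eq_bigr => b _; rewrite /bump /= add1n.
  have bh := ltn_ord b.
  have -> : ((h - b.+1).*2.+1 = p - b.+1.*2)%N by rewrite ph; clear -bh; lia.
  have bp : (b.+1.*2 <= p)%N by rewrite ph; clear -bh; lia.
  by rewrite chiN // -subzn //; ring.
have AE : first_moment p chi = 2 * B - p%:Z * S1.
  have hp : (h.+1 <= p)%N by rewrite ph; clear; lia.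
  rewrite /first_moment (sum_ord_split (fun a => a%:Z * chi a) hp) -/B.
  have -> : (p - h.+1 = h)%N by rewrite ph; clear; lia.
  suff -> : \sum_(i < h) (h.+1 + i)%N%:Z * chi (h.+1 + i)%N = B - p%:Z * S1 by ring.
  rewrite /B /S1 !big_ord_recl /= chi0 mulr0 !add0r mulr_sumr -sumrB.
  rewrite (reindex_inj rev_ord_inj) /=; apply: eq_bigr => b _; rewrite /bump /= add1n.
  have bh := ltn_ord b.
  have -> : (h.+1 + (h - b.+1) = p - b.+1)%N by rewrite ph; clear -bh; lia.
  have bp : (b.+1 <= p)%N by rewrite ph; clear -bh; lia.
  by rewrite chiN // -subzn //; ring.
have AE2 : first_moment p chi = 4 * c * B - p%:Z * S.
  rewrite /first_moment (bigID (fun a : 'I_p => ~~ odd a)) /= EE.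
  rewrite (eq_bigl (fun a : 'I_p => odd a)) ?OE; first by ring.
  by move=> a; rewrite negbK.
have -> : first_moment p chi * (1 - 2 * c) =
   (4 * c * B - p%:Z * S) - 2 * c * (2 * B - p%:Z * S1) by rewrite -AE -AE2; ring.
by rewrite SE; ring.
Qed.

Lemma pos3_levels (X : nat) (q : int) : 0 <= q ->
  pos3 (X%:Z - q) = \sum_(n < X.+1) (q == n%:Z)%:R * pos3 (X%:Z - n%:Z).
Proof.
move=> q0; have [qX|Xq] := leP q X%:Z; last first.
  rewrite pos3_le0 ?subr_le0 ?ltW // big1 // => n _.
  case: eqP => [E|_]; last by rewrite mul0r.
  by have := ltn_ord n; clear -E Xq; lia.
have lt : (`|q|%N < X.+1)%N by clear -qX q0; lia.
rewrite (bigD1 (Ordinal lt)) //= gez0_abs // eqxx mul1r big1 ?addr0 // => n nq.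
case: eqP => [E|_]; last by rewrite mul0r.
by case/eqP: nq; apply: val_inj => /=; rewrite E.
Qed.

Lemma chi_riesz_divisors (chi : nat -> int) (X R : nat) : chi 0%N = 0 -> (X < R)%N ->
  chi_riesz chi X R =
  \sum_(n < X) (\sum_(d <- divisors n.+1) chi d) * pos3 (X%:Z - n.+1%:Z).
Proof.
move=> chi0 XR; rewrite /chi_riesz.
transitivity (\sum_(d < R) \sum_(n < X) (d %| n.+1)%:R * chi d * pos3 (X%:Z - n.+1%:Z)).
  (* At [d = 0] all terms of [riesz] equal [X ^ 3], and only [chi 0 = 0] makes them disappear. *)
  apply: eq_bigr => d _; have [->|d0] := posnP d.
    by rewrite chi0 mul0r big1 // => n _; rewrite mulr0 mul0r.
  rewrite /riesz.
  have -> : \sum_(m < R) pos3 (X%:Z - d%:Z * m.+1%:Z) =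
    \sum_(m < R) \sum_(n < X) ((d * m.+1)%N == n.+1)%:R * pos3 (X%:Z - n.+1%:Z).
    apply: eq_bigr => m _; rewrite -PoszM pos3_levels // big_ord_recl /=.
    rewrite eqz_nat muln_eq0 /= (gtn_eqF d0) /= mul0r add0r.
    by apply: eq_bigr => n _; rewrite /bump /= add1n eqz_nat.
  rewrite exchange_big mulr_sumr /=; apply: eq_bigr => n _.
  rewrite -mulr_suml mulrA (mulrC (chi d)); congr (_ * _ * _).
  have [/dvdnP[k kE]|nd] := boolP (d %| n.+1)%N; last first.
    by rewrite big1 // => m _; case: eqP => // E; move: nd; rewrite -E dvdn_mulr.
  have k0 : (0 < k)%N by move: kE; case: (k).
  have kR : (k.-1 < R)%N.
    rewrite prednK //; apply: (@leq_trans n.+1); first by rewrite kE leq_pmulr.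
    by apply: leq_trans (ltn_ord n) (ltnW XR).
  rewrite (bigD1 (Ordinal kR)) //= prednK // kE mulnC eqxx big1 ?addr0 // => m mk.
  rewrite mulnC eqn_pmul2r //; case: eqP => // E.
  by case/eqP: mk; apply: val_inj => /=; rewrite -E.
rewrite exchange_big /=; apply: eq_bigr => n _.
rewrite -mulr_suml; congr (_ * _).
have nR : (n.+2 <= R)%N by apply: leq_trans XR; rewrite ltnS.
rewrite (sum_ord_split (fun d => (d %| n.+1)%:R * chi d) nR) [X in _ + X]big1 ?addr0; last first.
  move=> d _; rewrite gtnNdvd ?mul0r //; clear; lia.
rewrite (eq_bigr (fun d : 'I_n.+2 => if (d %| n.+1)%N then chi d else 0)); last first.
  by move=> d _; case: ifP; rewrite ?mul1r ?mul0r.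
by rewrite -big_mkcond sum_divisors.
Qed.

(** * The sum over powers of a primitive root *)

Section PrimitiveRoot.
Variables (p : nat) (v : int).
Hypotheses (p_prime : prime p) (p_mod4 : (p = 3 %[mod 4])%N)
  (v_prim : primitive_root_mod p v).
Local Notation x0 := (v%:~R : 'F_p).

Lemma leg_primitive_root : @legendre p x0 = -1.
Proof.
have p1 : (0 < p.-1)%N by have := prime_gt1 p_prime; lia.
have xn0 : x0 != 0.
  apply/eqP => E; have := prim_expr_order v_prim.
  by rewrite E expr0n (gtn_eqF p1) => /esym/eqP; rewrite oner_eq0.
have [E|//] := leg_values xn0.
have := half_power p_prime p_mod4 xn0; rewrite E eqxx => /eqP.
rewrite -(prim_order_dvd v_prim) => /dvdn_leq.
have h := half_double p_prime p_mod4; have o := half_odd p_prime p_mod4.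
have h0 : (0 < p.-1./2)%N by move: o; case: (p.-1./2).
by move/(_ h0); lia.
Qed.

Lemma leg_exp (x : 'F_p) i : @legendre p (x ^+ i) = @legendre p x ^+ i.
Proof.
elim: i => [|i IH]; first by rewrite !expr0 leg1.
by rewrite !exprS legM // IH.
Qed.

(** The powers [v^(-i)] run once through the nonzero residues, and [(-1) ^+ i] is the symbol of
    [v^(-i)] because a primitive root is a nonresidue. The even residue 0 enters on the right with
    value 0. *)
Lemma signed_residue_sum :
  \sum_(i < p.-1 | ~~ odd (residue_pow p v (- i%:Z))) (-1) ^+ i
  = \sum_(a < p | ~~ odd a) chi p a :> int.
Proof.
have p1 : (0 < p.-1)%N by have := prime_gt1 p_prime; lia.
have xn0 : x0 != 0.
  by rewrite -(leg_eq0 x0) leg_primitive_root.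
pose g (i : 'I_p.-1) : 'F_p := x0 ^- i.
have gE (i : 'I_p.-1) : x0 ^ (- i%:Z) = g i by rewrite -exprnN.
have gi : injective g.
  move=> i j /invr_inj/eqP; rewrite (eq_prim_root_expr v_prim).
  by rewrite !modn_small // => /eqP/val_inj.
have im : [set g i | i in [set: 'I_p.-1]] = [set~ 0].
  apply/eqP; rewrite eqEcard; apply/andP; split.
    by apply/fintype.subsetP => _ /imsetP[i _ ->]; rewrite !inE invr_eq0 expf_neq0.
  by rewrite card_imset // cardsT card_ord cardsC1 card_Fp.
transitivity (\sum_(x in [set~ (0 : 'F_p)] | ~~ odd x) @legendre p x).
  rewrite big_mkcondr -im big_imset /=; last by move=> i j _ _; apply: gi.
  rewrite [LHS]big_mkcond [RHS]big_mkcond /=; apply: eq_bigr => i _; rewrite inE /=.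
  rewrite /residue_pow gE /g legV // leg_exp leg_primitive_root; by case: ifP.
have E : (Zp_trunc (pdiv p)).+2 = p by exact: Fp_cast.
rewrite -(big_mkord (fun a => ~~ odd a) (chi p)) -[X in index_iota 0 X]E big_mkord.
rewrite [RHS](bigD1 (0 : 'F_p)) //= /chi leg0 add0r.
apply: eq_big => x; first by rewrite !inE andbC.
by rewrite natr_Zp.
Qed.
End PrimitiveRoot.

(** * Ideals of Z[w] in coordinates *)

Lemma int_subgroup (S : int -> Prop) :
  (forall x y, S x -> S y -> S (x + y)) -> (forall x, S x -> S (- x)) ->
  (exists2 x, S x & x != 0) ->
  exists2 g : nat, (0 < g)%N & forall x, S x <-> exists i, x = i * g%:Z.
Proof.
move=> SD SN [x0 Sx0 x00].
have ex : exists n : nat, `[< (0 < n)%N /\ S n%:Z >].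
  exists `|x0|%N; apply/asboolP; split; first by rewrite absz_gt0.
  by have [->|->] : `|x0|%N%:Z = x0 \/ `|x0|%N%:Z = - x0 by [lia| |]; [|apply: SN].
have [g /asboolP[g0 Sg] gmin] := ex_minnP ex.
exists g => // x.
have S0 : S 0 by rewrite -(subrr x0); apply: SD; [|apply: SN].
have Sm (i : int) : S (i * g%:Z).
  have Sn (n : nat) : S (n%:Z * g%:Z).
    elim: n => [|n IH]; first by rewrite mul0r.
    by rewrite intS mulrDl mul1r; apply: SD.
  case: i => n; first exact: Sn.
  by rewrite NegzE mulNr; apply: SN.
split=> [Sx|[i ->]//].
have Sr : S (x %% g%:Z)%Z.
  by rewrite /modz; apply: SD => //; apply: SN.
have r0 : 0 <= (x %% g%:Z)%Z by apply: modz_ge0; lia.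
have rg : (x %% g%:Z)%Z < g%:Z by apply: ltz_pmod; lia.
have [r1|r1] := eqVneq (x %% g%:Z)%Z 0.
  by exists (x %/ g%:Z)%Z; rewrite [LHS](divz_eq x g%:Z) r1 addr0.
have := gmin `|(x %% g%:Z)%Z|%N.
have -> : `[< (0 < `|(x %% g%:Z)%Z|)%N /\ S `|(x %% g%:Z)%Z|%N%:Z >].
  by apply/asboolP; split; rewrite ?absz_gt0 // gez0_abs.
by move/(_ isT); lia.
Qed.

Definition span2 (e f z : int * int) : Prop :=
  exists i j : int, z = (i * e.1 + j * f.1, i * e.2 + j * f.2).

(** Up to sign, the index of the lattice spanned by [e] and [f]; for an ideal, its norm. *)
Definition det2 (e f : int * int) : int := e.1 * f.2 - e.2 * f.1.

Lemma det2_span (e f e' f' : int * int) :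
  span2 e f e' -> span2 e f f' -> exists i, det2 e' f' = i * det2 e f.
Proof.
move=> [i [j ->]] [i' [j' ->]]; exists (i * j' - j * i').
by rewrite /det2 /=; ring.
Qed.

Lemma span2_l e f : span2 e f e.
Proof. by exists 1, 0; case: e => x y /=; rewrite !mul1r !mul0r !addr0. Qed.

Lemma span2_r e f : span2 e f f.
Proof. by exists 0, 1; case: f => x y /=; rewrite !mul1r !mul0r !add0r. Qed.

(** Each of the two determinants is a multiple of the other. *)
Lemma det2_eq (e f e' f' : int * int) : (forall z, span2 e f z <-> span2 e' f' z) ->
  0 < det2 e f -> 0 < det2 e' f' -> det2 e f = det2 e' f'.
Proof.
move=> H p1 p2.
have [i Ei] : exists i, det2 e' f' = i * det2 e f.
  by apply: det2_span; apply/H; [apply: span2_l|apply: span2_r].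
have [j Ej] : exists j, det2 e f = j * det2 e' f'.
  by apply: det2_span; apply/H; [apply: span2_l|apply: span2_r].
have i0 : 0 < i by move: p2; rewrite Ei pmulr_lgt0.
have j0 : 0 < j by move: p1; rewrite Ej pmulr_lgt0.
apply: le_anti; apply/andP; split.
  by rewrite Ei; apply: ler_peMl; [exact: ltW|lia].
by rewrite Ej; apply: ler_peMl; [exact: ltW|lia].
Qed.

Section Ideals.
Variable m : nat.
Hypothesis m_gt0 : (0 < m)%N.

Lemma norm_form_neq0 (x y : int) : (x, y) != (0, 0) ->
  x ^+ 2 + x * y + m%:Z * y ^+ 2 != 0.
Proof.
apply: contra => /eqP E.
have E4 : (2 * x + y) ^+ 2 + (4 * m%:Z - 1) * y ^+ 2 = 0.
  have -> : (2 * x + y) ^+ 2 + (4 * m%:Z - 1) * y ^+ 2 = 4 * (x ^+ 2 + x * y + m%:Z * y ^+ 2).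
    by ring.
  by rewrite E mulr0.
have m0 : 0 < 4 * m%:Z - 1 by lia.
move/eqP: E4; rewrite paddr_eq0 ?sqr_ge0 ?(mulr_ge0 (ltW m0) (sqr_ge0 y)) // => /andP[].
rewrite sqrf_eq0 mulf_eq0 (gt_eqF m0) /= sqrf_eq0 => /eqP xy /eqP y0.
by apply/eqP; congr (_, _); lia.
Qed.

(* An ideal of Z[w], w^2 = w - m, in coordinates with respect to (1, w). *)
Definition wideal (P : int * int -> Prop) : Prop :=
  [/\ forall z z', P z -> P z' -> P (z.1 + z'.1, z.2 + z'.2),
      forall z, P z -> P (- z.1, - z.2),
      forall z, P z -> P (- m%:Z * z.2, z.1 + z.2) &
      exists2 z, P z & z != (0, 0)].

Lemma wideal_scale P (i : int) z : wideal P -> P z -> P (i * z.1, i * z.2).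
Proof.
move=> [PD PN PW [z0 Pz0 _]] Pz.
have Pn (n : nat) : P (n%:Z * z.1, n%:Z * z.2).
  elim: n => [|n IH]; last by rewrite intS !mulrDl !mul1r; apply: PD IH.
  by rewrite !mul0r; have := PD _ _ Pz0 (PN _ Pz0); rewrite /= !subrr.
case: i => n; first exact: Pn.
by rewrite NegzE !mulNr; apply: (PN _ (Pn n.+1)).
Qed.

(** Let [d] generate the second coordinates and [g] the elements [(x, 0)]. Multiplying [(b0, d)] and
    [(g, 0)] by [w] shows that [d] divides [b0] and [g], so [d] comes out as a common factor and
    [a = g / d]. Subtracting [w] times [(d b, d)] from [b + 1] times it leaves
    [(d (b^2 + b + m), 0)], which gives the divisibility by [a]. *)
Lemma hnf_exists P : wideal P -> exists d a b : nat,
  [/\ (0 < d)%N, (0 < a)%N, (b < a)%N, (a %| b ^ 2 + b + m)%N &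
      forall z, P z <-> span2 (d%:Z * a%:Z, 0) (d%:Z * b%:Z, d%:Z) z].
Proof.
move=> wP; have [PD PN PW [[z1 z2] Pz z0]] := wP.
have Psub z z' : P z -> P z' -> P (z.1 - z'.1, z.2 - z'.2).
  by move=> Hz Hz'; apply: (PD _ _ Hz (PN _ Hz')).
have [d d0 Hd] : exists2 d : nat, (0 < d)%N &
   forall y, (exists x, P (x, y)) <-> exists i, y = i * d%:Z.
  apply: (@int_subgroup (fun y => exists x, P (x, y))).
  - by move=> y y' [x Px] [x' Px']; exists (x + x'); apply: (PD _ _ Px Px').
  - by move=> y [x Px]; exists (- x); apply: (PN _ Px).
  - have [z2_0|z2_0] := eqVneq z2 0; last by exists z2 => //; exists z1.
    exists (z1 + z2); first by exists (- m%:Z * z2); apply: (PW _ Pz).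
    by move: z0; rewrite z2_0 addr0; apply: contra => /eqP ->.
have [g g0 Hg] : exists2 g : nat, (0 < g)%N &
   forall x, P (x, 0) <-> exists i, x = i * g%:Z.
  apply: (@int_subgroup (fun x => P (x, 0))).
  - by move=> x x' Px Px'; have := PD _ _ Px Px'; rewrite /= addr0.
  - by move=> x Px; have := PN _ Px; rewrite /= oppr0.
  - exists (z1 ^+ 2 + z1 * z2 + m%:Z * z2 ^+ 2).
      have h1 := wideal_scale (z1 + z2) wP Pz.
      have h2 := wideal_scale z2 wP (PW _ Pz).
      have := Psub _ _ h1 h2; rewrite /=; congr P; congr (_, _); ring.
    exact: norm_form_neq0.
have [b0 Pb0] : exists x, P (x, d%:Z) by apply/Hd; exists 1; rewrite mul1r.
have [b1 Eb1] : exists i, b0 + d%:Z = i * d%:Z.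
  by apply/Hd; exists (- m%:Z * d%:Z); apply: (PW _ Pb0).
have Eb : b0 = (b1 - 1) * d%:Z by rewrite mulrBl -Eb1 mul1r addrK.
have [a Ea] : exists i, g%:Z = i * d%:Z.
  apply/Hd; exists 0.
  have Pg : P (g%:Z, 0) by apply/Hg; exists 1; rewrite mul1r.
  by have := PW _ Pg; rewrite /= mulr0 addr0.
have a0 : 0 < a by move: g0; rewrite -ltz_nat Ea pmulr_lgt0.
pose b := ((b1 - 1) %% a)%Z.
have b_ge0 : 0 <= b by apply: modz_ge0; lia.
have b_lt : b < a by apply: ltz_pmod.
have Pa : P (d%:Z * a, 0) by apply/Hg; exists 1; rewrite Ea mul1r mulrC.
have Pb : P (d%:Z * b, d%:Z).
  have := Psub _ _ Pb0 (wideal_scale ((b1 - 1) %/ a)%Z wP Pa); rewrite /= mulr0 subr0.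
  by congr P; congr (_, _); rewrite Eb /b /modz; ring.
have dv : (a %| b ^+ 2 + b + m%:Z)%Z.
  have : P (d%:Z * (b ^+ 2 + b + m%:Z), 0).
    have h := Psub _ _ (wideal_scale (b + 1) wP Pb) (PW _ Pb); move: h => /=.
    by congr P; congr (_, _); ring.
  move/Hg => [i Ei]; apply/dvdzP; exists i.
  have dz : d%:Z != 0 by lia.
  by apply: (mulfI dz); rewrite Ei Ea; ring.
exists d, `|a|%N, `|b|%N; split => //; rewrite ?absz_gt0; try lia.
  move: dv; rewrite /dvdz /=; congr (_ %| _)%N; apply/eqP.
  rewrite -eqz_nat gez0_abs; last by rewrite addr_ge0 // addr_ge0 // sqr_ge0.
  by rewrite !PoszD -mulnn PoszM (gez0_abs b_ge0) expr2.
rewrite (gez0_abs (ltW a0)) (gez0_abs b_ge0) => -[x y]; split.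
  move=> Pxy; have [j Ej] : exists j, y = j * d%:Z by apply/Hd; exists x.
  have : P (x - j * (d%:Z * b), 0).
    have := Psub _ _ Pxy (wideal_scale j wP Pb); rewrite /=.
    by congr P; congr (_, _); rewrite Ej subrr.
  move/Hg => [i Ei]; exists i, j; congr (_, _) => /=; last by rewrite mulr0 add0r.
  by rewrite -(mulrC a) -Ea -Ei subrK.
move=> [i [j [-> ->]]] /=.
by apply: (PD _ _ (wideal_scale i wP Pa) (wideal_scale j wP Pb)).
Qed.

End Ideals.

Lemma hnf_unique (d a b d' a' b' : nat) :
  (0 < d)%N -> (0 < a)%N -> (b < a)%N -> (0 < d')%N -> (0 < a')%N -> (b' < a')%N ->
  (forall z, span2 (d%:Z * a%:Z, 0) (d%:Z * b%:Z, d%:Z) z <->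
             span2 (d'%:Z * a'%:Z, 0) (d'%:Z * b'%:Z, d'%:Z) z) ->
  [/\ d = d', a = a' & b = b'].
Proof.
have dle (d1 a1 b1 d2 a2 b2 : nat) : (0 < d1)%N -> (0 < d2)%N ->
  (forall z, span2 (d1%:Z * a1%:Z, 0) (d1%:Z * b1%:Z, d1%:Z) z <->
             span2 (d2%:Z * a2%:Z, 0) (d2%:Z * b2%:Z, d2%:Z) z) -> (d2 <= d1)%N.
  move=> p1 p2 H.
  have /H[i [j []]] := span2_r (d1%:Z * a1%:Z, 0) (d1%:Z * b1%:Z, d1%:Z).
  rewrite /= mulr0 add0r => _ E.
  have : 0 < j by move: p1; rewrite -ltz_nat E pmulr_lgt0.
  by move=> j0; rewrite -lez_nat E ler_peMl //; lia.
move=> d0 a0 ba d0' a0' ba' H.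
have E : d = d'.
  by apply/eqP; rewrite eqn_leq (dle _ _ _ _ _ _ d0' d0 (fun z => iff_sym (H z))) (dle _ _ _ _ _ _ d0 d0' H).
rewrite -{}E in H *.
have dz : d%:Z != 0 by lia.
have aE : a = a'.
  have := det2_eq H; rewrite /det2 /= !mul0r !subr0 => E.
  have {}E : d%:Z * a%:Z * d%:Z = d%:Z * a'%:Z * d%:Z by apply: E; rewrite !mulr_gt0 ?ltz_nat.
  by move/(mulIf dz)/(mulfI dz): E => [].
split=> //.
have /H[i [j []]] := span2_r (d%:Z * a%:Z, 0) (d%:Z * b%:Z, d%:Z).
rewrite /= mulr0 add0r -aE => E1 E2.
have j1 : j = 1 by apply: (mulIf dz); rewrite -E2 mul1r.
have {}E1 : b%:Z = i * a%:Z + b'%:Z.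
  by apply: (mulfI dz); rewrite E1 j1; ring.
have [i0|[i0|i0]] : i = 0 \/ i >= 1 \/ i <= -1 by lia.
- by move: E1; rewrite i0 mul0r add0r => -[].
- have : a%:Z <= i * a%:Z by rewrite ler_peMl //.
  by rewrite -aE in ba'; lia.
- have : a%:Z <= - i * a%:Z by rewrite ler_peMl //; lia.
  by rewrite mulNr; rewrite -aE in ba'; lia.
Qed.

Lemma Posz_of_pm (p m : nat) : (p.+1 = 4 * m)%N -> p%:Z = 4 * m%:Z - 1.
Proof. by lia. Qed.

Section FractionalBasis.
Variables (m : nat) (a b c : int).
Hypotheses (abc : a * c = b ^+ 2 + b + m%:Z).

(* Coordinates of g a and g (b + w), where g = (x a + y (b + 1 - w)) / a runs
   over the inverse of the ideal Z a + Z (b + w). *)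
Definition basis1 (x y : int) : int * int := (x * a + y * b + y, - y).
Definition basis2 (x y : int) : int * int := (x * b + y * c, x).

Lemma det_basis x y : det2 (basis1 x y) (basis2 x y) = qf a (2 * b + 1) c x y.
Proof. by rewrite /det2 /qf /=; ring. Qed.

Lemma wideal_basis x y : 0 < qf a (2 * b + 1) c x y ->
  wideal m (span2 (basis1 x y) (basis2 x y)).
Proof.
move=> q0; split.
- move=> z z' [i [j ->]] [i' [j' ->]]; exists (i + i'), (j + j').
  by congr (_, _) => /=; ring.
- by move=> z [i [j ->]]; exists (- i), (- j); congr (_, _) => /=; ring.
(* The coefficients come from [w a = - b a + a (b + w)] and [w (b + w) = - c a + (b + 1) (b + w)],
   multiplied by [g]. *)
- move=> z [i [j ->]]; exists (- b * i - c * j), (a * i + (b + 1) * j); congr (_, _) => /=.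
    have -> : m%:Z = a * c - b ^+ 2 - b by rewrite abc; ring.
    by ring.
  by ring.
- have [E|E] := eqVneq (basis1 x y) (0, 0); last first.
    by exists (basis1 x y) => //; apply: span2_l.
  by move: q0; rewrite -det_basis E /det2 /= !mul0r subrr.
Qed.

Variable p : nat.
Hypotheses (p_prime : prime p) (pm : (p.+1 = 4 * m)%N) (p_gt4 : (4 < p)%N).
Hypothesis a_gt0 : 0 < a.

(** The square of the gcd of [a], [2 * b + 1] and [c] divides [4 * a * c - (2 * b + 1) ^ 2 = p], so
    the gcd is 1 and Bezout applies. *)
Lemma primitive_form (q : int) : (a %| q * (2 * b + 1))%Z -> (a %| q * c)%Z -> (a %| q)%Z.
Proof.
move=> h1 h2.
pose g := gcdz a (gcdz (2 * b + 1) c).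
have ga : (g %| a)%Z by apply: dvdz_gcdl.
have gb : (g %| 2 * b + 1)%Z by apply: dvdz_trans (dvdz_gcdr _ _) (dvdz_gcdl _ _).
have gc : (g %| c)%Z by apply: dvdz_trans (dvdz_gcdr _ _) (dvdz_gcdr _ _).
have g2 : (g ^+ 2 %| p%:Z)%Z.
  have -> : p%:Z = 4 * (a * c) - (2 * b + 1) ^+ 2.
    by rewrite abc (Posz_of_pm pm); ring.
  apply: rpredB; last by apply: dvdz_exp2r.
  by apply: dvdz_mull; apply: dvdz_mul.
have g1 : `|g|%N = 1%N.
  have : (`|g| ^ 2 %| p)%N by move: g2; rewrite dvdzE abszX.
  case/primeP: p_prime => p1 H; move=> gp; have := H _ (dvdn_trans (dvdn_mulr _ (dvdnn _)) gp).
  case/orP=> /eqP gE //; move: gp; rewrite gE => /dvdn_leq; rewrite (ltnW p1) => /(_ isT).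
  by rewrite leqNgt -[X in (X < _)%N]expn1 ltn_exp2l.
have [u [v E]] := Bezoutz a (gcdz (2 * b + 1) c).
have [u' [v' E']] := Bezoutz (2 * b + 1) c.
have -> : q = u * q * a + v * u' * (q * (2 * b + 1)) + v * v' * (q * c).
  have gE : g = 1 by rewrite -[g]/(`|g|%N%:Z) g1.
  transitivity (q * g); first by rewrite gE mulr1.
  by rewrite /g -E -E'; ring.
by apply: rpredD; [apply: rpredD|]; apply: dvdz_mull => //; apply: dvdzz.
Qed.

(** Two elements [g] and [g'] giving the same ideal differ by a unit of [Z[w]], and for [p > 4] the
    only units are 1 and [-1]. The integers [u], [v], [r], [s] form the matrix of that unit. *)
Lemma basis_unique x y x' y' :
  0 < qf a (2 * b + 1) c x y -> 0 < qf a (2 * b + 1) c x' y' ->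
  (forall z, span2 (basis1 x y) (basis2 x y) z <-> span2 (basis1 x' y') (basis2 x' y') z) ->
  (x' = x /\ y' = y) \/ (x' = - x /\ y' = - y).
Proof.
move=> q0 q0' H.
have := det2_eq H; rewrite !det_basis => /(_ q0 q0') qq.
have /H[u [v E1]] := span2_l (basis1 x' y') (basis2 x' y').
have /H[r [s E2]] := span2_r (basis1 x' y') (basis2 x' y').
case: E1 => /= E11 E12; case: E2 => /= E21 E22.
set D := qf a (2 * b + 1) c x y in q0 qq.
have DE : D = a * x ^+ 2 + (2 * b + 1) * x * y + c * y ^+ 2 by [].
have D0 : D != 0 by rewrite gt_eqF.
have hy : y' = u * y - v * x by apply: oppr_inj; rewrite E12; ring.
have hx : x' = s * x - r * y by rewrite E22; ring.
(* The equations [r1 = 0] and [r2 = 0] say that both rows of the matrix are multiplication by one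
   element; they are the coordinates of [(b + w) (u a + v (b + w)) = a (r a + s (b + w))], where
   [(b + w)^2 = (2 b + 1) (b + w) - a c]. *)
pose r1 := a * r + v * c; pose r2 := a * s - u * a - v * (2 * b + 1).
have L1 : x * r2 = y * r1.
  apply/eqP; rewrite -subr_eq0; apply/eqP.
  move/eqP: E11; rewrite -subr_eq0 hx hy => /eqP E; rewrite -[RHS]E /r1 /r2; ring.
have L2 : r1 * (a * x + (2 * b + 1) * y) = - (c * y * r2).
  apply/eqP; rewrite -subr_eq0; apply/eqP.
  move/eqP: E21; rewrite -subr_eq0 hx hy => /eqP E.
  by rewrite -[RHS](mulr0 (- a)) -E /r1 /r2; ring.
have r1_0 : r1 = 0.
  apply: (mulIf D0); rewrite mul0r DE.
  have -> : r1 * (a * x ^+ 2 + (2 * b + 1) * x * y + c * y ^+ 2)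
    = x * (r1 * (a * x + (2 * b + 1) * y)) + c * y * (y * r1) by ring.
  by rewrite L2 -L1; ring.
have r2_0 : r2 = 0.
  apply: (mulIf D0); rewrite mul0r DE.
  have -> : r2 * (a * x ^+ 2 + (2 * b + 1) * x * y + c * y ^+ 2)
    = (x * r2) * (a * x + (2 * b + 1) * y) + c * y ^+ 2 * r2 by ring.
  have -> : (x * r2) * (a * x + (2 * b + 1) * y) = y * (r1 * (a * x + (2 * b + 1) * y)).
    by rewrite L1; ring.
  by rewrite L2; ring.
have R1 : a * r = - v * c.
  by apply/eqP; rewrite -subr_eq0 mulNr opprK -/r1 r1_0.
have R2 : a * s = u * a + v * (2 * b + 1).
  by apply/eqP; rewrite -subr_eq0 opprD addrA -/r2 r2_0.
have dt : u * s - v * r = 1.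
  apply: (mulIf D0); rewrite mul1r [RHS]qq /D -!det_basis /det2 /basis1 /basis2 /= E11 E12 E21 E22; ring.
have /dvdzP[v' vE] : (a %| v)%Z.
  apply: primitive_form; apply/dvdzP.
    by exists (s - u); rewrite mulrBl mulrC (mulrC s) R2; ring.
  by exists (- r); rewrite mulNr (mulrC r) R1; ring.
(* The unit has norm 1, which reads [qf a (2 * b + 1) c u v = a]. Completing the square and putting
   [v = v' * a] gives [p * v' ^ 2 <= 4]. *)
have v0 : v = 0.
  have Ea : 4 * (a * a) = (2 * a * u + (2 * b + 1) * v) ^+ 2 + p%:Z * v ^+ 2.
    have E1 : a = a * u ^+ 2 + (2 * b + 1) * u * v + c * v ^+ 2.
      have -> : a * u ^+ 2 + (2 * b + 1) * u * v + c * v ^+ 2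
         = u * (u * a + v * (2 * b + 1)) - v * (- v * c) by ring.
      rewrite -R2 -R1 -[LHS]mulr1 -dt; ring.
    have -> : p%:Z = 4 * (a * c) - (2 * b + 1) ^+ 2.
      by rewrite abc (Posz_of_pm pm); ring.
    by rewrite [X in 4 * (_ * X)]E1; ring.
  have [v'E|v'0] := eqVneq v' 0; first by rewrite vE v'E mul0r.
  exfalso; have aa : 0 < a * a by rewrite mulr_gt0.
  have : p%:Z * (a * a) <= 4 * (a * a).
    rewrite Ea vE; apply: (@le_trans _ _ (p%:Z * (v' * a) ^+ 2)); last by rewrite lerDr sqr_ge0.
    rewrite ler_wpM2l // exprMn -expr2 ler_peMl ?sqr_ge0 //.
    by move: v'0; rewrite -sqrf_eq0 => v'0; have := sqr_ge0 v'; lia.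
  by rewrite ler_pM2r // lez_nat leqNgt p_gt4.
have r0 : r = 0.
  by move/eqP: R1; rewrite v0 oppr0 mul0r mulf_eq0 (gt_eqF a_gt0) => /eqP.
have su : s = u.
  by apply: (mulfI (lt0r_neq0 a_gt0)); rewrite R2 v0 mul0r addr0 mulrC.
have uu : u * u = 1 by rewrite -[RHS]dt su v0 mul0r subr0.
have [u1|u1] : u = 1 \/ u = -1.
  have : (u - 1) * (u + 1) = 0 by rewrite mulrBl !mulrDr uu; ring.
  by move/eqP; rewrite mulf_eq0 subr_eq0 addr_eq0 => /orP[/eqP|/eqP]; [left|right].
- left; move: E12 E22; rewrite r0 su u1 v0; lia.
- right; move: E12 E22; rewrite r0 su u1 v0; lia.
Qed.
End FractionalBasis.

(** * The ring of integers and its ideal classes *)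

(** Gauss's lemma: a primitive integral multiple of [q] divides [P] over the integers, so its
    leading coefficient is 1 or [-1]. *)
Lemma monic_dvd_int (P : {poly int}) (q : {poly rat}) : P \is monic -> q \is monic ->
  q %| map_poly intr P -> exists q1 : {poly int}, q = map_poly intr q1.
Proof.
move=> mP mq /dvdpP_rat_int[q1 [a a0 qE] [r PE]].
have l1 : lead_coef q1 * lead_coef r = 1 by rewrite -lead_coefM -PE (monicP mP).
have la : a * (lead_coef q1)%:~R = 1.
  have := monicP mq; rewrite qE lead_coefZ lead_coef_map_inj //; exact: intr_inj.
have [e|e] : lead_coef q1 = 1 :> int \/ lead_coef q1 = -1 :> int.
  have : `|(lead_coef q1 * lead_coef r)%R|%N = 1%N by rewrite l1.
  by rewrite abszM => /eqP; rewrite muln_eq1 => /andP[/eqP h _]; lia.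
- by exists q1; rewrite qE; move: la; rewrite e mulr1 => ->; rewrite scale1r.
- exists (- q1); rewrite qE; move: la; rewrite e mulrN1 => /eqP; rewrite eqr_oppLR => /eqP ->.
  by rewrite scaleN1r rmorphN.
Qed.

Lemma int_root_monic (P : {poly int}) (u : rat) : P \is monic ->
  root (map_poly intr P) u -> exists i : int, u = i%:~R.
Proof.
move=> mP; rewrite -dvdp_XsubCl => dv.
have [q1 E] := monic_dvd_int mP (monicXsubC u) dv.
have := congr1 (fun q : {poly rat} => q`_0) E.
rewrite coef_map coefB coefX coefC /= sub0r => h.
by exists (- q1`_0); rewrite rmorphN /= -h opprK.
Qed.

Definition quad_poly (R : nzRingType) (t n : R) : {poly R} :=
  ('X - t%:P) * 'X + n%:P.

Lemma size_quad_poly (R : nzRingType) (t n : R) : size (quad_poly t n) = 3%N.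
Proof.
have sz : size (('X - t%:P) * 'X) = 3%N.
  by rewrite size_mulX ?size_XsubC // polyXsubC_eq0.
by rewrite size_polyDl sz // size_polyC; case: eqP.
Qed.

Lemma quad_poly_monic (R : nzRingType) (t n : R) : quad_poly t n \is monic.
Proof.
have sz : size (('X - t%:P) * 'X) = 3%N.
  by rewrite size_mulX ?size_XsubC // polyXsubC_eq0.
rewrite monicE lead_coefDl; last by rewrite sz size_polyC; case: eqP.
by rewrite lead_coefMX lead_coefXsubC.
Qed.

Lemma map_quad_poly (R S : nzRingType) (g : {rmorphism R -> S}) (t n : R) :
  map_poly g (quad_poly t n) = quad_poly (g t) (g n).
Proof. by rewrite rmorphD rmorphM rmorphB /= map_polyX !map_polyC. Qed.

Lemma horner_quad_poly (R : comNzRingType) (t n x : R) :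
  (quad_poly t n).[x] = x ^+ 2 - t * x + n.
Proof. by rewrite /quad_poly !hornerE mulrBl. Qed.

Section QuadraticField.
Variables (L : fieldExtType rat) (s : L) (p m : nat).
Hypotheses (s2 : s ^+ 2 = (- p%:Z)%:~R) (s_gen : <<1; s>>%VS = fullv).
Hypotheses (p_prime : prime p) (pm : (p.+1 = 4 * m)%N).

(* f stands for [in_alg L], which simplification would unfold. *)
Variable f : {rmorphism rat -> L}.
Hypothesis fE : forall u, f u = u%:A.
Definition omega : L := (1 + s) / 2.
Local Notation w := omega.
Definition kq (u v : rat) : L := f u + f v * w.
Arguments kq (u v)%_ring_scope.
Definition omega_int (z : int * int) : L := z.1%:~R + z.2%:~R * w.
Local Notation kz := omega_int.

Lemma f_inj : injective f. Proof. exact: fmorph_inj. Qed.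

Lemma two_neq0 : (2 : L) != 0.
Proof. by rewrite -(rmorph_nat f) fmorph_eq0. Qed.

Lemma p_neq0Q : (p%:R : rat) != 0.
Proof. by rewrite pnatr_eq0 -lt0n prime_gt0. Qed.

Lemma omega2 : w ^+ 2 = w - m%:R.
Proof.
have h2 := two_neq0.
have s2' : s ^+ 2 = 1 - 4 * m%:R.
  by rewrite s2 rmorphN /= -pmulrn -natrM -pm -natr1; ring.
apply: (mulIf (mulf_neq0 h2 h2)).
have -> : w ^+ 2 * (2 * 2) = 1 + 2 * s + s ^+ 2 by rewrite /w; field.
have -> : (w - m%:R) * (2 * 2) = 2 + 2 * s - 4 * m%:R by rewrite /w; field.
by rewrite s2'; ring.
Qed.

Lemma kz_kq z : kz z = kq z.1%:~R z.2%:~R.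
Proof. by rewrite /omega_int /kq !rmorph_int. Qed.

Lemma kqD u v u' v' : kq u v + kq u' v' = kq (u + u') (v + v').
Proof. by rewrite /kq !rmorphD /=; ring. Qed.

Lemma kqM u v u' v' :
  kq u v * kq u' v' = kq (u * u' - m%:R * v * v') (u * v' + v * u' + v * v').
Proof.
rewrite /kq !(rmorphB, rmorphD, rmorphM) /= rmorph_nat.
have -> : (f u + f v * w) * (f u' + f v' * w)
  = f u * f u' + (f u * f v' + f v * f u') * w + f v * f v' * w ^+ 2 by ring.
by rewrite omega2; ring.
Qed.

Lemma sE : s = kq (-1) 2.
Proof.
rewrite /kq rmorphN1 rmorph_nat /w; have h2 := two_neq0; by field.
Qed.

Lemma kq_exists x : exists u v, x = kq u v.
Proof.
have : x \in <<1; s>>%VS by rewrite s_gen memvf.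
case/Fadjoin_polyP => q qo ->.
pose K (y : L) := exists u v, y = kq u v.
have K0 : K 0 by exists 0, 0; rewrite /kq !rmorph0 mul0r addr0.
have KD y z : K y -> K z -> K (y + z).
  by move=> [u [v ->]] [u' [v' ->]]; rewrite kqD; do 2!eexists.
have KM y z : K y -> K z -> K (y * z).
  by move=> [u [v ->]] [u' [v' ->]]; rewrite kqM; do 2!eexists.
have Kf u : K (f u) by exists u, 0; rewrite /kq rmorph0 mul0r addr0.
have Ks : K s by exists (-1), 2; exact: sE.
have Kpow i : K (s ^+ i).
  elim: i => [|i IH]; first by rewrite expr0 -(rmorph1 f).
  by rewrite exprS; apply: KM.
rewrite horner_coef; apply: (big_ind K) => // i _; apply: KM => //.
have /polyOverP/(_ i)/vlineP[u ->] := qo.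
by rewrite -fE; apply: Kf.
Qed.

Lemma omega_irrational u : w <> f u.
Proof.
move=> wu; have := omega2; rewrite wu -rmorphXn -(rmorph_nat f) -rmorphB => /f_inj E.
have : (2 * u - 1) ^+ 2 + p%:R = 0.
  have -> : (p%:R : rat) = 4 * m%:R - 1 by rewrite -natrM -pm -natr1 addrK.
  have -> : (2 * u - 1) ^+ 2 + (4 * m%:R - 1) = 4 * (u ^+ 2 - (u - m%:R)) by ring.
  by rewrite E subrr mulr0.
move/eqP; rewrite paddr_eq0 ?sqr_ge0 ?ler0n // => /andP[_].
by rewrite (negPf p_neq0Q).
Qed.

Lemma kq_eq0 u v : kq u v = 0 -> u = 0 /\ v = 0.
Proof.
have [->|v0] := eqVneq v 0.
  by rewrite /kq rmorph0 mul0r addr0 -(rmorph0 f) => /f_inj.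
move=> E; exfalso; apply: (@omega_irrational (- u / v)).
have fv : f v != 0 by rewrite fmorph_eq0.
rewrite fmorph_div rmorphN; apply: (mulIf fv); rewrite divfK // mulrC.
by apply/eqP; rewrite -addr_eq0 addrC; apply/eqP.
Qed.

Lemma kq_inj u v u' v' : kq u v = kq u' v' -> u = u' /\ v = v'.
Proof.
move=> E; have : kq (u - u') (v - v') = 0.
  by move/eqP: E; rewrite -subr_eq0 => /eqP <-; rewrite /kq !rmorphB /=; ring.
by case/kq_eq0 => /eqP; rewrite subr_eq0 => /eqP -> /eqP; rewrite subr_eq0 => /eqP ->.
Qed.

Lemma kz_inj : injective kz.
Proof.
move=> [x y] [x' y']; rewrite !kz_kq /= => /kq_inj[/eqP + /eqP].
by rewrite !eqr_int => /eqP -> /eqP ->.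
Qed.

Lemma kz0 : kz (0, 0) = 0.
Proof. by rewrite /omega_int /= mul0r addr0. Qed.

Lemma kzD z z' : kz z + kz z' = kz (z.1 + z'.1, z.2 + z'.2).
Proof. by rewrite /omega_int /= !rmorphD /=; ring. Qed.

Lemma kzN z : - kz z = kz (- z.1, - z.2).
Proof. by rewrite /omega_int /= !rmorphN /=; ring. Qed.

Lemma kzM z z' : kz z * kz z' =
  kz (z.1 * z'.1 - m%:Z * z.2 * z'.2, z.1 * z'.2 + z.2 * z'.1 + z.2 * z'.2).
Proof.
rewrite !kz_kq kqM /= !(rmorphB, rmorphD, rmorphM) /=.
by congr (kq (_ - _ * _ * _) _).
Qed.

Lemma kq_trace_norm u v :
  (kq u v) ^+ 2 - f (2 * u + v) * kq u v + f (u ^+ 2 + u * v + m%:R * v ^+ 2) = 0.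
Proof.
rewrite /kq !(rmorphD, rmorphM, rmorphXn) /= !rmorph_nat.
transitivity (f v ^+ 2 * (w ^+ 2 - (w - m%:R))); first by ring.
by rewrite omega2 subrr mulr0.
Qed.

Lemma integral_kz z : ring_of_integers L (kz z).
Proof.
case: z => x y.
exists (quad_poly (2 * x + y) (x ^+ 2 + x * y + m%:Z * y ^+ 2)); first exact: quad_poly_monic.
rewrite map_quad_poly rootE horner_quad_poly kz_kq /=.
have e1 : 2 * x%:~R + y%:~R = (2 * x + y)%:~R :> rat by rewrite rmorphD rmorphM.
have e2 : x%:~R ^+ 2 + x%:~R * y%:~R + m%:R * y%:~R ^+ 2
    = (x ^+ 2 + x * y + m%:Z * y ^+ 2)%:~R :> rat.
  by rewrite !rmorphD !rmorphM.
have := kq_trace_norm x%:~R y%:~R; rewrite e1 e2 !rmorph_int => E.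
by apply/eqP.
Qed.

(** For nonzero [v] the quadratic polynomial with trace [t] and norm [n] is minimal, so Gauss's
    lemma makes [t] and [n] integers. Then [p v^2 = 4 n - t^2] is an integer and, [p] being prime,
    so is [v]. Finally 4 divides [t^2 - v^2], hence [t] and [v] have the same parity and
    [u = (t - v) / 2] is an integer. *)
Lemma integral_kq u v : ring_of_integers L (kq u v) ->
  exists z, kq u v = kz z.
Proof.
move=> [P mP rP].
have PE : map_poly (intr : int -> L) P = map_poly f (map_poly intr P).
  by rewrite -map_poly_comp; apply: eq_map_poly => i /=; rewrite rmorph_int.
rewrite PE in rP; set PQ := map_poly intr P in rP.
have [v0|v0] := eqVneq v 0.
  have : root PQ u by move: rP; rewrite v0 /kq rmorph0 mul0r addr0 fmorph_root.
  by case/int_root_monic => // i ->; exists (i, 0); rewrite kz_kq v0.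
pose t := 2 * u + v; pose n := u ^+ 2 + u * v + m%:R * v ^+ 2.
have Qx : (map_poly f (quad_poly t n)).[kq u v] = 0.
  by rewrite map_quad_poly horner_quad_poly kq_trace_norm.
have dvQ : quad_poly t n %| PQ.
  (* The remainder has degree at most 1 and vanishes at [kq u v], which is irrational since [v] is
     nonzero. *)
  rewrite /dvdp; set R := PQ %% quad_poly t n.
  have sR : (size R <= 2)%N.
    by rewrite -ltnS -[3%N](size_quad_poly t n) ltn_modp -size_poly_eq0 size_quad_poly.
  have Rx : (map_poly f R).[kq u v] = 0.
    have := divp_eq PQ (quad_poly t n) => /(congr1 (fun q => (map_poly f q).[kq u v])).
    by rewrite (rootP rP) rmorphD rmorphM hornerD hornerM Qx mulr0 add0r.
  have RE : R = (R`_0)%:P + R`_1 *: 'X.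
    apply/polyP => -[|[|i]]; rewrite coefD coefC coefZ coefX /= ?mulr0 ?mulr1 ?addr0 ?add0r //.
    by rewrite nth_default // (leq_trans sR).
  have : kq (R`_0 + R`_1 * u) (R`_1 * v) = 0.
    rewrite -Rx [in RHS]RE rmorphD /= map_polyZ map_polyX map_polyC hornerD hornerC hornerZ hornerX.
    by rewrite /kq rmorphD !rmorphM /=; ring.
  case/kq_eq0 => h0 /eqP; rewrite mulf_eq0 (negPf v0) orbF => /eqP h1.
  rewrite RE h1 scale0r addr0; move: h0; rewrite h1 mul0r addr0 => ->.
  by rewrite polyC0.
have [q1 qE] := monic_dvd_int mP (quad_poly_monic t n) dvQ.
have [i ti] : exists i : int, t = i%:~R.
  have := congr1 (fun q : {poly rat} => q`_1) qE.
  rewrite coef_map coefD coefMX coefB coefX coefC /= coefC /= addr0 sub0r => h.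
  by exists (- q1`_1); rewrite rmorphN /= -h opprK.
have [j nj] : exists j : int, n = j%:~R.
  have := congr1 (fun q : {poly rat} => q`_0) qE.
  rewrite coef_map coefD coefMX coefC /= add0r => h.
  by exists q1`_0.
have pQ : (p%:R : rat) = 4 * m%:R - 1 by rewrite -natrM -pm -natr1 addrK.
have Kv : p%:R * v ^+ 2 = (4 * j - i ^+ 2)%:~R.
  rewrite rmorphB rmorphM rmorphXn /= -ti -nj /t /n pQ; ring.
(* [p * v] is rational and its square [p * (p * v ^+ 2)] is an integer. *)
have [e Ee] : exists e : int, p%:R * v = e%:~R.
  apply: (@int_root_monic (quad_poly 0 (- p%:Z * (4 * j - i ^+ 2)))); first exact: quad_poly_monic.
  rewrite map_quad_poly rootE horner_quad_poly rmorph0 mul0r subr0 rmorphM /= -Kv.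
  by rewrite rmorphN /= -pmulrn; apply/eqP; ring.
have e2 : e ^+ 2 = p%:Z * (4 * j - i ^+ 2).
  apply: (@intr_inj rat); rewrite rmorphXn rmorphM /= -Ee -Kv -pmulrn; ring.
have [y Ey] : exists y : int, v = y%:~R.
  have : (p %| `|e| ^ 2)%N by rewrite -abszX e2 abszM dvdn_mulr.
  rewrite Euclid_dvdX // andbT; move/dvdnP => [k ek].
  have [y ey] : exists y, e = y * p%:Z.
    have [h|h] : e = `|e|%N%:Z \/ e = - `|e|%N%:Z by clear; lia.
      by exists k%:Z; rewrite h ek PoszM.
    by exists (- k%:Z); rewrite h ek PoszM mulNr.
  exists y; apply: (mulIf p_neq0Q); rewrite mulrC Ee ey rmorphM /= -pmulrn //.
have E4 : i ^+ 2 - y ^+ 2 = 4 * (j - m%:Z * y ^+ 2).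
  apply: (@intr_inj rat); rewrite !(rmorphB, rmorphM, rmorphXn) /= -ti -Ey -nj /t /n -pmulrn; ring.
have [x Ex] : exists x, i = y + 2 * x.
  have := divz_eq (i - y) 2; set q := (_ %/ _)%Z; have : ((i - y) %% 2)%Z = 0 \/ ((i - y) %% 2)%Z = 1 by lia.
  case=> -> h; first by exists q; lia.
  exfalso; have iE : i = 2 * q + y + 1 by lia.
  have : 2 * (2 * (j - m%:Z * y ^+ 2) - 2 * q ^+ 2 - 2 * q * y - 2 * q - y) = 1.
    have -> : 2 * (2 * (j - m%:Z * y ^+ 2) - 2 * q ^+ 2 - 2 * q * y - 2 * q - y)
      = 4 * (j - m%:Z * y ^+ 2) - (4 * q ^+ 2 + 4 * q * y + 4 * q + 2 * y) by ring.
    by rewrite -E4 iE; ring.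
  by clear; lia.
exists (x, y); rewrite kz_kq Ey /=; congr (kq _ _).
have : 2 * u = 2 * x%:~R.
  have -> : 2 * u = t - v by rewrite /t addrK.
  by rewrite ti Ey Ex rmorphD rmorphM /=; ring.
by apply: mulfI.
Qed.

Lemma ring_of_integersE x : ring_of_integers L x <-> exists z, x = kz z.
Proof.
split=> [|[z ->]]; last exact: integral_kz.
have [u [v ->]] := kq_exists x; exact: integral_kq.
Qed.

End QuadraticField.

Section IdealEquivalence.
Local Open Scope classical_set_scope.

Lemma ideal_equiv_sym (L : fieldExtType rat) (I J : set L) :
  ideal_equiv I J -> ideal_equiv J I.
Proof. by move=> [a [b [Oa Ob a0 b0 E]]]; exists b, a. Qed.

Lemma ideal_equiv_trans (L : fieldExtType rat) (OM : forall x y : L,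
    ring_of_integers L x -> ring_of_integers L y -> ring_of_integers L (x * y))
  (I J K : set L) : ideal_equiv I J -> ideal_equiv J K -> ideal_equiv I K.
Proof.
move=> [a [b [Oa Ob a0 b0 E]]] [a' [b' [Oa' Ob' a0' b0' E']]].
exists (a' * a), (b * b'); split; rewrite ?mulf_neq0 //; try exact: OM.
apply/seteqP; split=> _ [x Ix <-].
  have : [set b * y | y in J] (a * x) by rewrite -E; exists x.
  move=> [y Jy Ey].
  have : [set b' * z | z in K] (a' * y) by rewrite -E'; exists y.
  move=> [z Kz Ez]; exists z => //.
  by rewrite -mulrA Ez -mulrA -Ey; ring.
have : [set a' * y | y in J] (b' * x) by rewrite E'; exists x.
move=> [y Jy Ey].
have : [set a * z | z in I] (b * y) by rewrite E; exists y.
move=> [z Iz Ez]; exists z => //.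
by rewrite -mulrA Ez -mulrA -Ey; ring.
Qed.

End IdealEquivalence.

Section QuadraticIdeals.
Local Open Scope classical_set_scope.
Variables (L : fieldExtType rat) (s : L) (p m : nat).
Hypotheses (s2 : s ^+ 2 = (- p%:Z)%:~R) (s_gen : <<1; s>>%VS = fullv).
Hypotheses (p_prime : prime p) (pm : (p.+1 = 4 * m)%N).
Variable f : {rmorphism rat -> L}.
Hypothesis fE : forall u, f u = u%:A.
Local Notation kz := (omega_int s).

Let OE := ring_of_integersE s2 s_gen p_prime pm fE.
Let kzMs := kzM s2 pm f.
Let kz_injs : injective kz := kz_inj s2 p_prime pm f.

Let m_gt0 : (0 < m)%N.
Proof. by move: pm; case: (m) => //; rewrite muln0. Qed.

Lemma integers_mul (x y : L) :
  ring_of_integers L x -> ring_of_integers L y -> ring_of_integers L (x * y).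
Proof.
by move=> /OE[z ->] /OE[z' ->]; apply/OE; eexists; apply: kzMs.
Qed.

Definition kset (P : int * int -> Prop) : set L := [set kz z | z in P].

Lemma ksetE P z : kset P (kz z) <-> P z.
Proof. by split=> [[z' Pz' /kz_injs <-]|Pz] //; exists z. Qed.

Lemma kz_span e g i j : kz (i * e.1 + j * g.1, i * e.2 + j * g.2) =
  i%:~R * kz e + j%:~R * kz g.
Proof. by rewrite /omega_int /= !(rmorphD, rmorphM) /=; ring. Qed.

Lemma kz_omega z : kz (0, 1) * kz z = kz (- m%:Z * z.2, z.1 + z.2).
Proof. by rewrite kzMs /=; congr (kz (_, _)); ring. Qed.

Lemma nonzero_ideal_wideal I : nonzero_ideal I ->
  wideal m (fun z => I (kz z)) /\ I = kset (fun z => I (kz z)).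
Proof.
move=> [IO I0 ID IM [x0 Ix0 x00]]; split; last first.
  apply/seteqP; split=> [x Ix|_ [z Iz <-] //].
  by have /OE[z xz] := IO _ Ix; exists z; rewrite -?xz.
split.
- by move=> z z' Iz Iz'; rewrite -kzD; apply: ID.
- move=> z Iz; rewrite -kzN -mulN1r; apply: IM => //.
  by apply/OE; exists (-1, 0); rewrite /omega_int /= mul0r addr0 rmorphN1.
- by move=> z Iz; rewrite -kz_omega; apply: IM => //; apply/OE; exists (0, 1).
- have /OE[z xz] := IO _ Ix0; exists z; first by rewrite -xz.
  by apply: contra x00 => /eqP zE; rewrite xz zE kz0.
Qed.

Lemma wideal_nonzero_ideal P : wideal m P -> nonzero_ideal (kset P).
Proof.
move=> wP; have [PD PN PW [z0 Pz0 z00]] := wP.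
have P0 : P (0, 0) by have := PD _ _ Pz0 (PN _ Pz0); rewrite /= !subrr.
split.
- by move=> _ [z Pz <-]; apply/OE; exists z.
- by exists (0, 0) => //; rewrite kz0.
- by move=> _ _ [z Pz <-] [z' Pz' <-]; rewrite kzD; apply/ksetE; apply: PD.
- move=> a _ /OE[u ->] [z Pz <-]; rewrite kzMs; apply/ksetE.
  have := PD _ _ (wideal_scale u.1 wP Pz) (wideal_scale u.2 wP (PW _ Pz)).
  by rewrite /=; congr P; congr (_, _); ring.
- exists (kz z0); first by apply/ksetE.
  by apply: contra z00 => /eqP; rewrite -(kz0 s) => /kz_injs ->.
Qed.

Lemma image_span (al be : L) e g e' g' :
  al * kz e = be * kz e' -> al * kz g = be * kz g' ->
  [set al * x | x in kset (span2 e g)] = [set be * x | x in kset (span2 e' g')].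
Proof.
move=> E1 E2.
have E i j : al * kz (i * e.1 + j * g.1, i * e.2 + j * g.2)
    = be * kz (i * e'.1 + j * g'.1, i * e'.2 + j * g'.2).
  rewrite !kz_span; move: (kz e) (kz g) (kz e') (kz g') E1 E2 => A B A' B' E1 E2.
  transitivity (i%:~R * (al * A) + j%:~R * (al * B)); first by ring.
  by rewrite E1 E2; ring.
apply/seteqP; split=> _ [_ [_ [i [j ->]] <-] <-].
  by rewrite E; eexists; [apply/ksetE; exists i, j|].
by rewrite -E; eexists; [apply/ksetE; exists i, j|].
Qed.

Lemma kz_neq0 z : z != (0, 0) -> kz z != 0.
Proof. by apply: contra => /eqP; rewrite -(kz0 s) => /kz_injs ->. Qed.

Lemma ideal_equiv_primitive J : nonzero_ideal J -> exists a b c : int,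
  [/\ 0 < a, a * c = b ^+ 2 + b + m%:Z & ideal_equiv (kset (span2 (a, 0) (b, 1))) J].
Proof.
move=> /nonzero_ideal_wideal[wP ->].
have [d [a [b [d0 a0 _ /dvdnP[c cE] H]]]] := hnf_exists m_gt0 wP.
exists a%:Z, b%:Z, c%:Z; split => //.
  by rewrite mulrC -PoszM -cE !PoszD -mulnn PoszM.
have -> : kset (fun z => J (kz z)) = kset (span2 (d%:Z * a%:Z, 0) (d%:Z * b%:Z, d%:Z)).
  by congr kset; apply/funext => z; apply/propext.
exists (kz (d%:Z, 0)), (kz (1, 0)); split.
- by apply/OE; exists (d%:Z, 0).
- by apply/OE; exists (1, 0).
- by apply: kz_neq0; apply/eqP => -[]; lia.
- by apply: kz_neq0.
- by apply: image_span; rewrite !kzMs; congr (kz (_, _)) => /=; ring.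
Qed.

Section Primitive.
Variables a b c : int.
Hypotheses (a_gt0 : 0 < a) (abc : a * c = b ^+ 2 + b + m%:Z).
Local Notation I := (kset (span2 (a, 0) (b, 1))).
Local Notation B1 := (basis1 a b).
Local Notation B2 := (basis2 b c).

Lemma basis_relation x y : kz (b, 1) * kz (B1 x y) = kz (a, 0) * kz (B2 x y).
Proof.
rewrite !kzMs /=; congr (kz (_, _)); last by ring.
have -> : m%:Z = a * c - b ^+ 2 - b by rewrite abc; ring.
by ring.
Qed.

(** The ideal is [g] times [I] with [g] possibly not integral; [g a] and [a] are integral
    multipliers with the same quotient. *)
Lemma ideal_equiv_basis x y : 0 < qf a (2 * b + 1) c x y ->
  ideal_equiv I (kset (span2 (B1 x y) (B2 x y))).
Proof.
move=> q0; exists (kz (B1 x y)), (kz (a, 0)); split.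
- by apply/OE; eexists.
- by apply/OE; eexists.
- apply: kz_neq0; apply/eqP => E; move: q0.
  by rewrite -det_basis E /det2 /= !mul0r subrr.
- by apply: kz_neq0; apply/eqP => -[E]; move: a_gt0; rewrite E.
- by apply: image_span; [rewrite mulrC|rewrite mulrC basis_relation].
Qed.

Lemma qf_gt0 x y : (x, y) != (0, 0) -> 0 < qf a (2 * b + 1) c x y.
Proof.
move=> xy0; have E : 4 * a * qf a (2 * b + 1) c x y
   = (2 * a * x + (2 * b + 1) * y) ^+ 2 + p%:Z * y ^+ 2.
  have -> : p%:Z = 4 * (a * c) - (2 * b + 1) ^+ 2 by rewrite abc (Posz_of_pm pm); ring.
  by rewrite /qf; ring.
have p0 : 0 < p%:Z by rewrite ltz_nat prime_gt0.
have a4 : 0 < 4 * a by rewrite mulr_gt0.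
rewrite -(pmulr_rgt0 _ a4) E.
have [y0|y0] := eqVneq y 0; last first.
  apply: ltr_wpDl; first exact: sqr_ge0.
  by rewrite mulr_gt0 // exprn_even_gt0.
rewrite y0 expr0n !mulr0 addr0 addr0 exprn_even_gt0 //= mulf_neq0 //.
  by rewrite mulf_neq0 // gt_eqF.
by apply: contra xy0 => /eqP ->; rewrite y0.
Qed.

(** The images [u] and [v] in [J] of [a] and [b + w] satisfy [a v = (b + w) u]. Comparing
    coordinates forces the shape of [basis1] and [basis2] with [x = v.2] and [y = - u.2], so the
    inverse of [I] need not be computed. *)
Lemma ideal_equiv_rep J : nonzero_ideal J -> ideal_equiv I J ->
  exists x y, 0 < qf a (2 * b + 1) c x y /\
    forall z, J (kz z) <-> span2 (B1 x y) (B2 x y) z.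
Proof.
move=> nJ [al [be [_ _ al0 be0 E]]].
have [JO _ _ _ [x0 Jx0 x00]] := nJ.
have im e : span2 (a, 0) (b, 1) e -> exists2 z, J (kz z) & al * kz e = be * kz z.
  move=> he; have : [set be * y | y in J] (al * kz e) by rewrite -E; exists (kz e) => //; apply/ksetE.
  by move=> [y Jy Ey]; have /OE[z yz] := JO _ Jy; exists z; rewrite -yz.
have [u Ju Eu] := im _ (span2_l _ _).
have [v Jv Ev] := im _ (span2_r _ _).
have rel : kz (a, 0) * kz v = kz (b, 1) * kz u.
  apply: (mulfI be0); rewrite mulrCA -Ev [RHS]mulrCA -Eu; ring.
have [x [y [uE vE]]] : exists x y, u = B1 x y /\ v = B2 x y.
  move: rel; rewrite !kzMs /= => /kz_injs[].
  rewrite !(mul0r, mulr0, addr0, subr0, mul1r, mulr1, add0r) => r1 r2.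
  exists v.2, (- u.2).
  have e1 : u.1 = v.2 * a - u.2 * b - u.2 by rewrite (mulrC v.2) r2; ring.
  split; first by rewrite /basis1 opprK [LHS]surjective_pairing e1; congr (_, _); ring.
  rewrite /basis2 [LHS]surjective_pairing; congr (_, _).
  apply: (mulfI (lt0r_neq0 a_gt0)); rewrite r1 e1.
  have -> : m%:Z = a * c - b ^+ 2 - b by rewrite abc; ring.
  by ring.
have H z : J (kz z) <-> span2 (B1 x y) (B2 x y) z.
  rewrite -uE -vE; have S := image_span Eu Ev; rewrite S in E.
  split=> [Jz|hz].
    have : [set be * x | x in kset (span2 u v)] (be * kz z) by rewrite E; exists (kz z).
    by move=> [_ [z' hz' <-]] /(mulfI be0)/kz_injs <-.
  have : [set be * y | y in J] (be * kz z) by rewrite -E; exists (kz z) => //; apply/ksetE.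
  by move=> [t Jt] /(mulfI be0) <-.
exists x, y; split=> //; apply: qf_gt0; apply/eqP => -[x_0 y_0].
have /OE[z xz] := JO _ Jx0; move: Jx0; rewrite xz => /H[i [j zE]].
move: x00; rewrite xz zE x_0 y_0 /basis1 /basis2 /=.
by rewrite !(oppr0, mul0r, mulr0, addr0) kz0 eqxx.
Qed.
End Primitive.
End QuadraticIdeals.

(** * Counting ideals by their Hermite normal form *)

Section HNFCount.
Variables m n : nat.
Hypothesis n_gt0 : (0 < n)%N.
Local Notation T := ('I_n.+1 * 'I_n.+1 * 'I_n.+1)%type.

(** The triple [(d, a, b)] stands for the ideal [d (Z a + Z (b + w))] of norm [d^2 a]; norm [n]
    bounds all three entries by [n]. *)
Definition is_hnf (t : T) : bool :=
  [&& (t.1.1 ^ 2 * t.1.2 == n)%N, (t.2 < t.1.2)%N & (t.1.2 %| t.2 ^ 2 + t.2 + m)%N].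

Lemma sum_square_eq (a : nat) : (a < n.+1)%N ->
  (\sum_(d < n.+1) (d ^ 2 * a == n) = (a %| n) && issq (n %/ a))%N.
Proof.
move=> an; have [/dvdnP[k kE]|na] := boolP (a %| n)%N; last first.
  rewrite big1 // => d _; apply/eqP; rewrite eqb0; apply: contra na => /eqP <-.
  exact: dvdn_mull.
have a0 : (0 < a)%N by move: n_gt0; rewrite kE muln_gt0 => /andP[].
have k0 : (0 < k)%N by move: n_gt0; rewrite kE muln_gt0 => /andP[].
rewrite [in RHS]kE mulnK //=.
have -> : (\sum_(d < n.+1) (d ^ 2 * a == n) = \sum_(d < n.+1) (d ^ 2 == k))%N.
  by apply: eq_bigr => d _; rewrite [X in (_ == X)%N]kE eqn_pmul2r.
have [/issqP[e ke]|nk] := boolP (issq k); last first.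
  rewrite big1 // => d _; apply/eqP; rewrite eqb0; apply: contra nk => /eqP <-.
  by apply/issqP; exists d.
have en : (e < n.+1)%N.
  rewrite ltnS; apply: (@leq_trans k); last by rewrite kE leq_pmulr.
  by rewrite ke; case: (e) => // e'; rewrite -[X in (X <= _)%N]expn1 leq_pexp2l.
rewrite (bigD1 (Ordinal en)) //= ke eqxx big1 // => d de.
by apply/eqP; rewrite eqb0 eqn_exp2r //; apply: contra de => /eqP h; apply/eqP/val_inj.
Qed.

Lemma card_hnf : #|is_hnf|%:Z = ideal_count m n.
Proof.
rewrite /ideal_count /dconv (@sum_divisors n (fun a => (rho m a)%:Z * (issq (n %/ a))%:Z)) //.
suff -> : #|is_hnf| = (\sum_(a < n.+1 | a %| n) rho m a * issq (n %/ a))%N.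
  by rewrite (big_morph Posz PoszD erefl); apply: eq_bigr => a _; rewrite PoszM.
rewrite -sum1_card big_mkcond /=.
rewrite -(pair_bigA _ (fun da (b : 'I_n.+1) => if (da, b) \in is_hnf then 1 else 0)%N) /=.
rewrite -(pair_bigA _ (fun (d a : 'I_n.+1) =>
  \sum_(b < n.+1) if (d, a, b) \in is_hnf then 1 else 0)%N) /=.
rewrite exchange_big /= [RHS]big_mkcond /=; apply: eq_bigr => a _.
have rhoE : (rho m a = \sum_(b < n.+1) ((b < a) && (a %| b ^ 2 + b + m)))%N.
  rewrite /rho (big_ord_widen n.+1 (fun b => (a %| b ^ 2 + b + m)%N : nat)); last exact: ltnW.
  by rewrite big_mkcond /=; apply: eq_bigr => b _; case: ltnP.
transitivity (\sum_(d < n.+1) (d ^ 2 * a == n) * rho m a)%N.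
  apply: eq_bigr => d _; rewrite rhoE big_distrr /=; apply: eq_bigr => b _.
  by rewrite mulnb -[(d, a, b) \in _]/(is_hnf (d, a, b)) /is_hnf /=; case: ifP.
rewrite -big_distrl /= sum_square_eq //.
by case: ifP => //= _; rewrite mulnC.
Qed.
End HNFCount.

(** * Representatives of the ideal classes *)

Section ClassReps.
Variables (L : fieldExtType rat) (s : L) (p m N : nat).
Hypotheses (s2 : s ^+ 2 = (- p%:Z)%:~R) (s_gen : <<1; s>>%VS = fullv).
Hypotheses (p_prime : prime p) (pm : (p.+1 = 4 * m)%N).
Hypothesis N_class : is_class_number L N.
Let fE (u : rat) : in_alg L u = u%:A := erefl.
Let OM := integers_mul s2 s_gen p_prime pm fE.

Lemma ideal_class_eq (I J : set L) : ideal_equiv I J -> ideal_class I = ideal_class J.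
Proof.
move=> IJ; apply/seteqP; split=> K [nK h]; split=> //.
  exact: (ideal_equiv_trans OM (ideal_equiv_sym IJ) h).
exact: (ideal_equiv_trans OM IJ h).
Qed.

Lemma ideal_equiv_refl (I : set L) : ideal_equiv I I.
Proof.
have O1 : ring_of_integers L 1.
  by apply/(ring_of_integersE s2 s_gen p_prime pm fE); exists (1, 0); rewrite /omega_int /= mul0r addr0.
by exists 1, 1; split; rewrite ?oner_eq0.
Qed.

Definition primitive_ideal (t : int * int * int) : set L :=
  kset s (span2 (t.1.1, 0) (t.1.2, 1)).

Definition primitive_triple (t : int * int * int) : Prop :=
  0 < t.1.1 /\ t.1.1 * t.2 = t.1.2 ^+ 2 + t.1.2 + m%:Z.

Lemma primitive_nonzero t : primitive_triple t -> nonzero_ideal (primitive_ideal t).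
Proof.
move=> [a0 abc]; apply: (wideal_nonzero_ideal s2 s_gen p_prime pm fE).
have := @wideal_basis m _ _ _ abc 1 0.
rewrite /basis1 /basis2 !mul1r !mul0r !addr0 oppr0; apply.
by have -> : qf t.1.1 (2 * t.1.2 + 1) t.2 1 0 = t.1.1 by rewrite /qf; ring.
Qed.

(** The bijection in [is_class_number] numbers the classes, and each contains an ideal equivalent to
    a primitive one, chosen here as a triple. *)
Lemma class_reps : exists A : 'I_N -> int * int * int,
  (forall k, primitive_triple (A k)) /\
  forall J, nonzero_ideal J -> exists k, ideal_equiv (primitive_ideal (A k)) J /\
    forall k', ideal_equiv (primitive_ideal (A k')) J -> k' = k.
Proof.
have /card_set_bijP[g [gf gi gs]] := N_class.
have [A HA] : {A : 'I_N -> int * int * int & forall k : 'I_N,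
    primitive_triple (A k) /\ g (ideal_class (primitive_ideal (A k))) = k}.
  apply: (@boolp.choice _ _ (fun (k : 'I_N) t =>
    primitive_triple t /\ g (ideal_class (primitive_ideal t)) = k)) => k.
  have [_ [I nI <-] gI] := gs k (ltn_ord k).
  have [a [b [c [a0 abc eq]]]] := ideal_equiv_primitive s2 s_gen p_prime pm fE nI.
  by exists (a, b, c); split; [split|rewrite -gI (ideal_class_eq eq)].
exists A; split=> [k|J nJ]; first by case: (HA k).
have CJ : ideal_classes L (ideal_class J) by exists J.
have kN : (g (ideal_class J) < N)%N by exact: (gf _ CJ).
have CA k : ideal_classes L (ideal_class (primitive_ideal (A k))).
  by exists (primitive_ideal (A k)) => //; apply: primitive_nonzero; case: (HA k).
exists (Ordinal kN); split.
  have E : ideal_class (primitive_ideal (A (Ordinal kN))) = ideal_class J.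
    by apply: gi; [exact/mem_set|exact/mem_set|case: (HA (Ordinal kN)) => _ ->].
  have JJ : ideal_class J J by split; last exact: ideal_equiv_refl.
  have : ideal_class (primitive_ideal (A (Ordinal kN))) J by rewrite E.
  by case.
move=> k' /ideal_class_eq E; apply: val_inj => /=.
by rewrite -E; case: (HA k').
Qed.
End ClassReps.

Lemma wideal_hnf (m d a b : nat) : (0 < d)%N -> (0 < a)%N ->
  (a %| b ^ 2 + b + m)%N ->
  wideal m (span2 (d%:Z * a%:Z, 0) (d%:Z * b%:Z, d%:Z)).
Proof.
move=> d0 a0 /dvdnP[c cE].
have mE : m%:Z = c%:Z * a%:Z - b%:Z ^+ 2 - b%:Z.
  by rewrite -PoszM -cE !PoszD -mulnn PoszM; ring.
split.
- by move=> z z' [i [j ->]] [i' [j' ->]]; exists (i + i'), (j + j'); congr (_, _) => /=; ring.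
- by move=> z [i [j ->]]; exists (- i), (- j); congr (_, _) => /=; ring.
- move=> z [i [j ->]]; exists (- (j * c%:Z + i * b%:Z)), (i * a%:Z + j * b%:Z + j).
  by rewrite /= mE; congr (_, _); ring.
- exists (d%:Z * a%:Z, 0); first exact: span2_l.
  by rewrite xpair_eqE eqxx andbT mulf_neq0 // eqz_nat -lt0n.
Qed.

(** * Representations by the class forms *)

Lemma double_count (X Y : finType) (PX : pred X) (PY : pred Y) (R : X -> Y -> bool) (k : nat) :
  (forall x, PX x -> #|[pred y | PY y && R x y]| = 1%N) ->
  (forall y, PY y -> #|[pred x | PX x && R x y]| = k) ->
  #|PX| = (k * #|PY|)%N.
Proof.
move=> H1 Hk.
transitivity (\sum_(x | PX x) \sum_(y | PY y) R x y)%N.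
  rewrite -sum1_card; apply: eq_bigr => x Px.
  by rewrite -(H1 x Px) -sum1_card -big_mkcondr.
rewrite exchange_big /= mulnC -sum_nat_const; apply: eq_bigr => y Py.
by rewrite -(Hk y Py) -sum1_card -big_mkcondr.
Qed.

Section RepresentationCount.
Variables (L : fieldExtType rat) (s : L) (p m N : nat).
Hypotheses (s2 : s ^+ 2 = (- p%:Z)%:~R) (s_gen : <<1; s>>%VS = fullv).
Hypotheses (p_prime : prime p) (pm : (p.+1 = 4 * m)%N) (p_gt4 : (4 < p)%N).
Variable A : 'I_N -> int * int * int.
Hypothesis A_prim : forall k, primitive_triple m (A k).
Hypothesis A_rep : forall J, nonzero_ideal J -> exists k,
  ideal_equiv (primitive_ideal s (A k)) J /\
    forall k', ideal_equiv (primitive_ideal s (A k')) J -> k' = k.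

Definition class_form (k : 'I_N) (x y : int) : int :=
  qf (A k).1.1 (2 * (A k).1.2 + 1) (A k).2 x y.

Variables (n M : nat).
Hypothesis n_gt0 : (0 < n)%N.
Hypothesis M_large : forall k x y, (M%:Z <= `|x|) || (M%:Z <= `|y|) ->
  n%:Z < class_form k x y.

Local Notation X := ('I_N * 'I_(2 * M) * 'I_(2 * M))%type.
Local Notation Y := ('I_n.+1 * 'I_n.+1 * 'I_n.+1)%type.

Let xx (t : X) : int := t.1.2%:Z - M%:Z.
Let yy (t : X) : int := t.2%:Z - M%:Z.
Let lat (t : X) := span2 (basis1 (A t.1.1).1.1 (A t.1.1).1.2 (xx t) (yy t))
                         (basis2 (A t.1.1).1.2 (A t.1.1).2 (xx t) (yy t)).
Let hlat (u : Y) := span2 (u.1.1%:Z * u.1.2%:Z, 0) (u.1.1%:Z * u.2%:Z, u.1.1%:Z).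
Let okX : pred X := fun t => class_form t.1.1 (xx t) (yy t) == n%:Z.
Let R (t : X) (u : Y) : bool := `[< forall z, lat t z <-> hlat u z >].

Let det_hlat (d a b : nat) : det2 (d%:Z * a%:Z, 0) (d%:Z * b%:Z, d%:Z) = (d ^ 2 * a)%N%:Z.
Proof. by rewrite /det2 /= mul0r subr0 -mulnn !PoszM; ring. Qed.

Let fE (u : rat) : in_alg L u = u%:A := erefl.

Let m_gt0 : (0 < m)%N.
Proof. by move: pm; case: (m) => //; rewrite muln0. Qed.

Let hnf_pos (u : Y) : is_hnf m u -> (0 < u.1.1)%N /\ (0 < u.1.2)%N.
Proof.
move=> /and3P[/eqP E _ _].
have : (0 < u.1.1 ^ 2 * u.1.2)%N by rewrite E.
by rewrite muln_gt0 expn_gt0 orbF => /andP[].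
Qed.

Let one_hnf (t : X) : okX t -> #|[pred u | is_hnf m u && R t u]| = 1%N.
Proof.
move=> /eqP ok; have [a0 abc] := A_prim t.1.1.
have q0 : 0 < class_form t.1.1 (xx t) (yy t) by rewrite ok.
have [d [a [b [d0 a0' ba dv H]]]] := hnf_exists m_gt0 (wideal_basis abc q0).
have nE : n = (d ^ 2 * a)%N.
  have h := det2_eq H; rewrite det_basis det_hlat -/(class_form _ _ _) ok in h.
  have := h n_gt0; rewrite ltz_nat muln_gt0 expn_gt0 d0 a0' => /(_ isT) E.
  by case: E.
have an : (a < n.+1)%N by rewrite ltnS nE leq_pmull // expn_gt0 d0.
have dn : (d < n.+1)%N.
  by rewrite ltnS nE -mulnn -mulnA leq_pmulr // muln_gt0 d0.
have bn : (b < n.+1)%N by apply: ltn_trans ba an.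
pose u : Y := (Ordinal dn, Ordinal an, Ordinal bn).
rewrite -(card1 u); apply: eq_card => v; rewrite !inE; apply/andP/eqP => [[hv /asboolP Rv]|->].
  have [d0v a0v] := hnf_pos hv; have /and3P[_ bv _] := hv.
  have HH z : hlat v z <-> hlat u z := iff_trans (iff_sym (Rv z)) (H z).
  have [e1 e2 e3] := hnf_unique d0v a0v bv d0 a0' ba HH.
  case: v e1 e2 e3 {hv Rv d0v a0v bv HH} => [[v1 v2] v3] /= e1 e2 e3.
  by congr (_, _, _); apply: val_inj.
by split; [rewrite /is_hnf /= -nE eqxx ba dv|apply/asboolP => z; apply: H].
Qed.

Let boxP (k : 'I_N) (x y : int) : class_form k x y = n%:Z ->
  exists t : X, [/\ t.1.1 = k, xx t = x & yy t = y].
Proof.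
move=> E; have : ~~ ((M%:Z <= `|x|) || (M%:Z <= `|y|)).
  by apply/negP => /(M_large k); rewrite E ltxx.
rewrite negb_or -!ltNge => /andP[hx hy].
have ix : (`|(x + M%:Z)%R|%N < 2 * M)%N by clear -hx; lia.
have iy : (`|(y + M%:Z)%R|%N < 2 * M)%N by clear -hy; lia.
exists (k, Ordinal ix, Ordinal iy); split=> //; rewrite /xx /yy /=; clear -hx hy; lia.
Qed.

Let two_reps (u : Y) : is_hnf m u -> #|[pred t | okX t && R t u]| = 2%N.
Proof.
move=> hu; have [d0 a0] := hnf_pos hu; have /and3P[/eqP nE ba dv] := hu.
have wJ := wideal_hnf d0 a0 dv.
have nJ := wideal_nonzero_ideal s2 s_gen p_prime pm fE wJ.
have [k [eqk uniqk]] := A_rep nJ.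
have [ak0 abck] := A_prim k.
have [x [y [q0 H]]] := ideal_equiv_rep s2 s_gen p_prime pm fE ak0 abck nJ eqk.
have {}H z : hlat u z <-> span2 (basis1 (A k).1.1 (A k).1.2 x y) (basis2 (A k).1.2 (A k).2 x y) z.
  by rewrite -H; symmetry; apply: (ksetE s2 p_prime pm (in_alg L)).
have qn : class_form k x y = n%:Z.
  have h := det2_eq H; rewrite det_basis det_hlat nE in h.
  exact: (esym (h n_gt0 q0)).
have [t [tk tx ty]] := boxP qn.
have qn' : class_form k (- x) (- y) = n%:Z by rewrite -qn /class_form /qf; ring.
have [t' [tk' tx' ty']] := boxP qn'.
have tt' : t != t'.
  apply/eqP => E; move: tx' ty'; rewrite -E tx ty => hx hy.
  have x0 : x = 0 by clear -hx; lia.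
  have y0 : y = 0 by clear -hy; lia.
  by move: q0; rewrite x0 y0 /qf expr0n /= !mulr0 !addr0.
have c2 : #|[set t; t']%SET| = 2%N by rewrite cards2 tt'.
rewrite -[RHS]c2.
apply: eq_card => v; rewrite !inE; apply/andP/orP.
  move=> [/eqP okv /asboolP Rv].
  have [av0 abcv] := A_prim v.1.1.
  have qv : 0 < qf (A v.1.1).1.1 (2 * (A v.1.1).1.2 + 1) (A v.1.1).2 (xx v) (yy v).
    by rewrite -/(class_form _ _ _) okv.
  have eqv := ideal_equiv_basis s2 s_gen p_prime pm fE av0 abcv qv.
  have vk : v.1.1 = k.
    apply: uniqk; rewrite /primitive_ideal.
    suff <- : kset s (lat v) = kset s (hlat u) by [].
    by congr kset; apply/funext => z; apply/propext.
  rewrite vk in qv.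
  have HH z : span2 (basis1 (A k).1.1 (A k).1.2 x y) (basis2 (A k).1.2 (A k).2 x y) z
     <-> span2 (basis1 (A k).1.1 (A k).1.2 (xx v) (yy v)) (basis2 (A k).1.2 (A k).2 (xx v) (yy v)) z.
    by rewrite -H -Rv /lat vk.
  have eqt (w : X) : w.1.1 = k -> xx w = xx v -> yy w = yy v -> v == w.
    case: v vk {qv HH eqv okv Rv av0 abcv} => [[v1 v2] v3] /= ->.
    case: w => [[w1 w2] w3] /= ->; rewrite /xx /yy /= => h1 h2.
    by apply/eqP; congr (_, _, _); apply: val_inj => /=; [clear -h1|clear -h2]; lia.
  have [[e1 e2]|[e1 e2]] := basis_unique abck p_prime pm p_gt4 ak0 q0 qv HH.
    by left; apply: eqt; rewrite ?tx ?ty.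
  by right; apply: eqt; rewrite ?tx' ?ty'.
case=> /eqP ->.
  split; first by rewrite /okX tk tx ty qn.
  by apply/asboolP => z; rewrite /lat tk tx ty H.
split; first by rewrite /okX tk' tx' ty' qn'.
apply/asboolP => z; rewrite H /lat tk' tx' ty'.
split=> -[i [j ->]]; exists (- i), (- j); congr (_, _); rewrite /basis1 /basis2 /=; ring.
Qed.

(** Double counting of pairs of a vector of value [n] and the ideal of norm [n] that it spans. A
    vector spans one ideal, of index equal to its value by [det_basis]; an ideal belongs to one
    class and comes from exactly two vectors, opposite to each other. *)
Theorem representation_count :
  (\sum_(k < N) \sum_(i < 2 * M) \sum_(j < 2 * M)
     (class_form k (i%:Z - M%:Z) (j%:Z - M%:Z) == n%:Z))%N%:Z = 2 * ideal_count m n.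
Proof.
rewrite -(card_hnf m n_gt0) -[2]/(2%N%:Z) -PoszM -(double_count one_hnf two_reps); congr Posz.
rewrite -sum1_card [RHS]big_mkcond /=.
transitivity (\sum_(ki : 'I_N * 'I_(2 * M)) \sum_(j < 2 * M) okX (ki.1, ki.2, j))%N.
  by rewrite -(pair_bigA _ (fun k i => \sum_(j < 2 * M) okX (k, i, j))%N).
rewrite pair_bigA /=; apply: eq_bigr => -[[k i] j] _ /=.
by rewrite -[(k, i, j) \in _]/(okX (k, i, j)); case: (okX _).
Qed.
End RepresentationCount.

(** * The class number formula *)

Section ClassNumberFormula.
Variables (L : fieldExtType rat) (s : L) (p m N : nat).
Hypotheses (s2 : s ^+ 2 = (- p%:Z)%:~R) (s_gen : <<1; s>>%VS = fullv).
Hypotheses (p_prime : prime p) (pm : (p.+1 = 4 * m)%N) (p_gt4 : (4 < p)%N).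
Variable A : 'I_N -> int * int * int.
Hypothesis A_prim : forall k, primitive_triple m (A k).
Hypothesis A_rep : forall J, nonzero_ideal J -> exists k,
  ideal_equiv (primitive_ideal s (A k)) J /\
    forall k', ideal_equiv (primitive_ideal s (A k')) J -> k' = k.

Let m_gt0 : (0 < m)%N.
Proof. by move: pm; case: (m) => //; rewrite muln0. Qed.

Let a_gt0 k : 0 < (A k).1.1. Proof. by case: (A_prim k). Qed.

Let abc k : (A k).1.1 * (A k).2 = (A k).1.2 ^+ 2 + (A k).1.2 + m%:Z.
Proof. by case: (A_prim k). Qed.

Let disc k : 4 * (A k).1.1 * (A k).2 - (2 * (A k).1.2 + 1) ^+ 2 = p%:Z.
Proof. by rewrite -mulrA abc (Posz_of_pm pm); ring. Qed.

Let p_gt0 : 0 < p%:Z. Proof. by rewrite ltz_nat prime_gt0. Qed.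

Let c_gt0 k : 0 < (A k).2.
Proof.
have h : 0 < 4 * (A k).1.1 * (A k).2.
  have := disc k; move/eqP; rewrite subr_eq => /eqP ->.
  by rewrite ltr_wpDr ?sqr_ge0.
by rewrite -(pmulr_rgt0 _ (_ : 0 < 4 * (A k).1.1)) // mulr_gt0.
Qed.

(** A sum dominates each of its terms, so this is one box constant for all the forms. *)
Let K : nat := \sum_(k < N) 4 * `|((A k).1.1 + (A k).2)%R|.

Let K_large k : 4 * ((A k).1.1 + (A k).2) <= K%:Z.
Proof.
have h : 0 < (A k).1.1 + (A k).2 by rewrite addr_gt0.
have -> : 4 * ((A k).1.1 + (A k).2) = (4 * `|((A k).1.1 + (A k).2)%R|)%N%:Z.
  by rewrite PoszM gez0_abs // ltW.
by rewrite lez_nat /K (bigD1 k) //= leq_addr.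
Qed.

Let K_gt0 : (0 < N)%N -> (0 < K)%N.
Proof.
move=> N0; have := K_large (Ordinal N0); rewrite -ltz_nat; apply: lt_le_trans.
by rewrite mulr_gt0 // addr_gt0.
Qed.

Let T (k : 'I_N) (Y : nat) : int :=
  lattice_sum (A k).1.1 (2 * (A k).1.2 + 1) (A k).2 K Y.

Let form_box k Y (x y : int) : (0 < Y)%N ->
  ((K * Y)%N%:Z <= `|x|) || ((K * Y)%N%:Z <= `|y|) ->
  (Y ^ 2)%N%:Z < class_form A k x y.
Proof.
move=> Y0 hxy.
have d0 : 0 < 4 * (A k).1.1 * (A k).2 - (2 * (A k).1.2 + 1) ^+ 2 by rewrite disc.
have := @qf_box _ _ _ (a_gt0 k) (c_gt0 k) d0 K Y%:Z x y (K_large k) isT.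
rewrite -PoszM => /(_ hxy); rewrite PoszX; apply: lt_le_trans.
have : 0 < Y%:Z ^+ 2 by rewrite exprn_gt0.
by move: (Y%:Z ^+ 2) => t; lia.
Qed.

Let form_ge0 k x y : 0 <= class_form A k x y.
Proof.
have [[-> ->]|xy0] := eqVneq (x, y) (0, 0).
  by rewrite /class_form /qf expr0n /= !mulr0 !addr0.
exact: ltW (qf_gt0 p_prime pm (a_gt0 k) (abc k) xy0).
Qed.

Let level_count (k : 'I_N) (M : nat) (n : nat) : nat :=
  \sum_(i < 2 * M) \sum_(j < 2 * M)
     (class_form A k (i%:Z - M%:Z) (j%:Z - M%:Z) == n%:Z).

Let level_count0 k M : (0 < M)%N -> level_count k M 0 = 1%N.
Proof.
move=> M0; have M2 : (M < 2 * M)%N by rewrite mul2n -addnn -{1}[M]addn0 ltn_add2l.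
have z0 (i j : 'I_(2 * M)) : (class_form A k (i%:Z - M%:Z) (j%:Z - M%:Z) == 0%N%:Z)
    = (i == Ordinal M2) && (j == Ordinal M2).
  apply/eqP/andP => [E|[/eqP -> /eqP ->]]; last first.
    by rewrite /= subrr /class_form /qf expr0n /= !mulr0 !addr0.
  have [[hi hj]|xy0] := eqVneq (i%:Z - M%:Z, j%:Z - M%:Z) (0, 0); last first.
    by have := qf_gt0 p_prime pm (a_gt0 k) (abc k) xy0; rewrite -/(class_form A k _ _) E ltxx.
  by split; apply/eqP/val_inj => /=; [clear -hi|clear -hj]; lia.
rewrite /level_count (bigD1 (Ordinal M2)) //= (bigD1 (Ordinal M2)) //=.
rewrite (z0 (Ordinal M2) (Ordinal M2)) !eqxx big1 ?big1 //.
- by move=> i iM; rewrite big1 // => j _; rewrite z0 (negPf iM).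
- by move=> j jM; rewrite (z0 (Ordinal M2)) (negPf jM) andbF.
Qed.

Let lattice_sum_levels k Y : (0 < Y)%N -> T k Y =
  \sum_(n < (Y ^ 2).+1) (level_count k (K * Y) n)%:Z * pos3 ((Y ^ 2)%N%:Z - n%:Z).
Proof.
move=> Y0; rewrite /T /lattice_sum /zsum2 /zsum.
have E i j : pos3 (Y%:Z ^+ 2 - class_form A k i j) =
  \sum_(n < (Y ^ 2).+1) (class_form A k i j == n%:Z)%:R * pos3 ((Y ^ 2)%N%:Z - n%:Z).
  by rewrite -PoszX; apply: pos3_levels; apply: form_ge0.
under eq_bigr => i _ do under eq_bigr => j _ do rewrite -/(class_form A k _ _) E.
under eq_bigr => i _ do rewrite exchange_big /=.
rewrite exchange_big /=; apply: eq_bigr => n _.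
under eq_bigr => i _ do rewrite -mulr_suml.
rewrite -mulr_suml /level_count; congr (_ * _).
rewrite (big_morph Posz PoszD erefl); apply: eq_bigr => i _.
rewrite (big_morph Posz PoszD erefl); apply: eq_bigr => j _.
by rewrite natz.
Qed.

Let chi_ := chi p.

Let chi0 : chi_ 0%N = 0. Proof. by rewrite /chi_ /chi leg0. Qed.

(** The theta series of the classes add up to an Eisenstein series of weight 1; this is that
    identity paired with the cubic weight. The origin, the constant term of each theta series,
    accounts for [N * X ^ 3] with [X = Y ^ 2]. *)
Let theta_identity Y R : (0 < N)%N -> (0 < Y)%N -> (Y ^ 2 < R)%N ->
  \sum_k T k Y = N%:Z * Y%:Z ^+ 6 + 2 * chi_riesz chi_ (Y ^ 2) R.
Proof.
move=> N0 Y0 YR.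
under eq_bigr => k _ do rewrite lattice_sum_levels //.
rewrite exchange_big /= big_ord_recl /=; congr (_ + _).
  under eq_bigr => k _ do rewrite level_count0 ?muln_gt0 ?K_gt0 // mul1r subr0.
  rewrite sumr_const card_ord -mulr_natl natz pos3_ge0 // PoszX; ring.
rewrite chi_riesz_divisors // mulr_sumr; apply: eq_bigr => n _.
rewrite /bump /= add1n -mulr_suml mulrA; congr (_ * _).
rewrite -(ideal_countE p_prime pm) //.
rewrite -(representation_count s2 s_gen p_prime pm p_gt4 A_prim A_rep (n := n.+1) (M := K * Y)) //.
  by rewrite -(big_morph Posz PoszD erefl).
move=> k x y h; apply: le_lt_trans (form_box k Y0 h).
by rewrite lez_nat.
Qed.

Lemma chi_le1 n : `|chi p n| <= 1.
Proof.
rewrite /chi; have [->|x0] := eqVneq (n%:R : 'F_p) 0; first by rewrite leg0.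
by case: (leg_values x0) => ->.
Qed.

Theorem class_number_moment : (0 < N)%N ->
  p%:Z * N%:Z + first_moment p (chi p) = 0.
Proof.
move=> N0.
have p4 := mod4_of_pm pm.
have chi_per n : chi p (n + p)%N = chi p n.
  by rewrite /chi natrD pchar_Fp_0 // addr0.
have chi_sum : \sum_(a < p) chi p a = 0 by apply: leg_sum_nat.
have [C1 HC1] := chi_riesz_doubling (prime_gt0 p_prime) chi_per chi_sum chi_le1 chi0.
have [C2 HC2] : exists C2 : 'I_N -> int, forall k Y, (0 < Y)%N ->
    `|256 * T k Y - T k (2 * Y)| <= C2 k * Y%:Z ^+ 5.
  have [C2 HC2] : {C2 : 'I_N -> int & forall k Y, (0 < Y)%N ->
    `|256 * T k Y - T k (2 * Y)| <= C2 k * Y%:Z ^+ 5}; last by exists C2.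
  apply: (@boolp.choice _ _ (fun k C => forall Y, (0 < Y)%N ->
    `|256 * T k Y - T k (2 * Y)| <= C * Y%:Z ^+ 5)) => k.
  by apply: lattice_sum_doubling => //; rewrite disc.
pose C := \sum_k C2 k.
(* With [Y = Z ^ 4] both estimates refer to [X = Z ^ 8]: the lattice error is
   [O(Y ^ 5) = O(Z ^ 20)]. The constant [192 = 256 - 64] is twice the 96 of the character sum. *)
have main Z : (p < Z)%N ->
  `|192 * (p%:Z * N%:Z + first_moment p (chi p)) * Z%:Z ^+ 24|
    <= p%:Z * (C * Z%:Z ^+ 20) + 2 * (C1 * Z%:Z ^+ 23).
  move=> pZ; have Z0 : (0 < Z)%N by apply: leq_ltn_trans pZ.
  have Y0 : (0 < Z ^ 4)%N by rewrite expn_gt0 Z0.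
  pose R := (4 * Z ^ 8).+1.
  have h1 := HC1 Z R pZ (leqnn _).
  have thetaY : \sum_k T k (Z ^ 4) = N%:Z * Z%:Z ^+ 24 + 2 * chi_riesz chi_ (Z ^ 8) R.
    rewrite (@theta_identity _ R) //; last by rewrite -expnM ltnS leq_pmull.
    by rewrite -expnM PoszX -exprM.
  have theta2Y : \sum_k T k (2 * Z ^ 4) = 64 * (N%:Z * Z%:Z ^+ 24) + 2 * chi_riesz chi_ (4 * Z ^ 8) R.
    have YY0 : (0 < 2 * Z ^ 4)%N by rewrite muln_gt0 Y0.
    rewrite (@theta_identity _ R) //; last by rewrite expnMn -expnM.
    by rewrite expnMn -expnM PoszM PoszX exprMn -exprM; ring.
  have h2 : `|256 * (\sum_k T k (Z ^ 4)) - \sum_k T k (2 * Z ^ 4)| <= C * Z%:Z ^+ 20.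
    rewrite mulr_sumr -sumrB mulr_suml; apply: le_trans (ler_norm_sum _ _ _) _.
    apply: ler_sum => k _; apply: le_trans (HC2 k _ Y0) _.
    by rewrite PoszX -exprM.
  set V := 256 * chi_riesz (chi p) (Z ^ 8) R - chi_riesz (chi p) (4 * Z ^ 8) R in h1.
  set W1 := 256 * _ - _ in h2; set W2 := p%:Z * V - _ in h1.
  have EQ : 192 * (p%:Z * N%:Z + first_moment p (chi p)) * Z%:Z ^+ 24 = p%:Z * W1 - 2 * W2.
    by rewrite /W1 /W2 thetaY theta2Y /V /chi_; ring.
  have h3 : `|p%:Z * W1 - 2 * W2| <= p%:Z * (C * Z%:Z ^+ 20) + 2 * (C1 * Z%:Z ^+ 23).
    apply: le_trans (ler_normB _ _) _; apply: lerD.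
      by rewrite normrM ger0_norm // ler_wpM2l.
    by rewrite normrM ger0_norm // ler_wpM2l.
  by move: h3; rewrite -EQ.
(* A nonzero integer [E] would make the left side at least [192 * Z ^ 24], against the bound
   [D * Z ^ 23]; any [Z] larger than [D] and [p] is contradictory. *)
apply/eqP; apply: contraT => E0.
set E := _ + _ in main E0.
set D := p%:Z * `|C| + 2 * `|C1|.
have D0 : 0 <= D by rewrite addr_ge0 // mulr_ge0 // ltW.
pose Z := (p + `|D|).+1%N.
have pZ : (p < Z)%N by rewrite ltnS leq_addr.
have := main Z pZ; rewrite leNgt => /negP[].
have DZ : D < Z%:Z by rewrite -(gez0_abs D0) ltz_nat ltnS leq_addl.
have Z23 : 0 < Z%:Z ^+ 23 by rewrite exprn_gt0.
apply: (@le_lt_trans _ _ (D * Z%:Z ^+ 23)).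
  rewrite [leRHS]mulrDl -[X in _ <= X + _]mulrA -[X in _ <= _ + X]mulrA; apply: lerD; apply: ler_wpM2l => //.
    apply: (@le_trans _ _ (`|C| * Z%:Z ^+ 20)).
      by rewrite ler_wpM2r ?ler_norm // exprn_ge0.
    by rewrite ler_wpM2l // ler_weXn2l.
  by rewrite ler_wpM2r ?ler_norm // ltW.
apply: (@lt_le_trans _ _ (Z%:Z * Z%:Z ^+ 23)); first by rewrite ltr_pM2r.
rewrite -exprS normrM [`|Z%:Z ^+ 24|]ger0_norm ?exprn_ge0 // ler_peMl ?exprn_ge0 //.
by clear -E0; lia.
Qed.
End ClassNumberFormula.

(** The whole ring is the Hermite form [(1, 1, 0)]. Its class shows that the class number is
    positive. *)
Lemma nonzero_ideal_exists (L : fieldExtType rat) (s : L) (p m : nat) :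
  s ^+ 2 = (- p%:Z)%:~R -> <<1; s>>%VS = fullv -> prime p -> (p.+1 = 4 * m)%N ->
  exists J : classical_sets.set L, nonzero_ideal J.
Proof.
move=> s2 s_gen p_prime pm.
have w : wideal m (span2 (1%N%:Z * 1%N%:Z, 0) (1%N%:Z * 0%N%:Z, 1%N%:Z)).
  by apply: wideal_hnf.
exists (kset s (span2 (1%N%:Z * 1%N%:Z, 0) (1%N%:Z * 0%N%:Z, 1%N%:Z))).
exact: (wideal_nonzero_ideal s2 s_gen p_prime pm (f := in_alg L) (fun=> erefl) w).
Qed.

Theorem theorem4p6 (p : nat) (v : int) (L : fieldExtType rat) (N h : nat)
  (p_prime : prime p) (p_mod4 : (p = 3 %[mod 4])%N) (p_neq3 : p <> 3%N)
  (v_prim : primitive_root_mod p v)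
  (L_field : is_Q_sqrt L (- p%:Z))
  (N_class : is_class_number L N)
  (h_prime : prime h) (h_odd : odd h) (h_dvd : (h %| N)%N) :
  (\sum_(i < p.-1 | ~~ odd (residue_pow p v (- i%:Z))) (-1) ^+ i : int) <> 0 /\
  ((\sum_(i < p.-1 | ~~ odd (residue_pow p v (- i%:Z))) (-1) ^+ i : int)
     = 0 %[mod h])%Z.
Proof.
have [s s2 s_gen] := L_field.
have [m pm] : exists m, (p.+1 = 4 * m)%N by exists (p.+1 %/ 4)%N; lia.
have p_gt4 : (4 < p)%N by have := prime_gt1 p_prime; lia.
have [A [A_prim A_rep]] := class_reps s2 s_gen p_prime pm N_class.
have N_gt0 : (0 < N)%N.
  have [J nJ] := nonzero_ideal_exists s2 s_gen p_prime pm.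
  by have [k _] := A_rep J nJ; apply: leq_ltn_trans (ltn_ord k).
have moment := class_number_moment s2 s_gen p_prime pm p_gt4 A_prim A_rep N_gt0.
rewrite (signed_residue_sum p_prime p_mod4 v_prim).
set S := \sum_(a < p | _) _.
pose c := chi p 2.
have c1 : c = 1 \/ c = -1.
  apply: leg_values; rewrite -(dvdn_pcharf (pchar_Fp p_prime)).
  by apply/negP => /dvdn_leq; lia.
(* The factor [2 * c - 1] is 1 or [-3], according as 2 is a square modulo [p] or not. It is never 0,
   so the sum is a nonzero multiple of [N]. *)
have SE : S = N%:Z * (2 * c - 1).
  have ph : p = (p./2).*2.+1 by rewrite -[LHS]odd_double_half (p_odd p_mod4).
  have chi0 : chi p 0 = 0 by rewrite /chi leg0.
  have chiN b : (b <= p)%N -> chi p (p - b) = - chi p b.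
    by move=> bp; rewrite /chi natrB // pchar_Fp_0 // sub0r legN.
  have chi2 b : chi p b.*2 = c * chi p b by rewrite -mul2n (chiM p_prime pm).
  have cc : c * c = 1 by case: c1 => ->.
  have := moment_even_sum ph chi0 chiN chi2 cc; rewrite -/S => E.
  have p0 : p%:Z != 0 by rewrite eqz_nat -lt0n prime_gt0.
  apply: (mulfI p0); rewrite -E.
  have -> : first_moment p (chi p) = - (p%:Z * N%:Z).
    by apply/eqP; rewrite -addr_eq0 addrC moment.
  ring.
split.
  by rewrite SE; case: c1 => ->; apply/eqP; rewrite mulf_neq0 // eqz_nat -lt0n.
apply/eqP; rewrite eqz_mod_dvd subr0 SE; apply: dvdz_mulr.
by rewrite dvdzE.
Qed.
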